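(* Let $h,k,\ell\in\mathbb{N}$ be fixed, let $\theta_k,\theta_{k-1}\in(0,1]$ be exponents of distribution for $d_k(n)$ and $d_{k-1}(n)$ respectively, and let $0<A\leq 1$ and $0<B<\min(\theta_k,A\theta_{k-1})$ be fixed. Then, as $x\to\infty$, $$\sum_{n\leq x}d_k(n+h,A)\,d_{\ell}(n,B)=\frac{A^{k-1}B^{\ell-1}C_{k,\ell}f_{k,\ell}(h)}{(k-1)!(\ell-1)!}\,x\log^{k+\ell-2} x+O_{A,B,h,k,\ell}\left(x \log^{k+\ell-3}x\right).$$
   Context: $\mathbb{N}$ denotes the positive integers, and $(m,n)$ denotes the greatest common divisor. $d_k(n)$ is the number of ways of writing $n$ as an ordered product of $k$ positive integer factors (so $d_1(n)=1$, and $d_0(n)=1$ if $n=1$ and $0$ otherwise). For $A\in(0,1]$, $$d_k(n,A)=\sum_{\substack{q\mid n\\ q\leq n^A}}d_{k-1}(q).$$ The constants are $$C_{k,\ell}=\prod_p\left( \left(1-p^{-1}\right)^{\ell-1}+\left(1-p^{-1}\right)^{k-1}-\left(1-p^{-1}\right)^{k+\ell-2}\right)$$ (product over all primes) and, writing $h=\prod_p p^{\gamma}$ with $\gamma=\gamma(p)$ the exponent of $p$ in $h$, $$f_{k,\ell}(h)=\prod_{p\mid h} \frac{(1-p^{-1})\sum_{\alpha=0}^{\gamma}d_{\ell-1}(p^{\alpha})\sum_{\beta=\alpha}^{\infty}d_k(p^{\beta})p^{-\beta}+d_k(p^{\gamma})\sum_{\alpha=\gamma+1}^{\infty}d_{\ell-1}(p^{\alpha})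 p^{-\alpha}}{(1-p^{-1})^{1-k}+(1-p^{-1})^{1-\ell}-1}.$$ Exponent of distribution: for $g\in\mathbb{N}$, a real number $0<\theta_{g,k}\leq 1$ is an exponent of distribution for $d_k(n)$ (with respect to $g$) if for every fixed $\epsilon>0$ there is a fixed $\delta>0$ such that for every $q\leq x^{\theta_{g,k}-\epsilon}$ and each residue class $h\not\equiv 0\pmod q$ with $(h,q)=g$, $$\sum_{\substack{n\leq x\\ n\equiv h \pmod q}} d_k(n)= \frac{1}{\phi(q/g)}\,\mathrm{Res}\left(\frac{x^{s}}{s}\sum_{(n,q)=g}\frac{d_k(n)}{n^s},\ s=1\right)+O_{\epsilon,\delta,k}\left(\frac{x^{1-\delta}}{\phi(q/g)}\right),$$ where $\phi$ is Euler's function and the Dirichlet series is meromorphically continued to a neighbourhood of $s=1$. Convention: $\theta_k$ denotes a single number that is an exponent of distribution for $d_k(n)$ for all $g$ simultaneously, i.e. one may take $\theta_{g,k}=\theta_k$ for every $g$. *)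

(* Defs.v *)
From mathcomp Require Import all_boot all_order all_algebra.
From mathcomp Require Import complex.
From mathcomp Require Import all_classical all_reals all_analysis.

Set Implicit Arguments.
Unset Strict Implicit.
Unset Printing Implicit Defensive.

Import Order.TTheory GRing.Theory Num.Theory.
Import numFieldNormedType.Exports.

Local Open Scope classical_set_scope.
Local Open Scope ring_scope.
Local Open Scope complex_scope.

(* Meaningful for n > 0 only: then the factors of n are automatically positive
   and at most n. *)
Definition divisor_fun (k n : nat) : nat :=
  #|[pred t : {ffun 'I_k -> 'I_n.+1} | (\prod_(i < k) t i)%N == n]|.

(* d_k(n, A), for k > 0. *)
Definition partial_divisor_fun (R : realType) (k n : nat) (A : R) : nat :=
  \sum_(q <- divisors n | q%:R <= n%:R `^ A) divisor_fun (k - 1) q.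

Definition singular_constant (R : realType) (k l : nat) : R :=
  lim ((fun N : nat => \prod_(0 <= p < N | prime p)
          ((1 - p%:R^-1) ^+ (l - 1) + (1 - p%:R^-1) ^+ (k - 1)
           - (1 - p%:R^-1) ^+ (k + l - 2) : R)) @ \oo).

Definition local_factor_num (R : realType) (k l p gamma : nat) : R :=
  (1 - p%:R^-1)
    * (\sum_(0 <= alpha < gamma.+1)
         (divisor_fun (l - 1) (p ^ alpha))%:R
         * lim ((fun N : nat => \sum_(alpha <= beta < N)
                   ((divisor_fun k (p ^ beta))%:R * p%:R ^- beta : R)) @ \oo))
  + (divisor_fun k (p ^ gamma))%:R
    * lim ((fun N : nat => \sum_(gamma.+1 <= alpha < N)
              ((divisor_fun (l - 1) (p ^ alpha))%:R * p%:R ^- alpha : R)) @ \oo).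

Definition singular_factor (R : realType) (k l h : nat) : R :=
  \prod_(p <- primes h)
    (local_factor_num R k l p (logn p h)
     / ((1 - p%:R^-1) ^ (1 - k%:Z) + (1 - p%:R^-1) ^ (1 - l%:Z) - 1)).

Section ComplexAnalysis.
Variable R : realType.
Implicit Types (c r s : R[i]) (f F : R[i] -> R[i]).

(* x^s = e^(s ln x), for x > 0. *)
Definition cpow (x : R) s : R[i] :=
  let: sigma +i* t := s in
  (x `^ sigma * cos (t * ln x)) +i* (x `^ sigma * sin (t * ln x)).

(* f(z) = sum_(j >= -N) a_j (z - c)^j on a punctured neighbourhood of c; in
   particular f is meromorphic at c.  The regular type [R[i]^o] carries the
   topology of the modulus. *)
Definition laurent_expansion f c (a : int -> R[i]) : Prop :=
  exists N : nat,
    (forall j : int, j < - N%:Z -> a j = 0)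
    /\ \forall z \near (c : R[i]^o)^',
         (fun n : nat => \sum_(0 <= m < n)
            a (m%:Z - N%:Z) * (z - c) ^ (m%:Z - N%:Z) : R[i]^o) @ \oo
         --> (f z : R[i]^o).

(* The residue at 1 of the meromorphic continuation to a neighbourhood of 1 of
   a function F whose values matter on the half-plane Re s > 1 only; it is
   unique when it exists, by the identity theorem. *)
Definition is_residue1 F r : Prop :=
  exists f, (forall s, 1 < complex.Re s -> f s = F s)
    /\ exists a, laurent_expansion f 1 a /\ r = a (-1).

Definition residue1 F : R[i] := xget 0 [set r | is_residue1 F r].

(* The sum over n >= 1 with gcd(n, q) = g of d_k(n) n^(-s), for Re s > 1. *)
Definition divisor_dirichlet_series (k q g : nat) s : R[i] :=
  lim ((fun N : nat => \sum_(1 <= n < N | gcdn n q == g)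
          (divisor_fun k n)%:R * cpow n%:R (- s) : R[i]^o) @ \oo).

Definition divisor_main_term (k q g : nat) (x : R) : R[i] :=
  residue1 (fun s => cpow x s / s * divisor_dirichlet_series k q g s).

(* The residue class modulo q is represented by a natural number b.  The
   constant K is uniform in x, q and b. *)
Definition exponent_of_distribution_wrt (g k : nat) (theta : R) : Prop :=
  0 < theta <= 1 /\
  forall eps : R, 0 < eps ->
  exists2 delta : R, 0 < delta &
  exists K : R, forall (x : R) (q b : nat),
    1 <= x -> (0 < q)%N -> q%:R <= x `^ (theta - eps) ->
    b <> 0 %[mod q] -> gcdn b q = g ->
    `| (\sum_(1 <= n < (Num.truncn x).+1 | (n == b %[mod q])%N)
           divisor_fun k n)%:R
       - (totient (q %/ g))%:R^-1 * divisor_main_term k q g x |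
    <= (K * (x `^ (1 - delta) / (totient (q %/ g))%:R))%:C.

Definition exponent_of_distribution (k : nat) (theta : R) : Prop :=
  forall g : nat, (0 < g)%N -> exponent_of_distribution_wrt g k theta.

End ComplexAnalysis.

(* Main.v *)
Require Import Defs.
From mathcomp Require Import all_boot all_order all_algebra.
From mathcomp Require Import all_classical all_reals all_analysis.
From mathcomp Require Import complex cyclic zify ring lra.
Import Order.TTheory GRing.Theory Num.Theory.
Import numFieldNormedType.Exports.
Local Open Scope ring_scope.

Set Implicit Arguments.
Unset Strict Implicit.
Unset Printing Implicit Defensive.

(* Opening d_l(n, B) as a sum over q | n with q <= n^B reduces the problem to
   sums of d_k(m, A) over m = h mod q.  For classes b, b' with (b, q) = (b', q)
   the hypotheses give the same main term, so it cancels in the difference of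
   the two progressions and its value (a residue) is never needed.  To pass
   from d_k(m) to d_k(m, A), a divisor r > m^A is traded for its cofactor
   s < m^(1 - A); for fixed s the variable r runs over an interval on which
   q < r^(B/A), which is where B < A theta_(k-1) enters.  Hence the sum over
   m = h mod q may be replaced by the mean over all m with (m, q) = (h, q),
   up to a power saving.

   Sieving the condition (m, q) = (h, q), the means add up to x times
     W = sum of d_(l-1)(q) d_(k-1)(r) / [q, r]
   over q <= x^B, r <= x^A, (q, r) | h.  With the coefficients g_h defined by
   sum_(d | n) g_h(d) = n [n | h], W becomes a sum over d of g_h(d) times a
   product of two sums of d_j(q)/q over the multiples q of d, each asymptotic
   to c_j(d) log^j / j!.  So W is asymptotic to a power of log x times
   sum_d g_h(d) c_(l-1)(d) c_(k-1)(d), and the Euler product of this series is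
   C_(k,l) f_(k,l)(h). *)

(** * Divisor sums and the functions d_k *)

(** The error allowed is only one logarithm below the main term, which rules out crude bounds in the
    sieve. With A = 1 the variable r runs up to x, and bounding each rounding error by 1 would cost
    a divisor function of q and with it extra logarithms. Bounded instead by (y / m)^(1/2), the
    rounding errors leave the factor sum_(e | q) e^(-1/2), bounded on average over q, and a sum over
    r weighted by (r / x)^(1/2), which saves a logarithm. The same weight majorises the loss in
    replacing the moving cut-offs q <= n^B and r <= m^A by q <= x^B and r <= x^A.

    The distribution hypotheses exclude the class 0 mod q. It matters only when q | h, and then the
    class of h is the only one with (m, q) = (h, q), so there is nothing to average. Their delta and
    K may depend on g; fixing s turns g into g / (s, q), still at most h, so finitely many g occur
    and the constants can be taken uniform.

    The sums over q carry weights log^i (Q / q) / i!: opening d_(j+1) as a divisor sum and summing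
    over the cofactor raises i by one. *)

Section DivisorSums.
Variable V : nmodType.
Implicit Types (F : nat -> V) (f : nat -> nat -> V).

Lemma big_divisors F n M : (0 < n < M)%N ->
  \sum_(d <- divisors n) F d = \sum_(1 <= d < M | (d %| n)%N) F d.
Proof.
move=> /andP[n0 nM]; rewrite -[RHS]big_filter; apply: perm_big.
apply: uniq_perm; [exact: divisors_uniq|exact/filter_uniq/iota_uniq|] => d.
rewrite mem_filter mem_index_iota -dvdn_divisors //.
case: (boolP (d %| n)%N) => //= dn; apply/esym/andP; split.
  exact: dvdn_gt0 dn.
exact: leq_ltn_trans (dvdn_leq n0 dn) nM.
Qed.

Lemma sum_multiples F d M : (0 < d)%N ->
  \sum_(1 <= n < M | (d %| n)%N) F n = \sum_(1 <= e < M | (d * e < M)%N) F (d * e)%N.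
Proof.
move=> d0; rewrite -[LHS]big_filter -[RHS]big_filter -(big_map (muln d) predT F).
apply: perm_big; apply: uniq_perm.
- exact/filter_uniq/iota_uniq.
- rewrite map_inj_uniq; first exact/filter_uniq/iota_uniq.
  by move=> a b /eqP; rewrite eqn_pmul2l // => /eqP.
move=> n; rewrite mem_filter mem_index_iota; apply/idP/mapP.
  move=> /and3P[/dvdnP[e ->] e0 eM]; exists e; last by rewrite mulnC.
  rewrite mem_filter mem_index_iota mulnC eM /=; nia.
move=> [e]; rewrite mem_filter mem_index_iota => /and3P[eM e0 _] ->.
by rewrite dvdn_mulr //= eM; nia.
Qed.

Lemma sum_multiples_all F d M : (0 < d)%N -> (forall n, (M <= n)%N -> F n = 0) ->
  \sum_(1 <= n < M | (d %| n)%N) F n = \sum_(1 <= e < M) F (d * e)%N.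
Proof.
move=> d0 F0; rewrite sum_multiples // [LHS]big_mkcond /=.
by apply: eq_bigr => e _; case: ltnP => // h; rewrite F0.
Qed.

Lemma sum_divisors_swap f M :
  \sum_(1 <= n < M) \sum_(d <- divisors n) f d n =
  \sum_(1 <= d < M) \sum_(1 <= n < M | (d %| n)%N) f d n.
Proof.
rewrite [RHS](eq_bigr (fun d => \sum_(1 <= n < M) if (d %| n)%N then f d n else 0)); last first.
  by move=> d _; rewrite -big_mkcond.
rewrite exchange_big_nat /=; rewrite big_nat_cond [RHS]big_nat_cond.
apply: eq_bigr => n /andP[nM _].
by rewrite -big_mkcond (big_divisors (fun d => f d n) nM).
Qed.

Lemma divn_divnK n d : (0 < n)%N -> (d %| n)%N -> (n %/ (n %/ d))%N = d.
Proof.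
move=> n0 dn; have d0 := dvdn_gt0 n0 dn.
by rewrite -{1}(divnK dn) mulKn // divn_gt0 // dvdn_leq.
Qed.

Lemma dvdn_divn n d : (d %| n)%N -> (n %/ d %| n)%N.
Proof. by move=> dn; apply/dvdnP; exists d; rewrite mulnC divnK. Qed.

Lemma sum_divisors_inv F n : (0 < n)%N ->
  \sum_(d <- divisors n) F d = \sum_(d <- divisors n) F (n %/ d)%N.
Proof.
move=> n0; rewrite -(big_map (divn n) predT F); apply: perm_big.
apply: uniq_perm; first exact: divisors_uniq.
  rewrite map_inj_in_uniq ?divisors_uniq // => a b.
  rewrite -!dvdn_divisors // => an bn e.
  by rewrite -(divn_divnK n0 an) e divn_divnK.
move=> d; rewrite -dvdn_divisors //; apply/idP/mapP.
  by move=> dn; exists (n %/ d)%N; rewrite ?divn_divnK // -dvdn_divisors // dvdn_divn.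
by move=> [e]; rewrite -dvdn_divisors // => en ->; rewrite dvdn_divn.
Qed.

End DivisorSums.

(** The recursive form of d_k, on which all inductions run; for n > 0 it agrees with the count of
    factorisations by [divisor_funE]. *)
Fixpoint divk (k n : nat) : nat :=
  if k is k'.+1 then (\sum_(d <- divisors n) divk k' d)%N else (n == 1)%N.

(** The range M of the factors is kept independent of n: splitting off the first factor a leaves a
    factorisation of n / a whose factors still range up to M, so the induction hypothesis
    applies. *)
Lemma card_factorizations k n M : (0 < n <= M)%N ->
  #|[pred t : {ffun 'I_k -> 'I_M.+1} | (\prod_(i < k) t i)%N == n]| = divk k n.
Proof.
elim: k n => [|k IH] n nM /=.
  have [->|n1] := eqVneq n 1%N.
    rewrite (eq_card (B := predT)); last by move=> t; rewrite !inE big_ord0.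
    by rewrite card_ffun !card_ord expn0.
  rewrite (eq_card (B := pred0)) ?card0 // => t.
  by rewrite !inE big_ord0 eq_sym (negbTE n1).
rewrite -sum1_card.
pose g (p : 'I_M.+1 * {ffun 'I_k -> 'I_M.+1}) : {ffun 'I_k.+1 -> 'I_M.+1} :=
  [ffun i => if unlift ord0 i is Some j then p.2 j else p.1].
pose g' (t : {ffun 'I_k.+1 -> 'I_M.+1}) : 'I_M.+1 * {ffun 'I_k -> 'I_M.+1} :=
  (t ord0, [ffun j => t (lift ord0 j)]).
rewrite (reindex g) /=; last first.
  exists g'.
    move=> [a t] _; rewrite /g /g' ffunE unlift_none /=; congr (_, _).
    by apply/ffunP => j; rewrite !ffunE liftK.
  move=> t _; apply/ffunP => i; rewrite ffunE /=.
  by case: unliftP => [j ->|->] //; rewrite ffunE.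
rewrite (eq_bigl (fun p : 'I_M.+1 * {ffun 'I_k -> 'I_M.+1} =>
    (p.1 * \prod_(i < k) p.2 i)%N == n)); last first.
  move=> [a t]; rewrite inE big_ord_recl ffunE unlift_none /=; congr (_ == _).
  by congr muln; apply: eq_bigr => i _; rewrite ffunE liftK.
rewrite big_mkcond /=.
rewrite -(pair_bigA _ (fun (a : 'I_M.+1) (t : {ffun 'I_k -> 'I_M.+1}) =>
  if (a * \prod_(i < k) t i)%N == n then 1%N else 0%N)) /=.
have n0 : (0 < n)%N by case/andP: nM.
rewrite (eq_bigr (fun a : 'I_M.+1 => if (a %| n)%N then divk k (n %/ a) else 0%N)); last first.
  move=> a _; case: ifP => an; last first.
    rewrite big1 // => t _; case: eqP => // e.
    by move: an; rewrite -e dvdn_mulr.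
  have a0 := dvdn_gt0 n0 an.
  rewrite -IH; last by rewrite divn_gt0 // dvdn_leq //=; apply: leq_trans (leq_div _ _) _; case/andP: nM.
  rewrite -sum1_card -big_mkcond; apply: eq_bigl => t; rewrite inE /=.
  by rewrite -{1}(divnK an) mulnC eqn_pmul2r.
rewrite -(big_mkord predT (fun a => if (a %| n)%N then divk k (n %/ a) else 0%N)).
rewrite big_ltn // dvd0n (gtn_eqF n0) add0n -big_mkcond.
rewrite [RHS](sum_divisors_inv (V := nat)) //.
by rewrite (big_divisors (V := nat) (fun d => divk k (n %/ d)) (M := M.+1)) // n0 ltnS; case/andP: nM.
Qed.

Lemma divisor_funE k n : (0 < n)%N -> divisor_fun k n = divk k n.
Proof. by move=> n0; rewrite /divisor_fun card_factorizations // n0 leqnn. Qed.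

Lemma divkS k n : divk k.+1 n = (\sum_(d <- divisors n) divk k d)%N.
Proof. by []. Qed.

(** * Multiplicative functions *)

Lemma perm_divisorsM m n : (0 < m)%N -> (0 < n)%N -> coprime m n ->
  perm_eq (divisors (m * n)) [seq (d * e)%N | d <- divisors m, e <- divisors n].
Proof.
move=> m0 n0 mn.
(* The factors of d e are recovered as its gcds with m and n, which gives injectivity. *)
have K1 d e : (d %| m)%N -> (e %| n)%N -> gcdn (d * e) m = d.
  move=> dm en; rewrite gcdnC Gauss_gcdl; last exact: coprime_dvdr en mn.
  by apply/gcdn_idPr.
have K2 d e : (d %| m)%N -> (e %| n)%N -> gcdn (d * e) n = e.
  move=> dm en; rewrite gcdnC Gauss_gcdr; first by apply/gcdn_idPr.
  by apply: coprime_dvdr dm _; rewrite coprime_sym.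
apply: uniq_perm; first exact: divisors_uniq.
  apply: allpairs_uniq; try exact: divisors_uniq.
  move=> [d e] [d' e'] /allpairsP[[a b]] /= [] + + [-> ->].
  rewrite -!dvdn_divisors // => am bn.
  move=> /allpairsP[[a' b']] /= [] + + [-> ->].
  rewrite -!dvdn_divisors // => am' bn' E.
  by rewrite -(K1 a b) // E K1 // -(K2 a b) // E K2.
move=> x; rewrite -dvdn_divisors ?muln_gt0 ?m0 //; apply/idP/allpairsP.
  move=> xmn; exists (gcdn x m, gcdn x n) => /=.
  rewrite -!dvdn_divisors // !dvdn_gcdr; split=> //.
  apply/eqP; rewrite eqn_dvd; apply/andP; split.
    by rewrite muln_gcdl !muln_gcdr !dvdn_gcd xmn (dvdn_mulr _ (dvdnn x)) (dvdn_mull _ (dvdnn x)) dvdn_mulr.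
  rewrite Gauss_dvd ?dvdn_gcdl //.
  by apply: coprime_dvdl (dvdn_gcdr _ _) _; apply: coprime_dvdr (dvdn_gcdr _ _) _.
by move=> [[d e]] /= []; rewrite -!dvdn_divisors // => dm en ->; exact: dvdn_mul.
Qed.

Lemma prime_power_ind (P : nat -> Prop) : P 1%N ->
  (forall p a m, prime p -> (0 < a)%N -> (0 < m)%N -> coprime (p ^ a) m ->
     P m -> P (p ^ a * m)%N) ->
  forall n, (0 < n)%N -> P n.
Proof.
move=> P1 PM n; elim/ltn_ind: n => n IH n0.
have [n1|n1] := leqP n 1.
  by have -> : n = 1%N by apply/eqP; rewrite eqn_leq n1.
have pp := pdiv_prime n1; have [m cpm En] := pfactor_coprime pp n0.
set p := pdiv n in pp cpm En *.
have a0 : (0 < logn p n)%N by rewrite logn_gt0 mem_primes pp n0 pdiv_dvd.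
have m0 : (0 < m)%N by move: n0; rewrite En muln_gt0 => /andP[].
rewrite En mulnC; apply: PM => //; first exact: coprimeXl.
apply: IH => //; rewrite En -[X in (X < _)%N]muln1 ltn_pmul2l //.
by rewrite -(exp1n (logn p n)) ltn_exp2r // prime_gt1.
Qed.

Section Multiplicative.
Variable R : realType.
Implicit Types f g : nat -> R.

Definition multiplicative f := f 1%N = 1 /\
  forall m n, (0 < m)%N -> (0 < n)%N -> coprime m n -> f (m * n)%N = f m * f n.

Definition divsum f n : R := \sum_(d <- divisors n) f d.

Lemma multiplicative_divsum f : multiplicative f -> multiplicative (divsum f).
Proof.
move=> [f1 fM]; split; first by rewrite /divsum (_ : divisors 1 = [:: 1%N]) ?big_seq1.
move=> m n m0 n0 mn; rewrite /divsum (perm_big _ (perm_divisorsM m0 n0 mn)) /=.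
rewrite big_allpairs_dep /= big_distrl /=; apply: eq_big_seq => d.
rewrite -dvdn_divisors // => dm; rewrite big_distrr /=; apply: eq_big_seq => e.
rewrite -dvdn_divisors // => en; apply: fM.
- exact: dvdn_gt0 dm.
- exact: dvdn_gt0 en.
by apply: coprime_dvdl dm _; apply: coprime_dvdr en _.
Qed.

Lemma multiplicativeM f g : multiplicative f -> multiplicative g -> multiplicative (fun n => f n * g n).
Proof.
move=> [f1 fM] [g1 gM]; split; first by rewrite f1 g1 mulr1.
by move=> m n m0 n0 mn; rewrite fM // gM // mulrACA.
Qed.

Lemma multiplicative_nat : multiplicative (fun n => n%:R).
Proof. by split=> // m n _ _ _; rewrite natrM. Qed.

Lemma multiplicative_inv : multiplicative (fun n => n%:R^-1).
Proof. by split=> [|m n _ _ _]; rewrite ?natrM ?invfM ?invr1. Qed.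

Lemma multiplicative_totient : multiplicative (fun n => (totient n)%:R).
Proof. by split=> // m n _ _ mn; rewrite totient_coprime // natrM. Qed.

Lemma multiplicative_gcd h : multiplicative (fun n => (gcdn h n)%:R).
Proof.
split=> [|m n m0 n0 mn]; first by rewrite gcdn1.
rewrite -natrM; congr _%:R; apply/eqP; rewrite eqn_dvd; apply/andP; split.
  have xh := dvdn_gcdl h (m * n); have xmn := dvdn_gcdr h (m * n).
  by rewrite muln_gcdl !muln_gcdr !(dvdn_gcd (gcdn h (m * n))) !(dvdn_mulr _ xh) (dvdn_mull _ xh) xmn.
rewrite Gauss_dvd.
  by rewrite !dvdn_gcd !dvdn_gcdl /= (dvdn_mulr _ (dvdn_gcdr _ _)) (dvdn_mull _ (dvdn_gcdr _ _)).
by apply: coprime_dvdl (dvdn_gcdr _ _) _; apply: coprime_dvdr (dvdn_gcdr _ _) _.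
Qed.

Lemma multiplicative_dvd h : multiplicative (fun n => (n %| h)%N%:R).
Proof.
split=> [|m n m0 n0 mn]; first by rewrite dvd1n.
by rewrite Gauss_dvd // -mulnb natrM.
Qed.

Lemma multiplicative_eq1 : multiplicative (fun n => (n == 1)%N%:R).
Proof.
split=> // m n m0 n0 mn; rewrite -natrM mulnb; congr (nat_of_bool _)%:R.
by rewrite muln_eq1.
Qed.

Lemma multiplicative_le f g : multiplicative f -> multiplicative g ->
  (forall p a, prime p -> (0 < a)%N -> 0 <= f (p ^ a)%N <= g (p ^ a)%N) ->
  forall n, (0 < n)%N -> 0 <= f n <= g n.
Proof.
move=> [f1 fM] [g1 gM] fg; apply: prime_power_ind.
  by rewrite f1 g1 ler01 lexx.
move=> p a m pp a0 m0 cop /andP[IH1 IH2].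
have pa0 : (0 < p ^ a)%N by rewrite expn_gt0 prime_gt0.
have /andP[F1 F2] := fg p a pp a0.
by rewrite fM // gM // mulr_ge0 //= ler_pM.
Qed.

Lemma multiplicative_eq f g : multiplicative f -> multiplicative g ->
  (forall p a, prime p -> (0 < a)%N -> f (p ^ a)%N = g (p ^ a)%N) ->
  forall n, (0 < n)%N -> f n = g n.
Proof.
move=> [f1 fM] [g1 gM] fg; apply: prime_power_ind.
  by rewrite f1 g1.
move=> p a m pp a0 m0 cop IH.
have pa0 : (0 < p ^ a)%N by rewrite expn_gt0 prime_gt0.
by rewrite fM // gM // fg // IH.
Qed.

Lemma sum_divisors_pfactor f p a : prime p ->
  divsum f (p ^ a) = \sum_(0 <= i < a.+1) f (p ^ i)%N.
Proof.
move=> pp; rewrite /divsum -(big_map (expn p) predT f); apply: perm_big.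
apply: uniq_perm; first exact: divisors_uniq.
  rewrite map_inj_uniq ?iota_uniq // => i j /eqP.
  by rewrite eqn_exp2l ?prime_gt1 // => /eqP.
move=> d; rewrite -dvdn_divisors ?expn_gt0 ?prime_gt0 //; apply/idP/mapP.
  move=> dpa; have /(dvdn_pfactor _ _ pp) [i ia ->] := dpa; exists i => //.
  by rewrite mem_index_iota ltnS ia.
by case=> i ia ->; apply: dvdn_exp2l; move: ia; rewrite mem_index_iota ltnS.
Qed.

Definition prime_product (F : nat -> nat -> R) n : R :=
  \prod_(p <- primes n) F p (logn p n).

Lemma multiplicative_prime_product F : multiplicative (prime_product F).
Proof.
split; first by rewrite /prime_product big_nil.
move=> m n m0 n0 mn; rewrite /prime_product.
have -> : \prod_(p <- primes (m * n)) F p (logn p (m * n)) =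
    \prod_(p <- primes m ++ primes n) F p (logn p (m * n)).
  apply: perm_big; apply: uniq_perm; first exact: primes_uniq.
    rewrite cat_uniq !primes_uniq andbT /=; apply/hasPn => p pn.
    by apply/negP => pm; move: mn; rewrite coprime_has_primes // => /hasPn/(_ p pn); rewrite pm.
  by move=> p; rewrite mem_cat primesM.
rewrite big_cat /=; congr (_ * _); apply: eq_big_seq => p.
  rewrite mem_primes => /and3P[pp _ pm]; rewrite lognM // (@lognE p n) pp n0 /=.
  case: ifP; rewrite ?addn0 // => pn.
  by have := prime_gt1 pp; rewrite ltnNge dvdn_leq // -(eqP mn) dvdn_gcd pm pn.
rewrite mem_primes => /and3P[pp _ pn]; rewrite lognM // (@lognE p m) pp m0 /=.
case: ifP; rewrite ?add0n // => pm.
by have := prime_gt1 pp; rewrite ltnNge dvdn_leq // -(eqP mn) dvdn_gcd pm pn.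
Qed.

Lemma prime_product_pfactor F p a : prime p -> (0 < a)%N -> prime_product F (p ^ a) = F p a.
Proof.
move=> pp a0; rewrite /prime_product primesX // primes_prime // big_seq1.
by rewrite pfactorK.
Qed.

Lemma multiplicative_divk j : multiplicative (fun n => (divk j n)%:R).
Proof.
elim: j => [|j IH]; first exact: multiplicative_eq1.
have -> : (fun n => (divk j.+1 n)%:R) = divsum (fun n => (divk j n)%:R).
  by apply/funext => n; rewrite /divsum /= natr_sum.
exact: multiplicative_divsum.
Qed.

End Multiplicative.

(** * The divisor bound *)

Section Bounds.
Variable R : realType.

Lemma divsum_totient n : (0 < n)%N -> divsum (fun d => (totient d)%:R) n = n%:R :> R.
Proof.
move=> n0; rewrite /divsum -[in RHS](sum_totient_dvd n) -natr_sum; congr _%:R.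
rewrite (big_divisors (V := nat) _ (M := n.+1)) ?n0 ?leqnn //.
by rewrite -(big_mkord (fun d => (d %| n)%N)) /= [RHS]big_ltn_cond // dvd0n (gtn_eqF n0).
Qed.

Lemma gcd_totient m v : (0 < m)%N ->
  (gcdn m v)%:R = \sum_(d <- divisors m) (totient d)%:R * (d %| v)%N%:R :> R.
Proof.
move=> m0; have g0 : (0 < gcdn m v)%N by rewrite gcdn_gt0 m0.
rewrite -divsum_totient // /divsum.
have gM : (0 < gcdn m v < m.+1)%N by rewrite g0 ltnS dvdn_leq ?dvdn_gcdl.
rewrite (big_divisors _ gM) (big_divisors _ (M := m.+1)) ?m0 ?leqnn //.
rewrite [LHS]big_mkcond [RHS]big_mkcond /=; apply: eq_bigr => d _.
by rewrite dvdn_gcd; case: (d %| m)%N; case: (d %| v)%N; rewrite ?mulr1 ?mulr0.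
Qed.

Lemma divk1 n : (0 < n)%N -> divk 1 n = 1%N.
Proof.
move=> n0 /=; rewrite (bigD1_seq 1%N) ?divisors_uniq -?dvdn_divisors ?dvd1n //=.
by rewrite big1_seq ?addn0 // => i /andP[/negbTE ->].
Qed.

Lemma divk2E n : (0 < n)%N -> divk 2 n = size (divisors n).
Proof.
move=> n0; rewrite /= -sum1_size; apply: eq_big_seq => d.
by rewrite -dvdn_divisors // => /(dvdn_gt0 n0) d0; apply: divk1.
Qed.

Lemma divk_at1 j : divk j 1 = 1%N.
Proof. by elim: j => //= j IH; rewrite (_ : divisors 1 = [:: 1%N]) ?big_seq1. Qed.

(** Every factor in a factorisation of d divides n. The base n stays fixed while d runs through its
    divisors, so that the induction multiplies by the same tau(n) each time. *)
Lemma divk_le_tau j n d : (0 < n)%N -> (d %| n)%N -> (divk j d <= divk 2 n ^ j)%N.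
Proof.
move=> n0; elim: j d => [|j IH] d dn; first by rewrite /=; case: eqP.
have d0 := dvdn_gt0 n0 dn.
rewrite divkS expnS.
apply: (@leq_trans (\sum_(e <- divisors d) divk 2 n ^ j)%N).
  rewrite big_seq [in X in (_ <= X)%N]big_seq; apply: leq_sum => e.
  by rewrite -dvdn_divisors // => ed; apply: IH; apply: dvdn_trans dn.
rewrite big_const_seq count_predT iter_addn_0 mulnC leq_mul2r divk2E //.
apply/orP; right; apply: uniq_leq_size; first exact: divisors_uniq.
by move=> e; rewrite -!dvdn_divisors // => ed; apply: dvdn_trans dn.
Qed.

Lemma divk2_pfactor p a : prime p -> divk 2 (p ^ a) = a.+1.
Proof.
move=> pp; have p0 := prime_gt0 pp.
apply/eqP; rewrite -(eqr_nat R) -[(divk 2 _)%:R]/((\sum_(d <- divisors (p ^ a)) divk 1 d)%N%:R).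
rewrite natr_sum -/(divsum (fun d => (divk 1 d)%:R) (p ^ a)) sum_divisors_pfactor //.
rewrite (eq_bigr (fun=> 1)) => [|i _]; last by rewrite divk1 // expn_gt0 p0.
by rewrite sumr_const_nat subn0.
Qed.

(** (a + 1)^r is at most (a + 1)(a + 2)...(a + r) = r! binom(a + r, r), and the binomial coefficient
    is at most 2^(a + r). *)
Lemma exp_le_pow2 r a : (a.+1 ^ r <= r`! * 2 ^ r * 2 ^ a)%N.
Proof.
rewrite -mulnA -expnD.
apply: (@leq_trans ((a + r) ^_ r)%N).
  elim: r => [|r IH]; first by rewrite ffactn0.
  by rewrite addnS ffactSS expnS leq_mul // ltnS leq_addr.
rewrite -bin_ffact mulnC leq_mul2l addnC; apply/orP; right.
rewrite (_ : 2 = 1 + 1)%N // expnDn.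
rewrite (bigD1 (inord r)) //= inordK ?ltnS ?leq_addr // !exp1n !muln1.
exact: leq_addr.
Qed.

(** At p^a the claim reads (a + 1)^r <= C p^a. If p >= 2^r it holds with C = 1, by a + 1 <= 2^a;
    each of the at most 2^r smaller primes contributes one factor c = r! 2^r, from [exp_le_pow2]. *)
Lemma tau_bound r : exists2 C : nat, (0 < C)%N &
  forall n, (0 < n)%N -> (divk 2 n ^ r <= C * n)%N.
Proof.
pose c := (r`! * 2 ^ r)%N; have c0 : (0 < c)%N by rewrite muln_gt0 fact_gt0 expn_gt0.
pose P := (2 ^ r)%N.
pose F (p _ : nat) : R := if (p < P)%N then c%:R else 1.
exists (c ^ P)%N; first by rewrite expn_gt0 c0.
move=> n n0.
have : (0 : R) <= (divk 2 n)%:R ^+ r <= prime_product F n * n%:R.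
  apply: (@multiplicative_le R (fun n => (divk 2 n)%:R ^+ r) (fun n => prime_product F n * n%:R) _ _ _ n n0).
  - split=> [|a b a0 b0 ab]; first by rewrite divk_at1 expr1n.
    by rewrite (multiplicative_divk R 2).2 // exprMn.
  - exact: multiplicativeM (multiplicative_prime_product _) (multiplicative_nat _).
  move=> p a pp a0; rewrite prime_product_pfactor // divk2_pfactor // exprn_ge0 ?ler0n //=.
  rewrite /F; case: ltnP => pP.
    rewrite -natrX -natrM ler_nat; apply: leq_trans (exp_le_pow2 r a) _.
    by rewrite leq_mul2l leq_exp2r // prime_gt1 // orbT.
  rewrite mul1r -natrX ler_nat; apply: (@leq_trans ((2 ^ a) ^ r)%N).
    by case: r @c @P @F c0 pP => // r' *; rewrite leq_exp2r // ltn_expl.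
  by rewrite -expnM mulnC expnM leq_exp2r.
move=> /andP[_]; rewrite -natrX => h; rewrite -(ler_nat R); apply: le_trans h _.
rewrite natrM ler_wpM2r // /prime_product.
apply: (@le_trans _ _ (\prod_(p <- primes n | (p < P)%N) c%:R)).
  by rewrite [leRHS]big_mkcond.
rewrite -big_filter.
rewrite big_const_seq count_predT iter_mulr_1 natrX.
rewrite ler_weXn2l //; first by rewrite ler1n.
rewrite -[X in (_ <= X)%N](size_iota 0); apply: uniq_leq_size.
  exact/filter_uniq/primes_uniq.
by move=> p; rewrite mem_filter mem_iota => /andP[].
Qed.

End Bounds.

Arguments divk : simpl never.

(** * Moebius-type coefficients *)

Section MoebiusType.
Variable R : realType.

(* The values at p^a of the coefficients g_h of [divsum_gcd_moebius]; g_1 is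
   the Moebius function. *)
Definition gcd_local (h p a : nat) : R :=
  if (a <= logn p h)%N then (totient (p ^ a))%:R
  else if a == (logn p h).+1 then - (p ^ logn p h)%N%:R else 0.

Definition gcd_moebius (h : nat) : nat -> R := prime_product (gcd_local h).

Lemma multiplicative_gcd_moebius h : multiplicative (gcd_moebius h). Proof. exact: multiplicative_prime_product. Qed.

Lemma gcd_moebius_pfactor h p a : prime p -> gcd_moebius h (p ^ a)%N = gcd_local h p a.
Proof.
case: a => [|a] pp; last by rewrite /gcd_moebius prime_product_pfactor.
by rewrite expn0 (multiplicative_gcd_moebius h).1 /gcd_local expn0.
Qed.

Lemma totient_pfactorR p a : prime p ->
  (totient (p ^ a.+1))%:R = (p ^ a.+1)%N%:R - (p ^ a)%N%:R :> R.
Proof.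
move=> pp; rewrite totient_pfactor //= expnS -subn1 mulnBl mul1n natrB //.
by rewrite leq_pmull // prime_gt0.
Qed.

(** The totients telescope to p^a as long as a <= v_p(h); the value -p^v at a = v + 1, v = v_p(h),
    cancels the whole sum, which then stays 0. *)
Lemma sum_gcd_local h p a : (0 < h)%N -> prime p ->
  \sum_(0 <= i < a.+1) gcd_local h p i = (p ^ a)%N%:R * (p ^ a %| h)%N%:R.
Proof.
move=> h0 pp; elim: a => [|a IH].
  by rewrite big_nat1 /gcd_local expn0 dvd1n mulr1.
rewrite big_nat_recr //= IH !pfactor_dvdn // /gcd_local.
have [av|av] := leqP a.+1 (logn p h).
  by rewrite (ltnW av) !mulr1 totient_pfactorR // addrC subrK.
rewrite mulr0; have [av'|av'] := leqP a (logn p h).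
  have -> : logn p h = a by apply/eqP; rewrite eqn_leq av' -ltnS av.
  by rewrite eqxx mulr1 subrr.
by rewrite mulr0 add0r eqSS (gtn_eqF av').
Qed.

Lemma divsum_gcd_moebius h n : (0 < h)%N -> (0 < n)%N ->
  divsum (gcd_moebius h) n = n%:R * (n %| h)%N%:R.
Proof.
move=> h0; apply: (@multiplicative_eq R (divsum (gcd_moebius h)) (fun n => n%:R * (n %| h)%N%:R)).
- exact/multiplicative_divsum/multiplicative_gcd_moebius.
- exact: multiplicativeM (multiplicative_nat R) (multiplicative_dvd R h).
move=> p a pp a0; rewrite sum_divisors_pfactor // -sum_gcd_local //.
by apply: eq_bigr => i _; rewrite gcd_moebius_pfactor.
Qed.

(** The sharper bound (h, n) is multiplicative and so can be checked at prime powers, where |g_h| is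
    phi(p^a), p^v with v = v_p(h), or 0. *)
Lemma gcd_moebius_le h n : (0 < h)%N -> (0 < n)%N -> `|gcd_moebius h n| <= h%:R.
Proof.
move=> h0 n0.
have /andP[_ le1] : 0 <= `|gcd_moebius h n| <= (gcdn h n)%:R.
  apply: (@multiplicative_le R (fun n => `|gcd_moebius h n|) (fun n => (gcdn h n)%:R) _ _ _ n n0).
  - split=> [|a b a0 b0 ab]; first by rewrite (multiplicative_gcd_moebius h).1 normr1.
    by rewrite (multiplicative_gcd_moebius h).2 // normrM.
  - exact: multiplicative_gcd.
  move=> p a pp a0; rewrite normr_ge0 gcd_moebius_pfactor //= /gcd_local.
  case: leqP => [av|av].
    have /gcdn_idPr -> : (p ^ a %| h)%N by rewrite pfactor_dvdn.
    rewrite normr_nat ler_nat; case: a a0 av => // a _ av.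
    by rewrite totient_pfactor //= expnS leq_mul2r leq_pred orbT.
  case: eqP => [->|_]; last by rewrite normr0 ler0n.
  rewrite normrN normr_nat ler_nat dvdn_leq // ?gcdn_gt0 ?h0 //.
  by rewrite dvdn_gcd pfactor_dvdn // leqnn dvdn_exp2l.
apply: le_trans le1 _; rewrite ler_nat dvdn_leq //; exact: dvdn_gcdl.
Qed.

Lemma sum_gl1 p a : prime p ->
  \sum_(0 <= i < a.+2) gcd_local 1 p i / (p ^ i)%N%:R = 1 - p%:R^-1.
Proof.
move=> pp; elim: a => [|a IH].
  by rewrite 2?big_nat_recr //= big_geq // /gcd_local logn1 /= expn0 expn1 add0r divr1 mulN1r.
by rewrite big_nat_recr //= IH {1}/gcd_local logn1 /= mul0r addr0.
Qed.

(** As g_1 = mu, this is the classical identity behind the density phi(n) / n in [coprime_count]. *)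
Lemma divsum_gh1 n : (0 < n)%N ->
  divsum (fun d => gcd_moebius 1 d / d%:R) n = (totient n)%:R / n%:R.
Proof.
apply: (@multiplicative_eq R (divsum (fun d => gcd_moebius 1 d / d%:R)) (fun n => (totient n)%:R / n%:R)).
- exact/multiplicative_divsum/(multiplicativeM (multiplicative_gcd_moebius 1) (multiplicative_inv R)).
- exact: multiplicativeM (multiplicative_totient R) (multiplicative_inv R).
move=> p [//|a] pp _; rewrite sum_divisors_pfactor //.
rewrite (eq_bigr (fun i => gcd_local 1 p i / (p ^ i)%N%:R)) => [|i _]; last by rewrite gcd_moebius_pfactor.
have p0 : (p%:R : R) != 0 by rewrite pnatr_eq0 -lt0n prime_gt0.
rewrite sum_gl1 // totient_pfactorR // expnS natrM.
have pa0 : ((p ^ a)%N%:R : R) != 0 by rewrite pnatr_eq0 -lt0n ?expn_gt0 prime_gt0.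
by field; rewrite p0 pa0.
Qed.

(** A majorant of n / phi(n) in the shape of a divisor sum, so that it can be averaged over q by
    exchanging sums. *)
Definition tau_series (n : nat) : R := divsum (fun d => (divk 2 d)%:R / d%:R) n.

(** At p^a the ratio is p / (p - 1), at most 1 + 2 / p because p >= 2; these are the first two terms
    of the divisor sum. *)
Lemma le_totient n : (0 < n)%N -> n%:R / (totient n)%:R <= tau_series n.
Proof.
move=> n0.
suff /andP[] : (0 : R) <= n%:R / (totient n)%:R <= tau_series n by [].
apply: (@multiplicative_le R (fun n => n%:R / (totient n)%:R) tau_series _ _ _ n n0).
- split=> [|a b a0 b0 ab]; first by rewrite divr1.
  by rewrite totient_coprime // !natrM invfM mulrACA.
- exact/multiplicative_divsum/(multiplicativeM (multiplicative_divk R 2) (multiplicative_inv R)).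
move=> p [//|a] pp _; rewrite divr_ge0 ?ler0n //=.
have p1 := prime_gt1 pp.
rewrite /tau_series sum_divisors_pfactor // 2?big_ltn // expn0 expn1.
rewrite divk_at1 (_ : divk 2 p = 2%N); last by rewrite -[p in LHS]expn1 divk2_pfactor.
apply: (@le_trans _ _ (1 + 2 / p%:R)); last first.
  by rewrite divr1 addrA lerDl; apply: sumr_ge0 => i _; rewrite divr_ge0.
rewrite totient_pfactor //= expnS !natrM invfM mulrACA divff ?mulr1; last first.
  by rewrite pnatr_eq0 -lt0n ?expn_gt0 prime_gt0.
have -> : (p.-1)%:R = p%:R - 1 :> R by rewrite -subn1 natrB // prime_gt0.
have P2 : (2 : R) <= p%:R by rewrite ler_nat.
rewrite -subr_ge0.
have -> : 1 + 2 / p%:R - p%:R / (p%:R - 1) = (p%:R - 2) / (p%:R * (p%:R - 1)) :> R.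
  by field; apply/andP; split; lra.
by rewrite divr_ge0 ?mulr_ge0 //; lra.
Qed.

End MoebiusType.

(** * Logarithmic weights *)

Section WeightedSums.
Variable R : realType.
Implicit Types (y Q : R).

(* Normalised so that [logpow i.+1] is a primitive of [logpow i] with respect
   to dy / y. *)
Definition logpow (i : nat) (y : R) : R := if 1 <= y then ln y ^+ i / i`!%:R else 0.

Lemma logpow_ge0 i y : 0 <= logpow i y.
Proof.
rewrite /logpow; case: ifP => // y1; apply: divr_ge0 (ler0n _ _).
exact/exprn_ge0/ln_ge0.
Qed.

Lemma logpow_lt1 i y : y < 1 -> logpow i y = 0.
Proof. by rewrite /logpow ltNge => /negbTE ->. Qed.

Lemma logpow_ge1 i y : 1 <= y -> logpow i y = ln y ^+ i / i`!%:R.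
Proof. by rewrite /logpow => ->. Qed.

Lemma le_logpow i x y : x <= y -> logpow i x <= logpow i y.
Proof.
move=> xy; have [x1|x1] := ltP x 1; first by rewrite logpow_lt1 // logpow_ge0.
have y1 := le_trans x1 xy; rewrite !logpow_ge1 // ler_pM2r ?invr_gt0 ?ltr0n ?fact_gt0 //.
rewrite lerXn2r ?nnegrE ?ln_ge0 // ler_ln ?posrE //.
  exact: lt_le_trans x1.
exact: lt_le_trans y1.
Qed.

(** The mean value inequality for t^(i+1) / (i+1)!, whose derivative is t^i / i!; the induction runs
    on the form without factorials. *)
Lemma pow_diff i (a b : R) : 0 <= b -> b <= a ->
  b ^+ i / i`!%:R * (a - b) <= a ^+ i.+1 / (i.+1)`!%:R - b ^+ i.+1 / (i.+1)`!%:R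
    <= a ^+ i / i`!%:R * (a - b).
Proof.
move=> b0 ba; have a0 := le_trans b0 ba; have ab0 : 0 <= a - b by lra.
have F0 : (0 : R) < i`!%:R by rewrite ltr0n fact_gt0.
have key : forall j : nat, (b ^+ j * (a - b) *+ j.+1 <= a ^+ j.+1 - b ^+ j.+1 <= a ^+ j * (a - b) *+ j.+1).
  elim=> [|j /andP[IH1 IH2]]; first by rewrite !expr0 !expr1 !mul1r lexx.
  have -> : a ^+ j.+2 - b ^+ j.+2 = a * (a ^+ j.+1 - b ^+ j.+1) + b ^+ j.+1 * (a - b).
    by rewrite !exprS; ring.
  have bj : 0 <= b ^+ j by exact: exprn_ge0.
  have ab : b ^+ j.+1 <= a ^+ j.+1 by rewrite lerXn2r.
  rewrite !(mulrS _ j.+1); apply/andP; split; rewrite [leRHS]addrC.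
    rewrite [leRHS]addrC addrC; apply: lerD => //.
    apply: (@le_trans _ _ (b * (a ^+ j.+1 - b ^+ j.+1))).
      by apply: le_trans (ler_wpM2l b0 IH1); rewrite mulrnAr mulrA -exprS.
    by rewrite ler_wpM2r // subr_ge0.
  apply: lerD; last by rewrite ler_wpM2r.
  by apply: le_trans (ler_wpM2l a0 IH2) _; rewrite -mulrnAr mulrA -exprS mulrnAr.
have /andP[k1 k2] := key i.
have e j : b ^+ i / i`!%:R * (a - b) = (b ^+ i * (a - b) *+ j.+1) / (j.+1%:R * i`!%:R) :> R.
  by rewrite -mulr_natr; field; rewrite gt_eqF //= pnatr_eq0.
have e' j : a ^+ i / i`!%:R * (a - b) = (a ^+ i * (a - b) *+ j.+1) / (j.+1%:R * i`!%:R) :> R.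
  by rewrite -mulr_natr; field; rewrite gt_eqF //= pnatr_eq0.
rewrite factS natrM -mulrBl (e i) (e' i).
by rewrite !ler_pM2r ?k1 ?k2 // invr_gt0 mulr_gt0.
Qed.

Lemma ln_step (w : nat) : (0 < w)%N ->
  w.+1%:R^-1 <= ln (w.+1%:R / w%:R : R) <= w%:R^-1.
Proof.
move=> w0; have W : (0 : R) < w%:R by rewrite ltr0n.
apply/andP; split.
  have e : w%:R / w.+1%:R = 1 + - w.+1%:R^-1 :> R.
    by rewrite -natr1; field; rewrite gt_eqF //; lra.
  have : ln (w%:R / w.+1%:R) <= - w.+1%:R^-1 :> R.
    rewrite e; apply: le_ln1Dx; rewrite ltrN2 invf_lt1 ?ltr1n //; lra.
  have -> : w%:R / w.+1%:R = (w.+1%:R / w%:R)^-1 :> R by rewrite invf_div.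
  by rewrite lnV ?posrE ?divr_gt0 // lerN2.
have -> : w.+1%:R / w%:R = 1 + w%:R^-1 :> R.
  by rewrite -natr1; field; rewrite gt_eqF.
by apply: le_ln1Dx; apply: lt_trans (_ : 0 < _); rewrite ?invr_gt0 // ltrN10.
Qed.

(** A mean value inequality for the primitive [logpow i.+1]. It survives the cut-off at 1 because
    [logpow i.+1] vanishes there; the case y / c < 1 <= y is a comparison with 0. *)
Lemma logpow_diff i y (c : R) : 1 <= c ->
  logpow i (y / c) * ln c <= logpow i.+1 y - logpow i.+1 (y / c) <= logpow i y * ln c.
Proof.
move=> c1; have c0 : 0 < c := lt_le_trans ltr01 c1.
have lc := ln_ge0 c1.
have [y1|y1] := ltP y 1.
  have yc : y / c < 1 by rewrite ltr_pdivrMr //; lra.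
  by rewrite !logpow_lt1 // !mul0r subrr lexx.
have y0 : 0 < y := lt_le_trans ltr01 y1.
have ly := ln_ge0 y1.
have [yc|yc] := ltP (y / c) 1.
  rewrite [logpow i (y / c)]logpow_lt1 // [logpow _ (y / c)]logpow_lt1 // mul0r subr0 logpow_ge0 /=.
  rewrite !logpow_ge1 //.
  have /andP[_] := pow_diff i (lexx 0) ly; rewrite expr0n mul0r !subr0 => h.
  apply: le_trans h _; rewrite ler_wpM2l ?divr_ge0 ?exprn_ge0 //.
  by move: yc; rewrite ltr_pdivrMr // mul1r => yc; rewrite ler_ln ?posrE // ltW.
rewrite !logpow_ge1 //.
have e : ln (y / c) = ln y - ln c by rewrite ln_div ?posrE.
have -> : ln c = ln y - ln (y / c) by rewrite e; lra.
by apply: pow_diff; rewrite ?ln_ge0 // e; lra.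
Qed.

Lemma logpow_step i y w : (0 < w)%N ->
  logpow i (y / w.+1%:R) / w.+1%:R <= logpow i.+1 (y / w%:R) - logpow i.+1 (y / w.+1%:R)
    <= logpow i (y / w%:R) / w%:R.
Proof.
move=> w0; have W : (0 : R) < w%:R by rewrite ltr0n.
have c1 : 1 <= w.+1%:R / w%:R :> R by rewrite ler_pdivlMr // mul1r ler_nat.
have := logpow_diff i (y / w%:R) c1.
have -> : y / w%:R / (w.+1%:R / w%:R) = y / w.+1%:R by rewrite invf_div mulrA divfK // gt_eqF.
have /andP[l1 l2] := ln_step w0 => /andP[h1 h2]; apply/andP; split.
  by apply: le_trans h1; rewrite ler_wpM2l ?logpow_ge0.
by apply: le_trans h2 _; rewrite ler_wpM2l ?logpow_ge0.
Qed.

Lemma logpow_div_lt1 i y (M n : nat) : 0 < y < M%:R -> (M <= n)%N -> logpow i (y / n%:R) = 0.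
Proof.
move=> /andP[y0 yM] Mn; apply: logpow_lt1.
have yn : y < n%:R by apply: lt_le_trans yM _; rewrite ler_nat.
by rewrite ltr_pdivrMr ?mul1r // (lt_trans y0).
Qed.

(** [logpow_step] compares each term with a difference of [logpow i.+1], and the differences
    telescope; the upper bound sets the term w = 1 apart, whence the extra [logpow i y]. *)
Lemma harm_sum i y (M : nat) : 0 < y < M%:R ->
  logpow i.+1 y <= \sum_(1 <= w < M) logpow i (y / w%:R) / w%:R <= logpow i.+1 y + logpow i y.
Proof.
move=> yM; have M0 : (0 < M)%N.
  by rewrite -(ltr0n R); case/andP: yM => y0; apply: lt_trans.
apply/andP; split.
  apply: (@le_trans _ _ (\sum_(1 <= w < M) (- logpow i.+1 (y / w.+1%:R) - - logpow i.+1 (y / w%:R)))).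
    rewrite (telescope_sumr (fun w => - logpow i.+1 (y / w%:R))) // divr1 opprK.
    by rewrite (logpow_div_lt1 _ yM) // oppr0 add0r.
  apply: ler_sum_nat => w /andP[w0 _]; have /andP[_] := logpow_step i y w0.
  by rewrite opprK addrC.
case: M M0 yM => // -[|M] _ yM.
  by rewrite big_geq // addr_ge0 ?logpow_ge0.
rewrite big_ltn // divr1 divr1 addrC lerD2r big_add1 /=.
apply: (@le_trans _ _ (\sum_(1 <= w < M.+1) (- logpow i.+1 (y / w.+1%:R) - - logpow i.+1 (y / w%:R)))).
  apply: ler_sum_nat => w /andP[w0 _]; have /andP[+ _] := logpow_step i y w0.
  by rewrite opprK addrC.
rewrite (telescope_sumr (fun w => - logpow i.+1 (y / w%:R))) // divr1 opprK.
by rewrite addrC lerBlDr lerDl logpow_ge0.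
Qed.

Lemma ln_nat_ge0 n : 0 <= ln (n%:R : R).
Proof.
case: n => [|n]; first by rewrite ln0.
by rewrite ln_ge0 // ler1n.
Qed.

(** With u = n e this is the harmonic sum at y / n; returning from y / n to y costs ln n times the
    weight, by [logpow_diff]. *)
Lemma harm_dvd i y (M n : nat) : (0 < n)%N -> 0 < y < M%:R ->
  `|\sum_(1 <= u < M | (n %| u)%N) n%:R / u%:R * logpow i (y / u%:R) - logpow i.+1 y|
    <= (1 + ln n%:R) * logpow i y.
Proof.
move=> n0 yM; have N : (0 : R) < n%:R by rewrite ltr0n.
have n1 : (1 : R) <= n%:R by rewrite ler1n.
have /andP[y0 yM'] := yM.
rewrite (sum_multiples_all (F := fun u => n%:R / u%:R * logpow i (y / u%:R))) //; last first.
  by move=> u Mu; rewrite (logpow_div_lt1 _ yM) // mulr0.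
rewrite (eq_bigr (fun e => logpow i (y / n%:R / e%:R) / e%:R)); last first.
  move=> e _; rewrite natrM invfM mulrA divff ?gt_eqF // mul1r mulrC.
  by rewrite mulrA.
have yn : y / n%:R <= y by rewrite ler_pdivrMr // ler_peMr // ltW.
have ynM : 0 < y / n%:R < M%:R by rewrite divr_gt0 //= (le_lt_trans yn).
have /andP[h1 h2] := harm_sum i ynM.
have /andP[g1 g2] := logpow_diff i y n1.
have m1 := le_logpow i.+1 yn; have m2 := le_logpow i yn.
have l0 := ln_nat_ge0 n; have p0 := logpow_ge0 i y.
rewrite ler_norml; apply/andP; split; nra.
Qed.

End WeightedSums.

(** * Divisor sums over multiples *)

Section DivisorAsymptotics.
Variable R : realType.
Implicit Types (Q : R).

(** M is only a formal bound: as soon as M > Q, the weight itself confines q to q <= Q. *)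
Definition logsum (M j i : nat) (Q : R) (m : nat) : R :=
  \sum_(1 <= q < M | (m %| q)%N) (divk j q)%:R / q%:R * logpow i (Q / q%:R).

Lemma logsum_ge0 M j i Q m : 0 <= logsum M j i Q m.
Proof. by apply: sumr_ge0 => q _; rewrite mulr_ge0 ?logpow_ge0 // divr_ge0. Qed.

Lemma sum_totient_logsum M j i Q m : (0 < m)%N ->
  divsum (fun d => (totient d)%:R * logsum M j i Q d) m =
  \sum_(1 <= v < M) (gcdn m v)%:R * ((divk j v)%:R / v%:R * logpow i (Q / v%:R)).
Proof.
move=> m0; rewrite /divsum /logsum.
rewrite (eq_bigr (fun d => \sum_(1 <= v < M)
  (totient d)%:R * (d %| v)%N%:R * ((divk j v)%:R / v%:R * logpow i (Q / v%:R)))); last first.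
  move=> d _; rewrite big_mkcond /= big_distrr /=; apply: eq_bigr => v _.
  by case: (d %| v)%N; rewrite ?mulr1 // !mulr0 ?mul0r.
rewrite exchange_big /=; apply: eq_bigr => v _.
by rewrite -big_distrl /= gcd_totient.
Qed.

(* In q = u v with d_(j+1)(q) = sum_(v | q) d_j(v), m divides u v iff
   m / (m, v) divides u; the sum over u raises the index of the weight, and
   (m, v) is the sum of phi(d) over d | (m, v). *)
Lemma logsum_rec M j i Q m : (0 < m)%N -> 0 < Q < M%:R ->
  `|logsum M j.+1 i Q m - divsum (fun d => (totient d)%:R * logsum M j i.+1 Q d) m / m%:R|
   <= (1 + ln m%:R) / m%:R * divsum (fun d => (totient d)%:R * logsum M j i Q d) m.
Proof.
move=> m0 QM; rewrite !sum_totient_logsum //.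
have mR : (0 : R) < m%:R by rewrite ltr0n.
have E : logsum M j.+1 i Q m = \sum_(1 <= v < M) (divk j v)%:R / v%:R * ((gcdn m v)%:R / m%:R) *
    \sum_(1 <= u < M | (m %/ gcdn m v %| u)%N) (m %/ gcdn m v)%:R / u%:R * logpow i (Q / v%:R / u%:R).
  rewrite /logsum big_mkcond /=.
  rewrite (eq_bigr (fun n => \sum_(v <- divisors n) (if (m %| n)%N then
       (divk j v)%:R / n%:R * logpow i (Q / n%:R) else 0))); last first.
    move=> n _; case: ifP => _; last by rewrite big1.
    by rewrite divkS natr_sum !big_distrl.
  rewrite sum_divisors_swap; apply: eq_big_nat => v /andP[v0 vM].
  rewrite (sum_multiples_all (F := fun n => if (m %| n)%N then
       (divk j v)%:R / n%:R * logpow i (Q / n%:R) else 0)) //; last first.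
    by move=> n Mn; case: ifP => // _; rewrite (logpow_div_lt1 _ QM) // mulr0.
  rewrite big_distrr [RHS]big_mkcond /=; apply: eq_big_nat => u /andP[u0 _].
  have g0 : (0 < gcdn m v)%N by rewrite gcdn_gt0 m0.
  have -> : (m %/ gcdn m v %| u)%N = (m %| v * u)%N.
    rewrite -[in RHS](divnK (dvdn_gcdl m v)) -[X in (_ %| X * u)%N](divnK (dvdn_gcdr m v)).
    rewrite mulnAC dvdn_pmul2r // Gauss_dvdr //.
    by rewrite /coprime -(eqn_pmul2r g0) muln_gcdl !divnK ?dvdn_gcdl ?dvdn_gcdr ?mul1n.
  case: ifP => // _.
  have uR : (u%:R : R) != 0 by rewrite pnatr_eq0 -lt0n.
  have vR : (v%:R : R) != 0 by rewrite pnatr_eq0 -lt0n.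
  have gR : ((gcdn m v)%:R : R) != 0 by rewrite pnatr_eq0 -lt0n.
  have -> : (m %/ gcdn m v)%:R = m%:R / (gcdn m v)%:R :> R.
    by apply: (mulIf gR); rewrite -natrM divnK ?dvdn_gcdl // divfK.
  rewrite natrM (_ : Q / v%:R / u%:R = Q / (v%:R * u%:R)); last by rewrite invfM mulrA.
  by field; rewrite uR vR gR gt_eqF.
rewrite E big_distrl big_distrr /= -sumrB; apply: le_trans (ler_norm_sum _ _ _) _.
apply: ler_sum_nat => v /andP[v0 vM].
have g0 : (0 < gcdn m v)%N by rewrite gcdn_gt0 m0.
set n := (m %/ gcdn m v)%N.
have n0 : (0 < n)%N by rewrite divn_gt0 // dvdn_leq // dvdn_gcdl.
have vR : (0 : R) < v%:R by rewrite ltr0n.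
have QvM : 0 < Q / v%:R < M%:R.
  case/andP: QM => Q0 QM; rewrite divr_gt0 //= (le_lt_trans _ QM) //.
  by rewrite ler_pdivrMr // ler_peMr ?ler1n // ltW.
have := harm_dvd i n0 QvM.
set S := \sum_(1 <= u < M | _) _ => h.
have -> : (divk j v)%:R / v%:R * ((gcdn m v)%:R / m%:R) * S -
   (gcdn m v)%:R * ((divk j v)%:R / v%:R * logpow i.+1 (Q / v%:R)) / m%:R =
   (divk j v)%:R / v%:R * ((gcdn m v)%:R / m%:R) * (S - logpow i.+1 (Q / v%:R)) by ring.
have c0 : 0 <= (divk j v)%:R / v%:R * ((gcdn m v)%:R / m%:R) :> R.
  by rewrite mulr_ge0 // divr_ge0.
rewrite normrM (ger0_norm c0); apply: le_trans (ler_wpM2l c0 h) _.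
have lnm : ln n%:R <= ln m%:R :> R.
  by rewrite ler_ln ?posrE ?ltr0n // ler_nat leq_div.
rewrite [leRHS](_ : _ = (divk j v)%:R / v%:R * ((gcdn m v)%:R / m%:R) *
   ((1 + ln m%:R) * logpow i (Q / v%:R))); last by ring.
by rewrite ler_wpM2l // ler_wpM2r ?logpow_ge0 // lerD2l.
Qed.

(* The constant c_j(m) for which the sum of d_j(q) / q over the multiples q <= Q
   of m is asymptotic to c_j(m) log^j Q / j!, by [logsum_asym]. *)
Fixpoint dens (j m : nat) : R :=
  if j is j'.+1 then divsum (fun d => (totient d)%:R * dens j' d) m / m%:R
  else (m == 1)%N%:R.

(** Each use of [logsum_rec] costs a factor 1 + ln m, and summing d_j(d) over d | m rebuilds
    d_(j+1)(m); hence this shape for the dependence on m. *)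
Definition logsum_majorant (j m : nat) : R := (1 + ln m%:R) ^+ j * (divk j m)%:R / m%:R.

Lemma ln1_ge1 m : 1 <= 1 + ln (m%:R : R).
Proof. by rewrite lerDl ln_nat_ge0. Qed.

Lemma ln1_ge0 m : 0 <= 1 + ln (m%:R : R).
Proof. exact: le_trans ler01 (ln1_ge1 m). Qed.

Lemma logsum_majorant_ge0 j m : 0 <= logsum_majorant j m.
Proof. by rewrite /logsum_majorant divr_ge0 // mulr_ge0 // exprn_ge0 // ln1_ge0. Qed.

Lemma totient_le n : (totient n <= n)%N.
Proof.
case: n => // n; rewrite totient_count_coprime.
apply: (@leq_trans (\sum_(0 <= d < n.+1) 1)%N); last by rewrite sum_nat_const_nat subn0 muln1.
by apply: leq_sum => d _; case: coprime.
Qed.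

Lemma sum_totient_logsum_majorant j m : (0 < m)%N ->
  divsum (fun d => (totient d)%:R * logsum_majorant j d) m <= (1 + ln m%:R) ^+ j * (divk j.+1 m)%:R.
Proof.
move=> m0; rewrite divkS natr_sum big_distrr /= /divsum big_seq [leRHS]big_seq.
apply: ler_sum => d; rewrite -dvdn_divisors // => dm; have d0 := dvdn_gt0 m0 dm.
have dR : (0 : R) < d%:R by rewrite ltr0n.
rewrite /logsum_majorant mulrCA [leRHS]mulrC -mulrA mulrA [X in X * _]mulrC -mulrA ler_wpM2l //.
rewrite -[leRHS]mulr1 ler_pM ?exprn_ge0 ?ln1_ge0 ?divr_ge0 //.
  rewrite lerXn2r ?nnegrE ?ln1_ge0 // lerD2l ler_ln ?posrE ?ltr0n // ler_nat.
  exact: dvdn_leq.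
by rewrite ler_pdivrMr // mul1r ler_nat totient_le.
Qed.

Lemma logsum0 M i Q m : 1 <= Q < M%:R -> (0 < m)%N -> logsum M 0 i Q m = dens 0 m * logpow i Q.
Proof.
move=> /andP[Q1 QM] m0.
have M1 : (1 < M)%N by rewrite -(ltr_nat R); apply: le_lt_trans QM.
rewrite /logsum /dens; have [->|m1] := eqVneq m 1%N.
  rewrite big_ltn_cond // dvd1n /= big_nat_cond big1 ?addr0 ?divr1 //.
  move=> q /andP[/andP[q2 _] _]; rewrite (_ : divk 0 q = 0%N) ?mul0r //=.
  by rewrite /divk gtn_eqF.
rewrite mul0r big1 // => q mq; rewrite (_ : divk 0 q = 0%N) ?mul0r //=.
rewrite /divk; case: eqP => // q1; move: mq; rewrite q1 dvdn1.
by rewrite (negbTE m1).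
Qed.

Lemma logpow_le_pow i Q : 1 <= Q -> logpow i Q <= (1 + ln Q) ^+ i.
Proof.
move=> Q1; have l0 := ln_ge0 Q1; rewrite logpow_ge1 //.
apply: (@le_trans _ _ (ln Q ^+ i)).
  rewrite ler_pdivrMr ?ltr0n ?fact_gt0 // ler_peMr ?exprn_ge0 //.
  by rewrite ler1n fact_gt0.
by rewrite lerXn2r ?nnegrE //; lra.
Qed.

Lemma divsum_ge0 (f : nat -> R) m : (forall d, 0 <= f d) -> 0 <= divsum f m.
Proof. by move=> f0; apply: sumr_ge0. Qed.

Lemma divsum_le (f g : nat -> R) m : (0 < m)%N -> (forall d, (0 < d)%N -> (d %| m)%N -> f d <= g d) ->
  divsum f m <= divsum g m.
Proof.
move=> m0 fg; rewrite /divsum big_seq [leRHS]big_seq; apply: ler_sum => d.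
by rewrite -dvdn_divisors // => dm; apply: fg => //; exact: dvdn_gt0 dm.
Qed.

Lemma divsumZ (f : nat -> R) c m : divsum (fun d => c * f d) m = c * divsum f m.
Proof. by rewrite /divsum big_distrr. Qed.

Lemma logsum_upper j i : exists2 K : R, 0 <= K & forall M Q m, 1 <= Q < M%:R -> (0 < m)%N ->
  logsum M j i Q m <= K * logsum_majorant j m * (1 + ln Q) ^+ (i + j).
Proof.
elim: j i => [|j IH] i.
  exists 1 => // M Q m QM m0; rewrite logsum0 // mul1r addn0.
  rewrite /logsum_majorant expr0 mul1r /dens /divk; have [->|m1] := eqVneq m 1%N; last by rewrite !mul0r.
  by rewrite divr1 !mul1r logpow_le_pow //; case/andP: QM.
have [K1 K10 H1] := IH i.+1; have [K0 K00 H0] := IH i.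
exists (K1 + K0); first exact: addr_ge0.
move=> M Q m QM m0; have Q1 : 1 <= Q by case/andP: QM.
have Q0 : 0 < Q < M%:R by case/andP: QM => h1 ->; rewrite (lt_le_trans ltr01 h1).
have L1 : 1 <= 1 + ln Q by rewrite lerDl ln_ge0.
have mR : (0 : R) < m%:R by rewrite ltr0n.
have lm := ln1_ge1 m; have lm0 := ln1_ge0 m.
set L := (1 + ln Q) in L1 *; have L0 : 0 <= L := le_trans ler01 L1.
pose U : R := (1 + ln m%:R) ^+ j * (divk j.+1 m)%:R.
have U0 : 0 <= U by rewrite mulr_ge0 // exprn_ge0.
have bnd i' K : 0 <= K -> (forall M Q m, 1 <= Q < M%:R -> (0 < m)%N ->
     logsum M j i' Q m <= K * logsum_majorant j m * (1 + ln Q) ^+ (i' + j)) ->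
   divsum (fun d => (totient d)%:R * logsum M j i' Q d) m <= K * L ^+ (i' + j) * U.
  move=> K_0 H; apply: (@le_trans _ _ (divsum (fun d => (K * L ^+ (i' + j)) * ((totient d)%:R * logsum_majorant j d)) m)).
    apply: divsum_le => // d d0 dm; rewrite mulrCA ler_wpM2l //.
    by apply: le_trans (H M Q d QM d0) _; rewrite mulrAC.
  by rewrite divsumZ ler_wpM2l ?mulr_ge0 ?exprn_ge0 ?sum_totient_logsum_majorant.
have := logsum_rec j i m0 Q0; rewrite ler_distl => /andP[_ h].
apply: le_trans h _.
have b1 := bnd i.+1 K1 K10 H1; have b0 := bnd i K0 K00 H0.
apply: (@le_trans _ _ (K1 * L ^+ (i.+1 + j) * U / m%:R + (1 + ln m%:R) / m%:R * (K0 * L ^+ (i + j) * U))).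
  by rewrite lerD // ?ler_pM2r ?invr_gt0 // ler_wpM2l // divr_ge0.
rewrite /logsum_majorant exprS addnS addSn.
rewrite [leRHS](_ : _ = (1 + ln m%:R) / m%:R * (K1 * L ^+ (i + j).+1 * U) + (1 + ln m%:R) / m%:R * (K0 * L ^+ (i + j).+1 * U)); last by rewrite /U; ring.
rewrite [leLHS](_ : _ = m%:R^-1 * (K1 * L ^+ (i + j).+1 * U) + (1 + ln m%:R) / m%:R * (K0 * L ^+ (i + j) * U)); last by ring.
apply: lerD.
  apply: ler_wpM2r; first by rewrite !mulr_ge0 ?exprn_ge0.
  by rewrite ler_peMl // invr_ge0 ltW.
rewrite ler_wpM2l ?divr_ge0 // ler_wpM2r // ler_wpM2l //.
by rewrite exprS ler_peMl ?exprn_ge0.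
Qed.

(** The recursion trades (j + 1, i) for (j, i + 1). The main terms match by the definition of
    [dens], and the error in [logsum_rec] is one logarithm smaller by [logsum_upper]. The case j = 0
    is exact. The saving is written as a division by 1 + ln Q since i + j - 1 would truncate at i +
    j = 0. *)
Lemma logsum_asym j i : exists2 K : R, 0 <= K & forall M Q m, 1 <= Q < M%:R -> (0 < m)%N ->
  `|logsum M j i Q m - dens j m * logpow (i + j) Q| <= K * logsum_majorant j m * ((1 + ln Q) ^+ (i + j) / (1 + ln Q)).
Proof.
elim: j i => [|j IH] i.
  by exists 0 => // M Q m QM m0; rewrite logsum0 // addn0 subrr normr0 !mul0r.
have [K1 K10 H1] := IH i.+1; have [K0 K00 H0] := logsum_upper j i.
exists (K1 + K0); first exact: addr_ge0.
move=> M Q m QM m0; have Q1 : 1 <= Q by case/andP: QM.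
have Q0 : 0 < Q < M%:R by case/andP: QM => h1 ->; rewrite (lt_le_trans ltr01 h1).
have L1 : 1 <= 1 + ln Q by rewrite lerDl ln_ge0.
have mR : (0 : R) < m%:R by rewrite ltr0n.
have lm := ln1_ge1 m; have lm0 := ln1_ge0 m.
set L := (1 + ln Q) in L1 *; have L0 : 0 < L := lt_le_trans ltr01 L1.
have eL n : L ^+ n.+1 / L = L ^+ n by rewrite exprSr mulfK // gt_eqF.
pose U : R := (1 + ln m%:R) ^+ j * (divk j.+1 m)%:R.
have U0 : 0 <= U by rewrite mulr_ge0 // exprn_ge0.
rewrite addnS eL.
have E : dens j.+1 m * logpow (i + j).+1 Q =
    divsum (fun d => (totient d)%:R * (dens j d * logpow (i.+1 + j) Q)) m / m%:R.
  rewrite [dens j.+1 m]/(divsum (fun d => (totient d)%:R * dens j d) m / m%:R).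
  rewrite mulrAC /divsum big_distrl /= addSn; congr (_ / _).
  by apply: eq_bigr => d _; rewrite mulrA.
have b0 : divsum (fun d => (totient d)%:R * logsum M j i Q d) m <= K0 * L ^+ (i + j) * U.
  apply: (@le_trans _ _ (divsum (fun d => (K0 * L ^+ (i + j)) * ((totient d)%:R * logsum_majorant j d)) m)).
    apply: divsum_le => // d d0 dm; rewrite mulrCA ler_wpM2l //.
    by apply: le_trans (H0 M Q d QM d0) _; rewrite mulrAC.
  by rewrite divsumZ ler_wpM2l ?mulr_ge0 ?exprn_ge0 ?sum_totient_logsum_majorant // ltW.
have b1 : `|divsum (fun d => (totient d)%:R * logsum M j i.+1 Q d) m -
    divsum (fun d => (totient d)%:R * (dens j d * logpow (i.+1 + j) Q)) m| <= K1 * L ^+ (i + j) * U.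
  rewrite /divsum -sumrB; apply: le_trans (ler_norm_sum _ _ _) _.
  apply: (@le_trans _ _ (divsum (fun d => (K1 * L ^+ (i + j)) * ((totient d)%:R * logsum_majorant j d)) m)).
    rewrite -/(divsum (fun d => `|(totient d)%:R * logsum M j i.+1 Q d - (totient d)%:R * (dens j d * logpow (i.+1 + j) Q)|) m).
    apply: divsum_le => // d d0 dm; rewrite -mulrBr normrM normr_nat mulrCA ler_wpM2l //.
    by apply: le_trans (H1 M Q d QM d0) _; rewrite addSn -/L eL mulrAC.
  by rewrite divsumZ ler_wpM2l ?mulr_ge0 ?exprn_ge0 ?sum_totient_logsum_majorant // ltW.
have h := logsum_rec j i m0 Q0.
rewrite E; apply: le_trans (ler_distD (divsum (fun d => (totient d)%:R * logsum M j i.+1 Q d) m / m%:R) _ _) _.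
rewrite -[in X in _ + X]mulrBl normrM (ger0_norm (_ : 0 <= m%:R^-1)); last by rewrite invr_ge0 ltW.
apply: (@le_trans _ _ ((1 + ln m%:R) / m%:R * (K0 * L ^+ (i + j) * U) + K1 * L ^+ (i + j) * U / m%:R)).
  rewrite lerD ?ler_pM2r ?invr_gt0 //.
  by apply: le_trans h _; rewrite ler_wpM2l // divr_ge0 // ltW.
rewrite /logsum_majorant exprS.
rewrite [leRHS](_ : _ = (1 + ln m%:R) / m%:R * (K0 * L ^+ (i + j) * U) + (1 + ln m%:R) / m%:R * (K1 * L ^+ (i + j) * U)); last by rewrite /U; ring.
rewrite lerD2l mulrC; apply: ler_wpM2r; first by rewrite !mulr_ge0 ?exprn_ge0 // ltW.
by rewrite ler_peMl // invr_ge0 ltW.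
Qed.

Lemma dens_ge0 j m : 0 <= dens j m.
Proof.
elim: j m => [|j IH] m /=; first exact: ler0n.
by rewrite divr_ge0 //; apply: divsum_ge0 => d; rewrite mulr_ge0.
Qed.

Lemma dens_le j m : (0 < m)%N -> dens j m <= (divk j m)%:R / m%:R.
Proof.
elim: j m => [|j IH] m m0.
  by rewrite /dens /divk; have [->|m1] := eqVneq m 1%N; rewrite ?divr1 // mul0r.
rewrite [dens j.+1 m]/(divsum (fun d => (totient d)%:R * dens j d) m / m%:R).
rewrite ler_pM2r ?invr_gt0 ?ltr0n // divkS natr_sum.
apply: divsum_le => // d d0 _; have dR : (0 : R) < d%:R by rewrite ltr0n.
apply: (@le_trans _ _ (d%:R * ((divk j d)%:R / d%:R))); last by rewrite mulrC divfK ?gt_eqF.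
by apply: ler_pM; rewrite ?dens_ge0 ?ler_nat ?totient_le ?IH.
Qed.

Lemma multiplicative_dens j : multiplicative (dens j).
Proof.
elim: j => [|j IH]; first exact: multiplicative_eq1.
have -> : dens j.+1 = fun m => divsum (fun d => (totient d)%:R * dens j d) m * m%:R^-1 by [].
exact/(multiplicativeM _ (multiplicative_inv R))/multiplicative_divsum/(multiplicativeM (multiplicative_totient R) IH).
Qed.

End DivisorAsymptotics.

Arguments dens : simpl never.

(** * Power bounds *)

Section PowerBounds.
Variable R : realType.
Implicit Types (x y Q : R).

Lemma powRD_gt0 x a b : 0 < x -> x `^ (a + b) = x `^ a * x `^ b.
Proof. by move=> x0; rewrite powRD // (gt_eqF x0) implybT. Qed.

Lemma le_powR_base x y a : 0 <= a -> 0 <= x -> x <= y -> x `^ a <= y `^ a.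
Proof.
by move=> a0 x0 xy; apply: ge0_ler_powR; rewrite ?nnegrE // (le_trans x0).
Qed.

Lemma le_powR_baseN x y a : a <= 0 -> 0 < x -> x <= y -> y `^ a <= x `^ a.
Proof.
move=> a0 x0 xy; have : 0 <= - a by rewrite oppr_ge0.
rewrite -[a in _ `^ a <= _]opprK -[a in _ <= _ `^ a]opprK; move: (- a) => b b0.
rewrite !powRN lef_pV2 ?posrE ?powR_gt0 ?(lt_le_trans x0 xy) //.
by apply: le_powR_base => //; exact: ltW.
Qed.

Lemma ln_pow_bound (e : R) j : 0 < e -> exists2 C : R, 0 < C &
  forall y, 1 <= y -> (1 + ln y) ^+ j <= C * y `^ e.
Proof.
(* Only a j <= e is needed; dividing by j + 1 keeps a meaningful at j = 0. *)
move=> e0; pose a : R := e / j.+1%:R.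
have a0 : 0 < a by rewrite divr_gt0.
exists ((1 + a^-1) ^+ j) => [|y y1]; first by rewrite exprn_gt0 // addr_gt0 // invr_gt0.
have y0 : 0 < y := lt_le_trans ltr01 y1.
have l0 := ln_ge0 y1.
have p1 : 1 <= y `^ a.
  by rewrite -[leLHS](powRr0 y) ler_powR // ltW.
have h : 1 + ln y <= (1 + a^-1) * y `^ a.
  have := ln_sublinear (powR_gt0 a y0); rewrite ln_powR => h.
  have : ln y <= a^-1 * y `^ a by rewrite -ler_pdivrMl ?invr_gt0 // invrK ltW.
  by move=> h'; rewrite mulrDl mul1r lerD.
apply: (@le_trans _ _ (((1 + a^-1) * y `^ a) ^+ j)).
  by rewrite lerXn2r // nnegrE ?mulr_ge0 ?powR_ge0 ?addr_ge0 ?invr_ge0 // ltW.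
rewrite exprMn ler_wpM2l //; first by rewrite exprn_ge0 // addr_ge0 // invr_ge0 ltW.
rewrite -powR_mulrn ?powR_ge0 // -powRrM; apply: ler_powR => //.
by rewrite /a mulrAC ler_pdivrMr // ler_pM2l // ler_nat.
Qed.

Lemma divk_pow_bound (e : R) j : 0 < e -> exists2 C : R, 0 < C &
  forall n, (0 < n)%N -> (divk j n)%:R <= C * n%:R `^ e.
Proof.
(* From tau(n)^r <= C n and d_j(n) <= tau(n)^j comes the exponent j / r, at most e for this r. *)
move=> e0; pose r := (Num.truncn (j%:R / e)).+1.
have r0 : (0 : R) < r%:R by rewrite ltr0n.
have re : j%:R / r%:R <= e.
  rewrite ler_pdivrMr // mulrC -ler_pdivrMr //; exact/ltW/truncnS_gt.
have [C C0 HC] := tau_bound R r.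
exists ((C%:R `^ (r%:R^-1)) ^+ j) => [|n n0]; first by rewrite exprn_gt0 // powR_gt0 // ltr0n.
have n1 : (1 : R) <= n%:R by rewrite ler1n.
have h : (divk 2 n)%:R <= C%:R `^ (r%:R^-1) * n%:R `^ (r%:R^-1) :> R.
  have -> : (divk 2 n)%:R = ((divk 2 n)%:R ^+ r) `^ (r%:R^-1) :> R.
    by rewrite -powR_mulrn // -powRrM divff ?powRr1 // gt_eqF.
  rewrite -powRM //; apply: le_powR_base; first by rewrite invr_ge0.
    exact: exprn_ge0.
  by rewrite -natrX -natrM ler_nat HC.
apply: (@le_trans _ _ ((divk 2 n)%:R ^+ j)); first by rewrite -natrX ler_nat divk_le_tau.
apply: (@le_trans _ _ ((C%:R `^ (r%:R^-1) * n%:R `^ (r%:R^-1)) ^+ j)).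
  by rewrite lerXn2r ?nnegrE ?mulr_ge0 ?powR_ge0.
rewrite exprMn ler_wpM2l ?exprn_ge0 ?powR_ge0 //.
rewrite -[_ ^+ j in leLHS]powR_mulrn ?powR_ge0 // -powRrM; apply: ler_powR => //.
by rewrite mulrC.
Qed.

Lemma logsum_majorant_pow_bound (e : R) j : 0 < e -> exists2 C : R, 0 < C &
  forall n, (0 < n)%N -> logsum_majorant R j n <= C * n%:R `^ (e - 1).
Proof.
move=> e0; have e20 : 0 < e / 2 by rewrite divr_gt0.
have [C1 C10 H1] := ln_pow_bound j e20; have [C2 C20 H2] := divk_pow_bound j e20.
exists (C1 * C2) => [|n n0]; first exact: mulr_gt0.
have n1 : (1 : R) <= n%:R by rewrite ler1n.
have nR : (0 : R) < n%:R by rewrite ltr0n.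
rewrite /logsum_majorant powRD_gt0 // powR_inv1 // mulrA ler_pM2r ?invr_gt0 //.
have -> : e = e / 2 + e / 2 by lra.
rewrite powRD_gt0 // mulrACA ler_pM ?H1 ?H2 ?exprn_ge0 ?ln1_ge0 //.
Qed.

Lemma dens_pow_bound (e : R) j : 0 < e -> exists2 C : R, 0 < C &
  forall n, (0 < n)%N -> dens R j n <= C * n%:R `^ (e - 1).
Proof.
move=> e0; have [C C0 H] := divk_pow_bound j e0.
exists C => // n n0; have nR : (0 : R) < n%:R by rewrite ltr0n.
apply: le_trans (dens_le R j n0) _.
by rewrite powRD_gt0 // powR_inv1 // mulrA ler_pM2r ?invr_gt0 ?H.
Qed.

(** The integral comparison for t^(-1-e), obtained from ((n+1)/n)^e = exp(e ln((n+1)/n)) >= 1 + e /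
    (n+1). *)
Lemma pseries_step (e : R) (n : nat) : 0 < e -> (0 < n)%N ->
  n.+1%:R `^ (- (1 + e)) <= e^-1 * (n%:R `^ (- e) - n.+1%:R `^ (- e)).
Proof.
move=> e0 n0; have nR : (0 : R) < n%:R by rewrite ltr0n.
have n1R : (0 : R) < n.+1%:R by rewrite ltr0n.
have /andP[l1 _] := ln_step R n0.
have c0 : 0 < n.+1%:R / n%:R :> R by rewrite divr_gt0.
have h : 1 + e * n.+1%:R^-1 <= (n.+1%:R / n%:R) `^ e :> R.
  rewrite /powR gt_eqF //; apply: le_trans (expR_ge1Dx _).
  by rewrite lerD2l ler_pM2l.
have E : n%:R `^ (- e) = n.+1%:R `^ (- e) * (n.+1%:R / n%:R) `^ e :> R.
  rewrite powRM ?invr_ge0 ?ltW // mulrA -powRD_gt0 // addNr powRr0 mul1r.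
  by rewrite -powR_inv1 ?ltW // -powRrM mulN1r.
rewrite E opprD powRD_gt0 // powR_inv1 ?(ltW n1R) // mulrC.
set P := n.+1%:R `^ (- e); have P0 : 0 < P by rewrite powR_gt0.
have -> : P * (n.+1%:R / n%:R) `^ e - P = P * ((n.+1%:R / n%:R) `^ e - 1) by ring.
by rewrite mulrCA ler_pM2l // [leRHS]mulrC ler_pdivlMr // [leLHS]mulrC lerBrDl.
Qed.

Lemma pseries_tail (e : R) (N M : nat) : 0 < e -> (0 < N)%N ->
  \sum_(N <= n < M) n%:R `^ (- (1 + e)) <= (1 + e^-1) * N%:R `^ (- e).
Proof.
move=> e0 N0; have NR : (0 : R) < N%:R by rewrite ltr0n.
have [MN|NM] := leqP M N.
  by rewrite big_geq // mulr_ge0 ?powR_ge0 // addr_ge0 // invr_ge0 ltW.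
rewrite big_ltn // mulrDl mul1r; apply: lerD.
  by apply: ler_powR; rewrite ?ler1n //; lra.
case: M NM => // M NM; rewrite big_add1 /=.
apply: (@le_trans _ _ (\sum_(N <= n < M) (e^-1 * (- n.+1%:R `^ (- e) - - n%:R `^ (- e))))).
  apply: ler_sum_nat => n /andP[Nn _].
  by rewrite opprK [- _ + _]addrC pseries_step // (leq_trans N0).
rewrite -big_distrr /= (telescope_sumr (fun n => - n%:R `^ (- e))) //.
by rewrite ler_wpM2l ?invr_ge0 ?(ltW e0) // opprK addrC lerBlDr lerDl powR_ge0.
Qed.

(** The common weight of the rounding and cut-off errors. Against du / u, the function (u / y)^(1/2)
    on u <= y has bounded mass, whereas the indicator of 1 <= u <= y has mass ln y: an error with
    this weight saves a logarithm. *)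
Definition sqrt_cut (t : R) : R := if t <= 1 then t `^ 2^-1 else 0.

Lemma sqrt_cut_ge0 t : 0 <= sqrt_cut t.
Proof. by rewrite /sqrt_cut; case: ifP => // _; exact: powR_ge0. Qed.

(** With a, b the square roots of u and u - 1, a - b = 1 / (a + b) >= 1 / (2 a). *)
Lemma sqrt_step (u : nat) : (0 < u)%N ->
  u%:R^-1 * u%:R `^ 2^-1 <= 2 * (u%:R `^ 2^-1 - u.-1%:R `^ 2^-1) :> R.
Proof.
case: u => // u _ /=.
have pw v : v%:R `^ 2^-1 * v%:R `^ 2^-1 = v%:R :> R.
  case: v => [|v]; first by rewrite powR0 ?mul0r // gt_eqF // invr_gt0.
  by rewrite -powRD_gt0 // (_ : 2^-1 + 2^-1 = 1) ?powRr1 //; lra.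
have := pw u; have := pw u.+1.
set a := u.+1%:R `^ 2^-1; set b := u%:R `^ 2^-1.
have a0 : 0 < a by rewrite powR_gt0.
have b0 : 0 <= b by rewrite powR_ge0.
move=> ea eb; have ab : b <= a by apply: le_powR_base; rewrite ?ler_nat.
rewrite -ea invfM mulrAC mulVf ?gt_eqF // mul1r -(ler_pM2r a0) mulVf ?gt_eqF //.
have : a * a - b * b = 1 by rewrite ea eb -natr1 addrAC subrr add0r.
nra.
Qed.

Lemma sqrt_cut_sum (y : R) (M : nat) : 0 < y ->
  \sum_(1 <= u < M) u%:R^-1 * sqrt_cut (u%:R / y) <= 2 * logpow 0 y.
Proof.
move=> y0; have [y1|y1] := ltP y 1.
  rewrite logpow_lt1 // mulr0 big_nat_cond big1 // => u /andP[/andP[u0 _] _].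
  rewrite /sqrt_cut ler_pdivrMr // mul1r leNgt (lt_le_trans y1) ?mulr0 // ler1n //.
rewrite logpow_ge1 // expr0 fact0 divr1 mulr1.
have yp : 0 < y `^ 2^-1 by rewrite powR_gt0.
(* The minimum stops s from growing beyond y, where the summand is 0, so the telescoping may run
   over the whole range. *)
pose s (u : nat) : R := 2 * (Num.min (u%:R `^ 2^-1) (y `^ 2^-1) / y `^ 2^-1).
have smon (u : nat) : s u.-1 <= s u.
  rewrite /s ler_wpM2l // ler_pM2r ?invr_gt0 //.

  rewrite le_min !ge_min lexx orbT andbT; apply/orP; left.
  by apply: le_powR_base; rewrite ?ler_nat ?leq_pred.
have [M1|M1] := leqP M 1; first by rewrite big_geq.
case: M M1 => // M M1.
apply: (@le_trans _ _ (\sum_(1 <= u < M.+1) (s u - s u.-1))).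
  apply: ler_sum_nat => u /andP[u0 _].
  rewrite /sqrt_cut ler_pdivrMr // mul1r; case: (leP u%:R y) => uy; last by rewrite mulr0 subr_ge0.
  have e1 : u%:R `^ 2^-1 <= y `^ 2^-1 by apply: le_powR_base.
  have e2 : u.-1%:R `^ 2^-1 <= y `^ 2^-1.
    by apply: le_trans e1; apply: le_powR_base; rewrite ?ler_nat ?leq_pred.
  rewrite /s (min_idPl e1) (min_idPl e2).
  have yi : (u%:R / y) `^ 2^-1 = u%:R `^ 2^-1 / y `^ 2^-1.
    rewrite powRM ?invr_ge0 ?(ltW y0) //; congr (_ * _).
    by rewrite -powR_inv1 ?(ltW y0) // -powRrM mulN1r powRN.
  rewrite yi -mulrBr -mulrBl !mulrA ler_pM2r ?invr_gt0 //.
  exact: sqrt_step.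
rewrite big_add1 /= (telescope_sumr (fun u => s u)) //.
have : s M <= 2.
  by rewrite /s ler_piMr // ler_pdivrMr // mul1r ge_min lexx orbT.
have : 0 <= s 0%N.
  apply: mulr_ge0 => //; apply: divr_ge0; last exact: ltW.
  by rewrite le_min !powR_ge0.
lra.
Qed.

Definition sqrtsum M j Q : R := \sum_(1 <= q < M) (divk j q)%:R / q%:R * sqrt_cut (q%:R / Q).

(** For j + 1, open d_(j+1)(v u) over v: the sum over u is bounded by twice the indicator of v <= Q,
    which leaves a sum of d_j only. For j = 0 only q = 1 counts, and Q^(-1/2) beats 1 / (1 + ln
    Q). *)
Lemma sqrtsum_bound j : exists2 K : R, 0 <= K & forall M Q, 1 <= Q < M%:R ->
  sqrtsum M j Q <= K * ((1 + ln Q) ^+ j / (1 + ln Q)).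
Proof.
case: j => [|j].
  have e0 : 0 < 2^-1 :> R by rewrite invr_gt0.
  have [C C0 HC] := ln_pow_bound 1 e0; exists C; first exact: ltW.
  move=> M Q /andP[Q1 QM].
  have M1 : (1 < M)%N by rewrite -(ltr_nat R); apply: le_lt_trans QM.
  have Q0 : 0 < Q := lt_le_trans ltr01 Q1; have l0 := ln_ge0 Q1.
  rewrite /sqrtsum big_ltn // big_nat_cond big1 ?addr0; last first.
    by move=> q /andP[/andP[q2 _] _]; rewrite /divk gtn_eqF // !mul0r.
  rewrite (_ : divk 0 1 = 1%N) // divr1 mulr_natl mulr1n /sqrt_cut ler_pdivrMr // mul1r Q1.
  rewrite mul1r -powR_inv1 ?(ltW Q0) // -powRrM mulN1r powRN.
  rewrite expr0 mul1r ler_pdivlMr ?(lt_le_trans ltr01) ?lerDl //.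
  by rewrite mulrC ler_pdivrMr ?powR_gt0 //; have := HC Q Q1; rewrite expr1.
have [K K0 HK] := logsum_upper R j 0; exists (2 * (K * logsum_majorant R j 1)).
  by apply: mulr_ge0 => //; apply: mulr_ge0 => //; exact: logsum_majorant_ge0.
move=> M Q QM; have /andP[Q1 QM'] := QM.
have Q0 : 0 < Q := lt_le_trans ltr01 Q1; have l0 := ln_ge0 Q1.
rewrite exprSr mulfK ?gt_eqF ?(lt_le_trans ltr01) ?lerDl //.
apply: (@le_trans _ _ (2 * logsum M j 0 Q 1)); last first.
  by rewrite -mulrA ler_pM2l // HK.
rewrite /sqrtsum.
rewrite (eq_bigr (fun n => \sum_(v <- divisors n) (divk j v)%:R / n%:R * sqrt_cut (n%:R / Q))); last first.
  by move=> n _; rewrite divkS natr_sum !big_distrl.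
rewrite sum_divisors_swap /logsum big_distrr /= [leRHS]big_mkcond /=.
apply: ler_sum_nat => v /andP[v0 vM]; rewrite dvd1n.
have vR : (0 : R) < v%:R by rewrite ltr0n.
rewrite (sum_multiples_all (F := fun n => (divk j v)%:R / n%:R * sqrt_cut (n%:R / Q))) //; last first.
  move=> n Mn; rewrite /sqrt_cut ler_pdivrMr // mul1r leNgt.
  by rewrite (lt_le_trans QM') ?ler_nat // mulr0.
rewrite (eq_bigr (fun u => (divk j v)%:R / v%:R * (u%:R^-1 * sqrt_cut (u%:R / (Q / v%:R))))); last first.
  move=> u _; rewrite natrM invfM !mulrA; congr (_ * sqrt_cut _).
  by rewrite invf_div mulrA [v%:R * _]mulrC.
rewrite -big_distrr /= mulrCA; apply: ler_wpM2l; first by rewrite divr_ge0.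
by apply: sqrt_cut_sum; rewrite divr_gt0.
Qed.

End PowerBounds.

(** * Local factors *)

Section LocalFactors.
Variable R : realType.
Variables (p : nat) (pp : prime p).

Let z : R := p%:R^-1.

Lemma pR_gt1 : 1 < p%:R :> R. Proof. by rewrite ltr1n prime_gt1. Qed.
Lemma pR_gt0 : 0 < p%:R :> R. Proof. exact: lt_trans ltr01 pR_gt1. Qed.
Lemma z_gt0 : 0 < z. Proof. by rewrite invr_gt0 pR_gt0. Qed.
Lemma z_lt1 : z < 1. Proof. by rewrite invf_lt1 ?pR_gt0 ?pR_gt1. Qed.
Lemma onez_gt0 : 0 < 1 - z. Proof. by rewrite subr_gt0 z_lt1. Qed.

(* The sum of d_j(p^b) p^(-b) over b >= a, by [tail_lim]. *)
Definition euler_tail (j a : nat) : R := dens R j (p ^ a) / (1 - z) ^+ j.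

Lemma euler_tail_at0 j : euler_tail j 0 = (1 - z) ^- j.
Proof. by rewrite /euler_tail expn0 (multiplicative_dens R j).1 mul1r. Qed.

Lemma divk_pfactorS j a : divk j.+1 (p ^ a) = (\sum_(0 <= c < a.+1) divk j (p ^ c))%N.
Proof.
apply/eqP; rewrite -(eqr_nat R) divkS !natr_sum.
by rewrite -/(divsum (fun d => (divk j d)%:R) (p ^ a)) sum_divisors_pfactor.
Qed.

Lemma dens_pfactor j a :
  (p ^ a)%N%:R * dens R j.+1 (p ^ a) =
  \sum_(0 <= c < a.+1) (totient (p ^ c))%:R * dens R j (p ^ c).
Proof.
have P0 : ((p ^ a)%N%:R : R) != 0 by rewrite pnatr_eq0 -lt0n expn_gt0 prime_gt0.
rewrite [dens R j.+1 _]/(divsum (fun d => (totient d)%:R * dens R j d) (p ^ a) / (p ^ a)%N%:R).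
by rewrite sum_divisors_pfactor // mulrC divfK.
Qed.

Lemma euler_tail_rec0 j : (1 - z) * euler_tail j.+1 0 = euler_tail j 0.
Proof.
have := onez_gt0 => o0.
by rewrite !euler_tail_at0 exprS invfM mulrA divff ?mul1r // gt_eqF.
Qed.

(** Comparing [dens_pfactor] at a + 1 and at a isolates the last term, phi(p^(a+1)) times the
    density of index j. *)
Lemma euler_tail_recS j a : euler_tail j.+1 a.+1 = z * euler_tail j.+1 a + euler_tail j a.+1.
Proof.
have o0 := onez_gt0; have p0 := pR_gt0.
have P0 : (0 : R) < (p ^ a)%N%:R by rewrite ltr0n expn_gt0 prime_gt0.
have := dens_pfactor j a.+1; rewrite big_nat_recr //= -dens_pfactor.
rewrite totient_pfactorR // /euler_tail.
set c1 := dens R j.+1 _; set c2 := dens R j.+1 _; set c3 := dens R j _.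
rewrite expnS natrM => e.
have {}e : c1 = z * c2 + (1 - z) * c3.
  apply: (mulfI (_ : p%:R * (p ^ a)%N%:R != 0)); first by rewrite gt_eqF // mulr_gt0.
  by rewrite e /z; field; rewrite gt_eqF.
rewrite e exprS; field.
by apply/andP; split; [apply: expf_neq0|]; rewrite gt_eqF.
Qed.

(** The two families interlock: the difference formula at j gives the second identity at j by
    induction on a, and this gives the difference formula at j + 1. The difference formula is what
    makes [euler_tail] a tail sum. *)
Lemma euler_tail_main j :
  (forall a, euler_tail j a - euler_tail j a.+1 = (divk j (p ^ a))%:R * z ^+ a) /\
  (forall a, (1 - z) * euler_tail j.+1 a = euler_tail j a + z ^+ a * (\sum_(0 <= c < a) divk j (p ^ c))%N%:R).
Proof.
have K i : (forall a, euler_tail i a - euler_tail i a.+1 = (divk i (p ^ a))%:R * z ^+ a) ->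
  (forall a, (1 - z) * euler_tail i.+1 a = euler_tail i a + z ^+ a * (\sum_(0 <= c < a) divk i (p ^ c))%N%:R).
  move=> H; elim=> [|a IH]; first by rewrite big_geq // mulr0 addr0 euler_tail_rec0.
  rewrite euler_tail_recS mulrDr mulrCA IH big_nat_recr //= natrD.
  have := H a; rewrite exprS => Ha.
  have -> : z * z ^+ a * ((\sum_(0 <= c < a) divk i (p ^ c))%N%:R + (divk i (p ^ a))%:R) =
    z * (z ^+ a * (\sum_(0 <= c < a) divk i (p ^ c))%N%:R) + z * ((divk i (p ^ a))%:R * z ^+ a) by ring.
  by rewrite -Ha; ring.
suff H a : euler_tail j a - euler_tail j a.+1 = (divk j (p ^ a))%:R * z ^+ a by split=> //; exact: K.
elim: j a => [|j IH] a.
  rewrite /euler_tail /dens !expr0 !divr1 /divk.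
  case: a => [|a]; first by rewrite expn0 expr0 eqxx expn1 gtn_eqF ?prime_gt1 // subr0 mulr1.
  by rewrite !gtn_eqF ?mul0r ?subrr // -[1%N](expn0 p) ltn_exp2l // prime_gt1.
have := K j IH a; have := IH a; rewrite divk_pfactorS big_nat_recr //= natrD euler_tail_recS => h1 h2.
have -> : euler_tail j.+1 a - (z * euler_tail j.+1 a + euler_tail j a.+1) = (1 - z) * euler_tail j.+1 a - euler_tail j a.+1 by ring.
rewrite h2 mulrDl -h1; ring.
Qed.

Lemma euler_tail_diff j a : euler_tail j a - euler_tail j a.+1 = (divk j (p ^ a))%:R * z ^+ a.
Proof. exact: (euler_tail_main j).1. Qed.

Lemma euler_tail_key j a :
  (1 - z) * euler_tail j.+1 a = euler_tail j a + z ^+ a * (\sum_(0 <= c < a) divk j (p ^ c))%N%:R.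
Proof. exact: (euler_tail_main j).2. Qed.

Lemma euler_tail_ge1 j : 1 <= euler_tail j 0.
Proof.
rewrite euler_tail_at0 invf_ge1 ?exprn_gt0 ?onez_gt0 // exprn_ile1 ?(ltW onez_gt0) //.
by rewrite gerBl ltW // z_gt0.
Qed.

Lemma tail_sum j a N : (a <= N)%N ->
  \sum_(a <= b < N) (divk j (p ^ b))%:R * p%:R ^- b = euler_tail j a - euler_tail j N.
Proof.
move=> aN; rewrite -[RHS]opprB -(telescope_sumr (euler_tail j)) // -sumrN.
by apply: eq_bigr => b _; rewrite opprB euler_tail_diff /z exprVn.
Qed.

(** For g = v_p(h), the left side is, up to a power of 1 - 1/p, the factor at p of the sum over d of
    g_h(d) c_i(d) c_j(d); the right side is the numerator in f at p. In the step to g + 1, the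
    values of d_i and d_j at p^(g+1) are rewritten as differences of tails, and what remains is a
    polynomial identity modulo p^a z^a = 1. *)
Lemma local_identity i j g :
  \sum_(0 <= a < g.+1) (totient (p ^ a))%:R * (euler_tail i a * euler_tail j a)
    - (p ^ g)%N%:R * (euler_tail i g.+1 * euler_tail j g.+1) =
  (1 - z) * (\sum_(0 <= a < g.+1) (divk i (p ^ a))%:R * euler_tail j.+1 a)
    + (divk j.+1 (p ^ g))%:R * euler_tail i g.+1.
Proof.
have zp a : (p ^ a)%N%:R * z ^+ a = 1.
  by rewrite /z natrX exprVn divff // expf_neq0 // gt_eqF // pR_gt0.
elim: g => [|g IH].
  rewrite !big_nat1 expn0 !divk_at1 (_ : totient 1 = 1%N) // !mul1r euler_tail_rec0.
  have := euler_tail_diff i 0; have := euler_tail_diff j 0; rewrite !expn0 !expr0 !divk_at1 => ej ei.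
  have -> : euler_tail i 1 = euler_tail i 0 - 1 by rewrite -[X in _ - X](mulr1 1%:R) -ei; ring.
  have -> : euler_tail j 1 = euler_tail j 0 - 1 by rewrite -[X in _ - X](mulr1 1%:R) -ej; ring.
  ring.
rewrite big_nat_recr //= [in RHS]big_nat_recr //= mulrDr.
set S1 := \sum_(0 <= a < g.+1) _ in IH *; set S2 := \sum_(0 <= a < g.+1) _ in IH *.
have -> : S1 = (1 - z) * S2 + (divk j.+1 (p ^ g))%:R * euler_tail i g.+1 + (p ^ g)%N%:R * (euler_tail i g.+1 * euler_tail j g.+1).
  by rewrite -IH subrK.
rewrite totient_pfactorR // [(1 - z) * (_ * euler_tail _ _)]mulrCA euler_tail_key.
rewrite -divk_pfactorS [divk j.+1 (p ^ g.+1)]divk_pfactorS big_nat_recr //= -divk_pfactorS natrD.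
have := euler_tail_diff i g.+1; have := euler_tail_diff j g.+1; have := zp g.+1.
set P := (p ^ g.+1)%N%:R; set Z := z ^+ g.+1; set D := (divk j.+1 (p ^ g))%:R.
set di := (divk i _)%:R; set dj := (divk j _)%:R => PZ ej ei.
have -> : di = P * (euler_tail i g.+1 - euler_tail i g.+2) by rewrite ei mulrCA PZ mulr1.
have -> : dj = P * (euler_tail j g.+1 - euler_tail j g.+2) by rewrite ej mulrCA PZ mulr1.
rewrite [P * _ * _](_ : _ = P * (euler_tail i g.+1 - euler_tail i g.+2) * euler_tail j g.+1 + (euler_tail i g.+1 - euler_tail i g.+2) * (P * Z) * D); last by ring.
rewrite PZ; ring.
Qed.

End LocalFactors.

(** * Euler products and the singular series *)

Section EulerProduct.
Local Open Scope classical_set_scope.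
Variable R : realType.

Lemma powRN_cvg0 (e : R) : 0 < e -> (fun N : nat => N%:R `^ (- e)) @ \oo --> (0 : R).
Proof.
move=> e0; apply/cvgrPdist_le => eps eps0.
pose K := (Num.truncn (eps `^ (- e^-1))).+1.
exists K => // N /= KN.
have N0 : (0 : R) < N%:R by rewrite ltr0n; apply: leq_trans KN.
rewrite sub0r normrN ger0_norm ?powR_ge0 //.
apply: (@le_trans _ _ ((eps `^ (- e^-1)) `^ (- e))).
  apply: le_powR_baseN; rewrite ?powR_gt0 ?oppr_le0 ?ltW //.
  by apply: lt_le_trans (truncnS_gt _) _; rewrite ler_nat.
by rewrite -powRrM mulrNN mulVf ?gt_eqF // powRr1 // ltW.
Qed.

Lemma cvg0_dominated (a : nat -> R) (C e : R) : 0 < e ->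
  (forall N, (0 < N)%N -> `|a N| <= C * N%:R `^ (- e)) -> a @ \oo --> (0 : R).
Proof.
move=> e0 H; apply/cvgrPdist_le => eps eps0.
have h : (fun N : nat => C * N%:R `^ (- e)) @ \oo --> (0 : R).
  by rewrite -[X in _ --> X](mulr0 C); apply: cvgMr; exact: powRN_cvg0.
have /cvgrPdist_le /(_ _ eps0) [K _ HK] := h.
exists K.+1 => // N /= KN; rewrite sub0r normrN.
apply: le_trans (H N (leq_ltn_trans (leq0n _) KN)) _.
have := HK N (ltnW KN); rewrite /= sub0r normrN; exact/le_trans/ler_norm.
Qed.

Lemma abs_series (G : nat -> R) (C e : R) : 0 < e -> 0 <= C ->
  (forall d, (0 < d)%N -> `|G d| <= C * d%:R `^ (- (1 + e))) ->
  exists2 S : R, (fun N : nat => \sum_(1 <= d < N) G d) @ \oo --> S &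
  forall N, (0 < N)%N -> `|S - \sum_(1 <= d < N) G d| <= C * (1 + e^-1) * N%:R `^ (- e).
Proof.
move=> e0 C0 H.
pose E (N : nat) : R := C * (1 + e^-1) * N%:R `^ (- e).
have tailn N M : (0 < N)%N -> \sum_(N <= d < M) `|G d| <= E N.
  move=> N0; rewrite /E -mulrA; apply: le_trans (ler_wpM2l C0 (pseries_tail M e0 N0)).
  rewrite big_distrr /=; apply: ler_sum_nat => d /andP[Nd _].
  by apply: H; exact: leq_trans Nd.
have ndcvg (F : nat -> R) (b : R) : (forall d, 0 <= F d) ->
    (forall N, \sum_(1 <= d < N) F d <= b) -> cvgn (fun N : nat => \sum_(1 <= d < N) F d).
  move=> F0 Fb; apply: nondecreasing_is_cvgn.
    apply/nondecreasing_seqP => -[|n]; first by rewrite !big_geq.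
    by rewrite [leRHS]big_nat_recr //= lerDl.
  by exists b => _ [N _ <-].
have c1 := ndcvg (fun d => `|G d|) (E 1%N) (fun d => normr_ge0 _) (fun N => tailn 1%N N isT).
(* Both |G| and |G| + G are nonnegative with bounded partial sums; G is their difference. *)
have c2 : cvgn (fun N : nat => \sum_(1 <= d < N) (`|G d| + G d)).
  apply: (ndcvg _ (E 1%N + E 1%N)) => [d|N].
    by rewrite -lerBlDr sub0r -normrN ler_norm.
  apply: (@le_trans _ _ (\sum_(1 <= d < N) (`|G d| + `|G d|))).
    by apply: ler_sum => d _; rewrite lerD2l ler_norm.
  by rewrite big_split lerD // tailn.
have uE : (fun N : nat => \sum_(1 <= d < N) G d) =
    (fun N : nat => \sum_(1 <= d < N) (`|G d| + G d) - \sum_(1 <= d < N) `|G d|).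
  by apply/funext => N; rewrite big_split /= addrAC subrr add0r.
have c : cvgn (fun N : nat => \sum_(1 <= d < N) G d).
  by rewrite uE; apply: is_cvgB.
exists (limn (fun N : nat => \sum_(1 <= d < N) G d)); first exact: c.
move=> N N0.
have h : (fun M : nat => `|\sum_(1 <= d < M) G d - \sum_(1 <= d < N) G d|) @ \oo -->
    `|limn (fun N : nat => \sum_(1 <= d < N) G d) - \sum_(1 <= d < N) G d|.
  by apply: cvg_norm; apply: cvgB => //; exact: cvg_cst.
apply: (ler_cvg_to h (cvg_cst (E N))).
exists N => // M /= NM.
rewrite (big_cat_nat N0 NM) /= addrAC subrr add0r.
apply: le_trans (ler_norm_sum _ _ _) (tailn _ _ N0).
Qed.

(** Its divisors are the d built from primes p < N with exponents at most v_p(h) + 1, beyond which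
    g_h vanishes. A finite Euler product thus becomes a divisor sum of one integer. *)
Definition euler_modulus (h N : nat) : nat := (\prod_(0 <= p < N | prime p) p ^ (logn p h).+1)%N.

Lemma euler_modulusS h N :
  euler_modulus h N.+1 = (euler_modulus h N * (if prime N then N ^ (logn N h).+1 else 1))%N.
Proof. by rewrite /euler_modulus !(big_mkcond prime) /= big_nat_recr. Qed.

Lemma euler_modulus_gt0 h N : (0 < euler_modulus h N)%N.
Proof. by apply: prodn_cond_gt0 => p pp; rewrite expn_gt0 prime_gt0. Qed.

Lemma coprime_euler_modulus h N : prime N -> coprime (euler_modulus h N) N.
Proof.
move=> pN; rewrite /euler_modulus big_nat_cond; apply: (big_ind (fun x => coprime x N)).
- exact: coprime1n.
- by move=> x y cx cy; rewrite coprimeMl cx.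
move=> p /andP[/andP[_ plt] pp]; apply: coprimeXl.
by rewrite prime_coprime // dvdn_prime2 // ltn_eqF.
Qed.

Lemma dvdn_euler_modulus h N d : (0 < d < N)%N ->
  (forall p, prime p -> (logn p d <= (logn p h).+1)%N) -> (d %| euler_modulus h N)%N.
Proof.
move=> /andP[d0 dN] H; apply/(dvdn_partP _ d0) => p pd.
have pp : prime p by move: pd; rewrite mem_primes => /andP[].
have plt : (p < N)%N.
  apply: leq_ltn_trans dN; apply: dvdn_leq => //.
  by move: pd; rewrite mem_primes => /and3P[].
rewrite p_part; apply: (@dvdn_trans (p ^ (logn p h).+1)); first by rewrite dvdn_exp2l // H.
rewrite /euler_modulus (big_mkcond prime) (bigD1_seq p) ?iota_uniq ?mem_index_iota //= pp.
exact: dvdn_mulr.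
Qed.

Lemma divsum_euler_modulus (G : nat -> R) h N : multiplicative G ->
  divsum G (euler_modulus h N) =
  \prod_(0 <= p < N | prime p) \sum_(0 <= a < (logn p h).+2) G (p ^ a)%N.
Proof.
move=> mG; rewrite (big_mkcond prime) /=; elim: N => [|N IH].
  by rewrite /euler_modulus !big_geq // (multiplicative_divsum mG).1.
rewrite big_nat_recr //= -IH euler_modulusS; case: ifP => pN; last by rewrite muln1 mulr1.
rewrite (multiplicative_divsum mG).2 ?euler_modulus_gt0 ?expn_gt0 ?prime_gt0 //.
  by rewrite sum_divisors_pfactor.
exact/coprimeXr/coprime_euler_modulus.
Qed.

(** A d < N with G d != 0 divides [euler_modulus h N], so the product over p < N and the partial sum
    over d < N differ only in terms with d >= N, a tail of an absolutely convergent series. *)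
Lemma euler_product (G : nat -> R) (C e S : R) h : 0 < e -> 0 <= C -> multiplicative G ->
  (forall d, (0 < d)%N -> `|G d| <= C * d%:R `^ (- (1 + e))) ->
  (forall p a, prime p -> ((logn p h).+1 < a)%N -> G (p ^ a)%N = 0) ->
  (fun N : nat => \sum_(1 <= d < N) G d) @ \oo --> S ->
  (fun N : nat => \prod_(0 <= p < N | prime p)
     \sum_(0 <= a < (logn p h).+2) G (p ^ a)%N) @ \oo --> S.
Proof.
move=> e0 C0 mG H G0 cS.
pose u N := \sum_(1 <= d < N) G d.
have dom N : (0 < N)%N -> `|divsum G (euler_modulus h N) - u N| <= C * (1 + e^-1) * N%:R `^ (- e).
  move=> N0; pose M := maxn N (euler_modulus h N).+1.
  have EM : (0 < euler_modulus h N < M)%N by rewrite euler_modulus_gt0 /M leq_max leqnn orbT.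
  have NM : (N <= M)%N by rewrite leq_maxl.
  rewrite /divsum (big_divisors G EM) big_mkcond /= (big_cat_nat N0 NM) /=.
  have -> : \sum_(1 <= d < N) (if (d %| euler_modulus h N)%N then G d else 0) = u N.
    apply: eq_big_nat => d dN; case: ifP => // dE; have /andP[d0 _] := dN.
    have [p [pp pd]] : exists p, prime p /\ ((logn p h).+1 < logn p d)%N.
      apply: contrapT => nex; move: dE; rewrite dvdn_euler_modulus // => p pp.
      by rewrite leqNgt; apply/negP => lt; apply: nex; exists p.
    have [m cpm Ed] := pfactor_coprime pp d0.
    have m0 : (0 < m)%N by move: d0; rewrite Ed muln_gt0 => /andP[].
    rewrite Ed mG.2 ?expn_gt0 ?(prime_gt0 pp) //; last by rewrite coprime_sym coprimeXl.
    by rewrite G0 ?mulr0.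
  rewrite addrAC subrr add0r; apply: le_trans (ler_norm_sum _ _ _) _.
  rewrite -mulrA; apply: le_trans (ler_wpM2l C0 (pseries_tail M e0 N0)).
  rewrite big_distrr /=; apply: ler_sum_nat => d /andP[Nd _].
  have d0 : (0 < d)%N := leq_trans N0 Nd.
  by case: ifP => _; [exact: H | rewrite normr0 mulr_ge0 ?powR_ge0].
have -> : (fun N : nat => \prod_(0 <= p < N | prime p)
     \sum_(0 <= a < (logn p h).+2) G (p ^ a)%N) =
   (fun N => u N + (divsum G (euler_modulus h N) - u N)).
  by apply/funext => N; rewrite addrC subrK divsum_euler_modulus.
rewrite -[X in _ --> X]addr0; apply: cvgD => //.
exact: cvg0_dominated e0 dom.
Qed.

End EulerProduct.

(** * The singular series equals C f *)

Section SingularSeries.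
Local Open Scope classical_set_scope.
Variable R : realType.

Lemma euler_tail_cvg0 p j : prime p -> euler_tail R p j @ \oo --> (0 : R).
Proof.
move=> pp; have e0 : 0 < 2^-1 :> R by rewrite invr_gt0.
have [C C0 H] := dens_pow_bound j e0.
have o0 := onez_gt0 R pp.
apply: (@cvg0_dominated _ _ (C / (1 - p%:R^-1) ^+ j) _ e0) => N N0.
rewrite ger0_norm; last by rewrite divr_ge0 ?dens_ge0 ?exprn_ge0 // ltW.
rewrite /euler_tail mulrAC ler_pM2r ?invr_gt0 ?exprn_gt0 //.
apply: le_trans (H (p ^ N)%N _) _; first by rewrite expn_gt0 prime_gt0.
rewrite ler_pM2l // (_ : 2^-1 - 1 = - 2^-1 :> R); last by lra.
apply: le_powR_baseN; rewrite ?oppr_le0 ?ltW ?ltr0n // ltr_nat.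
exact: ltn_expl (prime_gt1 pp).
Qed.

Lemma tail_lim p j a : prime p ->
  lim ((fun N : nat => \sum_(a <= b < N)
         ((divisor_fun j (p ^ b))%:R * p%:R ^- b : R)) @ \oo) = euler_tail R p j a.
Proof.
move=> pp; apply/cvg_lim => //.
have h : (fun N : nat => euler_tail R p j a - euler_tail R p j N) @ \oo --> euler_tail R p j a.
  rewrite -[X in _ --> X]subr0; apply: cvgB; first exact: cvg_cst.
  exact: euler_tail_cvg0.
apply: cvg_trans h; apply: near_eq_cvg; exists a => // N /= aN.
rewrite -tail_sum //; apply: eq_bigr => b _; rewrite divisor_funE //.
by rewrite expn_gt0 prime_gt0.
Qed.

Definition local_num (i j p g : nat) : R :=
  (1 - p%:R^-1) * (\sum_(0 <= a < g.+1) (divk i (p ^ a))%:R * euler_tail R p j.+1 a)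
    + (divk j.+1 (p ^ g))%:R * euler_tail R p i g.+1.

Lemma local_factor_numE i j p g : prime p ->
  local_factor_num R j.+1 i.+1 p g = local_num i j p g.
Proof.
move=> pp; rewrite /local_factor_num !subn1 /= tail_lim // /local_num.
rewrite divisor_funE ?expn_gt0 ?prime_gt0 //; congr (_ * _ + _).
apply: eq_bigr => a _; rewrite tail_lim // divisor_funE //.
by rewrite expn_gt0 prime_gt0.
Qed.

Definition singular_term (h i j d : nat) : R := gcd_moebius R h d * (dens R i d * dens R j d).

Lemma multiplicative_singular_term h i j : multiplicative (singular_term h i j).
Proof. exact/(multiplicativeM (multiplicative_gcd_moebius R h))/(multiplicativeM (multiplicative_dens R i) (multiplicative_dens R j)). Qed.

(** The coefficient g_h is at most h in absolute value and each density is O(d^(-3/4)), hence the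
    exponent 3/2. *)
Lemma singular_term_bound h i j : (0 < h)%N -> exists2 C : R, 0 <= C &
  forall d, (0 < d)%N -> `|singular_term h i j d| <= C * d%:R `^ (- (1 + 2^-1)).
Proof.
move=> h0; have e0 : 0 < 4^-1 :> R by rewrite invr_gt0.
have [C1 C10 H1] := dens_pow_bound i e0; have [C2 C20 H2] := dens_pow_bound j e0.
exists (h%:R * (C1 * C2)) => [|d d0]; first by rewrite !mulr_ge0 // ltW.
have dR : (0 : R) < d%:R by rewrite ltr0n.
rewrite /singular_term normrM -mulrA ler_pM ?gcd_moebius_le //.
rewrite ger0_norm ?mulr_ge0 ?dens_ge0 //.
rewrite (_ : - (1 + 2^-1) = (4^-1 - 1) + (4^-1 - 1)); last by lra.
by rewrite powRD_gt0 // mulrACA ler_pM ?dens_ge0 ?H1 ?H2.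
Qed.

(** The powers of 1 - 1/p come out of the densities, and [local_identity] does the rest. *)
Lemma singular_term_local h i j p : prime p ->
  \sum_(0 <= a < (logn p h).+2) singular_term h i j (p ^ a)%N =
  (1 - p%:R^-1) ^+ (i + j) * local_num i j p (logn p h).
Proof.
move=> pp; have o0 := onez_gt0 R pp.
have Uc k a : dens R k (p ^ a) = (1 - p%:R^-1) ^+ k * euler_tail R p k a.
  by rewrite /euler_tail mulrC divfK // expf_neq0 // gt_eqF.
rewrite /local_num -local_identity // big_nat_recr //= mulrBr big_distrr /=; congr (_ + _).
  apply: eq_big_nat => a /andP[_ ag]; rewrite /singular_term gcd_moebius_pfactor // /gcd_local -ltnS ag !Uc exprD.
  by ring.
rewrite /singular_term gcd_moebius_pfactor // /gcd_local ltnn eqxx !Uc exprD.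
by ring.
Qed.

Definition local_den (i j p : nat) : R := euler_tail R p i 0 + euler_tail R p j 0 - 1.

Lemma local_den_gt0 i j p : prime p -> 0 < local_den i j p.
Proof.
by move=> pp; have := euler_tail_ge1 R pp i; have := euler_tail_ge1 R pp j; rewrite /local_den; lra.
Qed.

(** At a prime not dividing h the numerator of f reduces to its denominator; so the Euler product
    for h and the one for 1 differ only at p | h. *)
Lemma local_num0 i j p : prime p -> local_num i j p 0 = local_den i j p.
Proof.
move=> pp; rewrite /local_num big_nat1 expn0 !divk_at1 !mul1r euler_tail_rec0 // /local_den.
have := euler_tail_diff R pp i 0; rewrite expn0 expr0 divk_at1 => e.
have -> : euler_tail R p i 1 = euler_tail R p i 0 - 1 by rewrite -[X in _ - X](mulr1 1%:R) -e; ring.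
ring.
Qed.

Lemma local_den_expand i j p : prime p ->
  (1 - p%:R^-1) ^+ (i + j) * local_den i j p =
  (1 - p%:R^-1) ^+ i + (1 - p%:R^-1) ^+ j - (1 - p%:R^-1) ^+ (i + j).
Proof.
move=> pp; have o0 := onez_gt0 R pp; rewrite /local_den !euler_tail_at0 exprD.
by field; rewrite !expf_neq0 // gt_eqF.
Qed.

(** C is the singular series of h = 1, by [local_num0] and [local_den_expand], which also shows that
    its product converges. Once N > h, the partial product for h is the one for 1 multiplied by
    f. *)
Lemma singular_series h i j (S : R) : (0 < h)%N ->
  (fun N : nat => \sum_(1 <= d < N) singular_term h i j d) @ \oo --> S ->
  S = singular_constant R j.+1 i.+1 * singular_factor R j.+1 i.+1 h.
Proof.
move=> h0 cS; have e0 : 0 < 2^-1 :> R by rewrite invr_gt0.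
have cv g (T : R) : (0 < g)%N -> (fun N : nat => \sum_(1 <= d < N) singular_term g i j d) @ \oo --> T ->
  (fun N : nat => \prod_(0 <= p < N | prime p)
     ((1 - p%:R^-1) ^+ (i + j) * local_num i j p (logn p g))) @ \oo --> T.
  move=> g0 cT; have [C C0 HC] := singular_term_bound i j g0.
  have := @euler_product R _ C _ T g e0 C0 (multiplicative_singular_term g i j) HC _ cT.
  have -> : (fun N : nat => \prod_(0 <= p < N | prime p)
     \sum_(0 <= a < (logn p g).+2) singular_term g i j (p ^ a)%N) = (fun N : nat => \prod_(0 <= p < N | prime p)
     ((1 - p%:R^-1) ^+ (i + j) * local_num i j p (logn p g))).
    by apply/funext => N; apply: eq_bigr => p pp; exact: singular_term_local.
  apply => p a pp lta; rewrite /singular_term gcd_moebius_pfactor // /gcd_local leqNgt (ltnW lta) /=.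
  by rewrite gtn_eqF // mul0r.
have [C C0 HC] := singular_term_bound i j (isT : 0 < 1)%N.
have [S1 cS1 _] := abs_series e0 C0 HC.
have E1 : singular_constant R j.+1 i.+1 = S1.
  rewrite /singular_constant; apply/cvg_lim => //.
  rewrite (_ : (fun N : nat => _) = (fun N : nat => \prod_(0 <= p < N | prime p)
     ((1 - p%:R^-1) ^+ (i + j) * local_num i j p (logn p 1)))); first exact: cv.
  apply/funext => N; apply: eq_bigr => p pp.
  by rewrite logn1 local_num0 // local_den_expand // !subn1 /= addSn addnS subn2 /= [(j + i)%N]addnC.
rewrite E1; have c1 := cv 1%N S1 isT cS1; have ch := cv h S h0 cS.
pose r p := local_num i j p (logn p h) / local_den i j p.
have Ef : singular_factor R j.+1 i.+1 h = \prod_(p <- primes h) r p.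
  rewrite /singular_factor; apply: eq_big_seq => p; rewrite mem_primes => /and3P[pp _ _].
  rewrite local_factor_numE // /r /local_den; congr (_ / _).
  rewrite !euler_tail_at0 //.
  have ex n : (1 - p%:R^-1) ^ (1 - n.+1%:Z) = (1 - p%:R^-1) ^- n :> R.
    by rewrite -addn1 PoszD opprD addrCA subrr addr0 -exprnN.
  by rewrite !ex; ring.
rewrite Ef; apply: (cvg_unique _ ch) => //.
have h1 : (fun N : nat => (\prod_(0 <= p < N | prime p)
     ((1 - p%:R^-1) ^+ (i + j) * local_num i j p (logn p 1))) * \prod_(p <- primes h) r p) @ \oo
   --> S1 * \prod_(p <- primes h) r p.
  by apply: cvgM => //; exact: cvg_cst.
apply: cvg_trans h1; apply: near_eq_cvg; exists h.+1 => // N /= hN.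
have -> : \prod_(p <- primes h) r p = \prod_(0 <= p < N | prime p) (if (p %| h)%N then r p else 1).
  rewrite -big_mkcondr -[RHS]big_filter; apply: perm_big; apply: uniq_perm.
  - exact: primes_uniq.
  - exact/filter_uniq/iota_uniq.
  move=> p; rewrite mem_filter mem_index_iota mem_primes h0 /=.
  case: (boolP (p %| h)%N) => ph; rewrite ?andbF // ?andbT.
  by rewrite (leq_trans _ hN) ?andbT // ltnS dvdn_leq.
rewrite -big_split /=; apply: eq_bigr => p pp.
rewrite logn1 local_num0 //; case: ifP => ph.
  by rewrite /r -mulrA; congr (_ * _); rewrite mulrC divfK // gt_eqF // local_den_gt0.
rewrite mulr1; have -> : logn p h = 0%N by rewrite lognE pp h0 ph.
by rewrite local_num0.
Qed.

End SingularSeries.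

(** * Sums over pairs *)

Section DoubleSums.
Local Open Scope classical_set_scope.
Variable R : realType.
Implicit Types (Q X : R).

(** Divisibility as a 0-1 factor on a common range, ready for exchanges of summation. *)
Lemma divsum_bool (f : nat -> R) n M : (0 < n < M)%N ->
  divsum f n = \sum_(1 <= d < M) f d * (d %| n)%N%:R.
Proof.
move=> nM; rewrite /divsum (big_divisors f nM) big_mkcond /=.
by apply: eq_bigr => d _; case: (d %| n)%N; rewrite ?mulr1 ?mulr0.
Qed.

Lemma logsum_bool M j i Q m : logsum M j i Q m =
  \sum_(1 <= q < M) (m %| q)%N%:R * ((divk j q)%:R / q%:R * logpow i (Q / q%:R)).
Proof.
rewrite /logsum big_mkcond /=; apply: eq_bigr => q _.
by case: (m %| q)%N; rewrite ?mul1r ?mul0r.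
Qed.

(* The sieve error for the modulus q is the sum of e^(-1/2) over e | q, divided
   by phi(q); [tau_series] takes care of q / phi(q). *)
Definition sieve_weight (q : nat) : R := divsum (fun e => e%:R `^ (- 2^-1)) q * tau_series R q.

(** Opening both divisor sums leaves, for each pair (e, d), a sum over the multiples q of lcm(e, d).
    Its decay in the lcm makes the double series over e and d converge, so the weight costs no
    logarithm. *)
Lemma sieve_weight_bound j : exists2 K : R, 0 <= K & forall M Q, 1 <= Q < M%:R ->
  \sum_(1 <= q < M) (divk j q)%:R / q%:R * logpow 0 (Q / q%:R) * sieve_weight q
    <= K * (1 + ln Q) ^+ j.
Proof.
have e0 : 0 < 8^-1 :> R by rewrite invr_gt0.
have [C1 C10 H1] := logsum_majorant_pow_bound j e0; have [C2 C20 H2] := divk_pow_bound 2 e0.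
have [K K0 HK] := logsum_upper R j 0.
(* The decay lcm(e, d)^(-7/8) is shared as e^(-21/32) d^(-7/32). Together with e^(-1/2) and d^(-7/8)
   this makes the exponents 37/32 = 1 + s1 and 35/32 = 1 + s2. *)
pose s1 : R := 5%:R / 32%:R; pose s2 : R := 3%:R / 32%:R.
have s10 : 0 < s1 by rewrite divr_gt0.
have s20 : 0 < s2 by rewrite divr_gt0.
exists (K * C1 * C2 * ((1 + s1^-1) * (1 + s2^-1))) => [|M Q QM].
  have i1 : 0 <= s1^-1 by rewrite invr_ge0 ltW.
  have i2 : 0 <= s2^-1 by rewrite invr_ge0 ltW.
  by rewrite !mulr_ge0 ?addr_ge0 ?(ltW C10) ?(ltW C20).
pose w (e d : nat) : R := e%:R `^ (- 2^-1) * ((divk 2 d)%:R / d%:R).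
pose L : R := (1 + ln Q) ^+ j.
have L0 : 0 <= L by rewrite exprn_ge0 // addr_ge0 // ln_ge0; case/andP: QM.
have -> : \sum_(1 <= q < M) (divk j q)%:R / q%:R * logpow 0 (Q / q%:R) * sieve_weight q =
   \sum_(1 <= e < M) \sum_(1 <= d < M) w e d * logsum M j 0 Q (lcmn e d).
  rewrite (eq_big_nat _ _ (F2 := fun q => \sum_(1 <= e < M) \sum_(1 <= d < M)
     w e d * ((lcmn e d %| q)%N%:R * ((divk j q)%:R / q%:R * logpow 0 (Q / q%:R))))); last first.
    move=> q qM; rewrite /sieve_weight /tau_series !(divsum_bool _ qM) big_distrlr big_distrr /=.
    apply: eq_bigr => e _; rewrite big_distrr /=; apply: eq_bigr => d _.
    by rewrite dvdn_lcm -mulnb natrM /w; ring.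
  rewrite exchange_big_nat /=; apply: eq_bigr => e _.
  rewrite exchange_big_nat /=; apply: eq_bigr => d _.
  by rewrite logsum_bool big_distrr.
apply: (@le_trans _ _ (\sum_(1 <= e < M) \sum_(1 <= d < M)
    (K * C1 * C2 * L) * (e%:R `^ (- (1 + s1)) * d%:R `^ (- (1 + s2))))).
  apply: ler_sum_nat => e /andP[e1 _]; apply: ler_sum_nat => d /andP[d1 _].
  have eR : (0 : R) < e%:R by rewrite ltr0n.
  have dR : (0 : R) < d%:R by rewrite ltr0n.
  have l0 : (0 < lcmn e d)%N by rewrite lcmn_gt0 e1.
  have lR : (0 : R) < (lcmn e d)%:R by rewrite ltr0n.
  have Dle : logsum M j 0 Q (lcmn e d) <= K * C1 * L * (e%:R `^ (- (21%:R / 32%:R)) * d%:R `^ (- (7%:R / 32%:R))).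
    apply: le_trans (HK M Q _ QM l0) _; rewrite add0n -/L.
    have := H1 _ l0; move: (logsum_majorant R j (lcmn e d)) => G HG; rewrite -!mulrA.
    rewrite ler_wpM2l // [leLHS]mulrC [leRHS]mulrCA ler_wpM2l //.
    apply: le_trans HG _; rewrite ler_pM2l //.
    rewrite (_ : 8^-1 - 1 = - (21%:R / 32%:R) + - (7%:R / 32%:R)); last by field.
    rewrite powRD_gt0 // ler_pM ?powR_ge0 //; apply: le_powR_baseN => //.
      by rewrite ler_nat dvdn_leq // dvdn_lcml.
    by rewrite ler_nat dvdn_leq // dvdn_lcmr.
  have wle : w e d <= C2 * (e%:R `^ (- 2^-1) * d%:R `^ (8^-1 - 1)).
    rewrite /w [leRHS]mulrCA ler_wpM2l ?powR_ge0 // powRD_gt0 // powR_inv1 // mulrA.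
    by rewrite ler_pM2r ?invr_gt0 // H2.
  have w0 : 0 <= w e d by rewrite mulr_ge0 ?powR_ge0 ?divr_ge0.
  apply: le_trans (ler_pM w0 (logsum_ge0 _ _ _ _ _) wle Dle) _.
  rewrite (_ : - (1 + s1) = - 2^-1 + - (21%:R / 32%:R)); last by rewrite /s1; field.
  rewrite (_ : - (1 + s2) = (8^-1 - 1) + - (7%:R / 32%:R)); last by rewrite /s2; field.
  rewrite !powRD_gt0 //; rewrite le_eqVlt; apply/orP; left; apply/eqP; ring.
have -> : \sum_(1 <= e < M) \sum_(1 <= d < M)
    (K * C1 * C2 * L) * (e%:R `^ (- (1 + s1)) * d%:R `^ (- (1 + s2))) =
   (K * C1 * C2 * L) * ((\sum_(1 <= e < M) e%:R `^ (- (1 + s1))) * (\sum_(1 <= d < M) d%:R `^ (- (1 + s2)))).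
  rewrite big_distrlr big_distrr /=; apply: eq_bigr => e _; by rewrite big_distrr.
rewrite -/L [leRHS]mulrAC; apply: ler_wpM2l.
  by rewrite !mulr_ge0 ?(ltW C10) ?(ltW C20).
apply: ler_pM.
- by apply: sumr_ge0 => e _; exact: powR_ge0.
- by apply: sumr_ge0 => e _; exact: powR_ge0.
- by have := pseries_tail M s10 (isT : 0 < 1)%N; rewrite powR1 mulr1.
by have := pseries_tail M s20 (isT : 0 < 1)%N; rewrite powR1 mulr1.
Qed.

(** L^i / L is monotone in L only for i >= 1; at i = 0 the comparability La <= c L takes over. *)
Lemma scale_log (c L La : R) i : 1 <= L -> L <= La -> La <= c * L ->
  L ^+ i / L <= c * (La ^+ i / La).
Proof.
move=> L1 LLa LacL; have L0 : 0 < L := lt_le_trans ltr01 L1.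
have La0 : 0 < La := lt_le_trans L0 LLa.
rewrite ler_pdivrMr // mulrCA -mulrA; apply: (@le_trans _ _ (La ^+ i)).
  by rewrite lerXn2r ?nnegrE ?(ltW L0) ?(ltW La0).
rewrite -[leLHS]mulr1 ler_wpM2l ?exprn_ge0 ?(ltW La0) //.
by rewrite mulrAC ler_pdivlMr // mul1r.
Qed.

Lemma dens_le_logsum_majorant j m : (0 < m)%N -> dens R j m <= logsum_majorant R j m.
Proof.
move=> m0; apply: le_trans (dens_le R j m0) _; rewrite /logsum_majorant ler_pM2r ?invr_gt0 ?ltr0n //.
by rewrite ler_peMl // exprn_ege1 // ln1_ge1.
Qed.

(** The sum W, with 1 / [q, r] written as (q, r) / (q r) and [logpow 0] as the indicator of the
    cut-off. *)
Definition pair_sum M (Q1 Q2 : R) (h i j : nat) : R :=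
  \sum_(1 <= q < M) \sum_(1 <= r < M)
    ((divk i q)%:R / q%:R * logpow 0 (Q1 / q%:R)) * ((divk j r)%:R / r%:R * logpow 0 (Q2 / r%:R))
     * ((gcdn q r)%:R * (gcdn q r %| h)%N%:R).

Lemma pair_sumE M Q1 Q2 h i j : (0 < h)%N ->
  pair_sum M Q1 Q2 h i j = \sum_(1 <= d < M) gcd_moebius R h d * (logsum M i 0 Q1 d * logsum M j 0 Q2 d).
Proof.
move=> h0; rewrite /pair_sum.
rewrite (eq_big_nat _ _ (F2 := fun q => \sum_(1 <= r < M) \sum_(1 <= d < M) gcd_moebius R h d *
   (((d %| q)%N%:R * ((divk i q)%:R / q%:R * logpow 0 (Q1 / q%:R))) *
    ((d %| r)%N%:R * ((divk j r)%:R / r%:R * logpow 0 (Q2 / r%:R)))))); last first.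
  move=> q /andP[q0 qM]; apply: eq_big_nat => r rM.
  have g0 : (0 < gcdn q r)%N by rewrite gcdn_gt0 q0.
  rewrite -divsum_gcd_moebius // (@divsum_bool _ _ M); last first.
    by rewrite g0 (leq_ltn_trans _ qM) // dvdn_leq // dvdn_gcdl.
  rewrite big_distrr /=; apply: eq_bigr => d _.
  by rewrite dvdn_gcd -mulnb natrM; ring.
rewrite [LHS](eq_bigr (fun q => \sum_(1 <= d < M) gcd_moebius R h d *
   (((d %| q)%N%:R * ((divk i q)%:R / q%:R * logpow 0 (Q1 / q%:R))) * logsum M j 0 Q2 d))); last first.
  move=> q _; rewrite exchange_big_nat /=; apply: eq_bigr => d _.
  by rewrite logsum_bool !big_distrr.
rewrite exchange_big_nat /=; apply: eq_bigr => d _.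
by rewrite -big_distrr -big_distrl /= -logsum_bool.
Qed.

(** The two asymptotics are inserted for each d; both majorants are O(d^(-3/4)), so the errors are
    summable over d. Completing the series costs M^(-1/2), less than 1 / log X. The constant c
    expresses that Q1 and Q2 are comparable to X on the logarithmic scale. *)
Lemma pair_sum_asym h i j (S c : R) : (0 < h)%N -> 0 < c ->
  (fun N : nat => \sum_(1 <= d < N) singular_term R h i j d) @ \oo --> S ->
  exists2 K : R, 0 <= K & forall M Q1 Q2 X, 1 <= Q1 -> 1 <= Q2 -> Q1 <= X -> Q2 <= X ->
    X < M%:R -> 1 + ln X <= c * (1 + ln Q1) -> 1 + ln X <= c * (1 + ln Q2) ->
    `|pair_sum M Q1 Q2 h i j - S * (logpow i Q1 * logpow j Q2)| <=
      K * ((1 + ln X) ^+ (i + j) / (1 + ln X)).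
Proof.
move=> h0 c0 cS.
have e0 : 0 < 2^-1 :> R by rewrite invr_gt0.
have e40 : 0 < 4^-1 :> R by rewrite invr_gt0.
have [C C0 HC] := singular_term_bound R i j h0.
have [S' cS' HS'] := abs_series e0 C0 HC.
have ES : S' = S by apply: (cvg_unique _ cS' cS).
rewrite {}ES in cS' HS'.
have [K1 K10 H1] := logsum_upper R i 0; have [K2 K20 H2] := logsum_upper R j 0.
have [K3 K30 H3] := logsum_asym R i 0; have [K4 K40 H4] := logsum_asym R j 0.
have [C1 C10 G1] := logsum_majorant_pow_bound i e40; have [C2 C20 G2] := logsum_majorant_pow_bound j e40.
have [C3 C30 L3] := ln_pow_bound 1 e0.
pose B := h%:R * (C1 * C2) * (1 + (2^-1)^-1) * (c * (K3 * K2 + K4)).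
pose T := C * (1 + (2^-1)^-1) * C3.
have p3 : 0 <= 1 + (2^-1)^-1 :> R by rewrite addr_ge0 // invr_ge0 invr_ge0.
have B0 : 0 <= B by rewrite !mulr_ge0 ?addr_ge0 ?mulr_ge0 ?(ltW C10) ?(ltW C20) ?(ltW c0).
have T0 : 0 <= T by rewrite !mulr_ge0 ?(ltW C30).
exists (B + T) => [|M Q1 Q2 X Q11 Q21 Q1X Q2X XM cQ1 cQ2]; first exact: addr_ge0.
have X1 : 1 <= X := le_trans Q11 Q1X.
have X0 : 0 < X := lt_le_trans ltr01 X1.
have M0 : (0 < M)%N by rewrite -(ltr0n R) (lt_trans X0).
have Q1M : 1 <= Q1 < M%:R by rewrite Q11 (le_lt_trans Q1X).
have Q2M : 1 <= Q2 < M%:R by rewrite Q21 (le_lt_trans Q2X).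
have q10 : 0 < Q1 := lt_le_trans ltr01 Q11; have q20 : 0 < Q2 := lt_le_trans ltr01 Q21.
set La := 1 + ln X; set L1 := 1 + ln Q1 in cQ1; set L2 := 1 + ln Q2 in cQ2.
have l11 : 1 <= L1 by rewrite lerDl ln_ge0.
have l21 : 1 <= L2 by rewrite lerDl ln_ge0.
have l1a : L1 <= La by rewrite lerD2l ler_ln ?posrE.
have l2a : L2 <= La by rewrite lerD2l ler_ln ?posrE.
have La1 : 1 <= La := le_trans l11 l1a.
have La0 : 0 < La := lt_le_trans ltr01 La1.
have L10 : 0 <= L1 := le_trans ler01 l11. have L20 : 0 <= L2 := le_trans ler01 l21.
rewrite pair_sumE //.
pose main := \sum_(1 <= d < M) singular_term R h i j d.
apply: le_trans (ler_distD (main * (logpow i Q1 * logpow j Q2)) _ _) _.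
rewrite [leRHS]mulrDl; apply: lerD; last first.
  rewrite -mulrBl normrM [`|logpow i Q1 * _|]ger0_norm ?mulr_ge0 ?logpow_ge0 //.
  have t1 : `|main - S| <= T / La.
    rewrite distrC; apply: le_trans (HS' M M0) _; rewrite /T -!mulrA.
    rewrite !ler_wpM2l //.
    rewrite ler_pdivlMr // powRN mulrC ler_pdivrMr ?powR_gt0 ?ltr0n //.
    have := L3 X X1; rewrite expr1 -/La => /le_trans; apply.
    by rewrite ler_pM2l // le_powR_base ?ltW.
  have t2 : logpow i Q1 * logpow j Q2 <= La ^+ (i + j).
    rewrite exprD ler_pM ?logpow_ge0 //.
      by apply: le_trans (logpow_le_pow i Q11) _; rewrite lerXn2r ?nnegrE // ltW.
    by apply: le_trans (logpow_le_pow j Q21) _; rewrite lerXn2r ?nnegrE // ltW.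
  apply: le_trans (ler_pM _ _ t1 t2) _; rewrite ?mulr_ge0 ?logpow_ge0 //.
  by rewrite mulrAC mulrA.
rewrite /main big_distrl -sumrB /=; apply: le_trans (ler_norm_sum _ _ _) _.
pose Y := c * (K3 * K2 + K4) * (La ^+ (i + j) / La).
have Y0 : 0 <= Y by rewrite !mulr_ge0 ?addr_ge0 ?mulr_ge0 ?exprn_ge0 ?invr_ge0 ?(ltW c0) ?(ltW La0).
apply: (@le_trans _ _ (\sum_(1 <= d < M) h%:R * (C1 * C2) * Y * d%:R `^ (- (1 + 2^-1)))).
  apply: ler_sum_nat => d /andP[d0 _].
  have dR : (0 : R) < d%:R by rewrite ltr0n.
  rewrite /singular_term -mulrA -mulrBr normrM -[leRHS]mulrA -[leRHS]mulrA ler_pM ?gcd_moebius_le //.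
  have D1 := H3 M Q1 d Q1M d0; have D2 := H4 M Q2 d Q2M d0.
  have U2 := H2 M Q2 d Q2M d0.
  rewrite add0n -/L1 in D1; rewrite add0n -/L2 in D2; rewrite add0n -/L2 in U2.
  set x1 := logsum M i 0 Q1 d in D1 *; set x2 := logsum M j 0 Q2 d in D2 U2 *.
  set y1 := dens R i d * logpow i Q1 in D1; set y2 := dens R j d * logpow j Q2 in D2.
  have -> : dens R i d * dens R j d * (logpow i Q1 * logpow j Q2) = y1 * y2 by rewrite /y1 /y2; ring.
  have -> : x1 * x2 - y1 * y2 = (x1 - y1) * x2 + y1 * (x2 - y2) by ring.
  have x20 : 0 <= x2 by exact: logsum_ge0.
  have y10 : 0 <= y1 by rewrite mulr_ge0 ?dens_ge0 ?logpow_ge0.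
  have y1le : y1 <= logsum_majorant R i d * L1 ^+ i.
    by rewrite ler_pM ?dens_ge0 ?logpow_ge0 ?dens_le_logsum_majorant // logpow_le_pow.
  apply: le_trans (ler_normD _ _) _.
  rewrite (normrM (x1 - y1) x2) (normrM y1 (x2 - y2)) (ger0_norm x20) (ger0_norm y10).
  have g1 := logsum_majorant_ge0 R i d; have g2 := logsum_majorant_ge0 R j d.
  apply: (@le_trans _ _ (logsum_majorant R i d * logsum_majorant R j d * Y)); last first.
    rewrite [leRHS](_ : _ = (C1 * C2) * d%:R `^ (- (1 + 2^-1)) * Y); last by ring.
    apply: ler_wpM2r => //.
    rewrite (_ : - (1 + 2^-1) = (4^-1 - 1) + (4^-1 - 1)); last by field.
    by rewrite powRD_gt0 // [leRHS]mulrACA ler_pM ?G1 ?G2.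
  have s1 := scale_log i l11 l1a cQ1; have s2 := scale_log j l21 l2a cQ2.
  have pj : L2 ^+ j <= La ^+ j by rewrite lerXn2r ?nnegrE // ltW.
  have pi' : L1 ^+ i <= La ^+ i by rewrite lerXn2r ?nnegrE // ltW.
  have i1 : 0 <= L1 ^+ i / L1 by rewrite divr_ge0 ?exprn_ge0.
  have i2 : 0 <= L2 ^+ j / L2 by rewrite divr_ge0 ?exprn_ge0.
  have j1 : 0 <= L1 ^+ i by rewrite exprn_ge0.
  have j2 : 0 <= L2 ^+ j by rewrite exprn_ge0.
  have z1 : (L1 ^+ i / L1) * L2 ^+ j <= c * (La ^+ (i + j) / La).
    apply: le_trans (ler_pM i1 j2 s1 pj) _; rewrite exprD.
    by rewrite le_eqVlt; apply/orP; left; apply/eqP; ring.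
  have z2 : L1 ^+ i * (L2 ^+ j / L2) <= c * (La ^+ (i + j) / La).
    apply: le_trans (ler_pM j1 i2 pi' s2) _; rewrite exprD.
    by rewrite le_eqVlt; apply/orP; left; apply/eqP; ring.
  have n1 : 0 <= `|x1 - y1| by []. have n2 : 0 <= `|x2 - y2| by [].
  have w1 := ler_pM n1 x20 D1 U2; have w2 := ler_pM y10 n2 y1le D2.
  apply: le_trans (lerD w1 w2) _.
  rewrite [leLHS](_ : _ = logsum_majorant R i d * logsum_majorant R j d * (K3 * K2 * ((L1 ^+ i / L1) * L2 ^+ j) + K4 * (L1 ^+ i * (L2 ^+ j / L2)))); last by ring.
  apply: ler_wpM2l; first exact: mulr_ge0.
  rewrite /Y [leRHS](_ : _ = K3 * K2 * (c * (La ^+ (i + j) / La)) + K4 * (c * (La ^+ (i + j) / La))); last by ring.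
  by rewrite lerD // ler_wpM2l // mulr_ge0.
rewrite -big_distrr /= /B [leRHS](_ : _ = h%:R * (C1 * C2) * Y * (1 + (2^-1)^-1)); last by rewrite /Y; ring.
apply: ler_wpM2l.
  by apply: mulr_ge0 => //; rewrite !mulr_ge0 ?(ltW C10) ?(ltW C20).
by have := pseries_tail M e0 (isT : 0 < 1)%N; rewrite powR1 mulr1.
Qed.

End DoubleSums.

(** * Exponents of distribution *)

Section Progressions.
Local Open Scope classical_set_scope.
Variable R : realType.

(** The main term is a complex residue; once it has cancelled, a difference of natural numbers
    remains and the bound descends to [R]. *)
Lemma normc_natB (a b : nat) (e : R) :
  `|a%:R - b%:R : R[i]| <= e%:C%C -> `|a%:R - b%:R : R| <= e.
Proof.
have -> : (a%:R - b%:R : R[i]) = ((a%:R - b%:R : R)%:C)%C.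
  by rewrite rmorphB /= !rmorph_nat.
by rewrite normc_def /= expr0n addr0 sqrtr_sqr lecR.
Qed.

(* The main term depends on the class only through g, so it cancels. *)
Lemma distribution_difference (g k : nat) (theta beta : R) : beta < theta ->
  exponent_of_distribution_wrt g k theta ->
  exists2 delta : R, 0 < delta <= 1 & exists2 K : R, 0 <= K &
  forall (x : R) (q b b' : nat), 1 <= x -> (0 < q)%N -> q%:R <= x `^ beta ->
    b <> 0 %[mod q] -> b' <> 0 %[mod q] -> gcdn b q = g -> gcdn b' q = g ->
    `|(\sum_(1 <= n < (Num.truncn x).+1 | (n == b %[mod q])%N) divisor_fun k n)%N%:R
      - (\sum_(1 <= n < (Num.truncn x).+1 | (n == b' %[mod q])%N) divisor_fun k n)%N%:R|
    <= K * (x `^ (1 - delta) / (totient (q %/ g))%:R).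
Proof.
move=> bt [_ H]; have e0 : 0 < theta - beta by rewrite subr_gt0.
have [d d0 [K HK]] := H _ e0.
(* Capping delta at 1 keeps the exponent 1 - delta nonnegative, so that x^(1 - delta) is
   nondecreasing in x. *)
exists (Num.min d 1); first by rewrite lt_min d0 ltr01 ge_min lexx orbT.
exists (2 * `|K|) => [|x q b b' x1 q0 qx b0 b'0 gb gb']; first by rewrite mulr_ge0.
have qx' : q%:R <= x `^ (theta - (theta - beta)) by rewrite opprB addrC subrK.
have h1 := HK x q b x1 q0 qx' b0 gb; have h2 := HK x q b' x1 q0 qx' b'0 gb'.
pose T : R := (totient (q %/ g))%:R.
apply: (@le_trans _ _ (K * (x `^ (1 - d) / T) + K * (x `^ (1 - d) / T))).
  apply: normc_natB; rewrite rmorphD /=; apply: le_trans (ler_distD _ _ _) _.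
  by apply: lerD h1 _; rewrite distrC; exact: h2.
have x0 : 0 < x := lt_le_trans ltr01 x1.
rewrite [leLHS](_ : _ = 2 * (K * (x `^ (1 - d) / T))); last by ring.
rewrite -[leRHS]mulrA ler_pM2l //.
apply: (@le_trans _ _ (`|K| * (x `^ (1 - d) / T))).
  by rewrite ler_wpM2r ?ler_norm // divr_ge0 ?powR_ge0.
rewrite ler_wpM2l // ler_wpM2r ?invr_ge0 // ler_powR // lerD2l lerN2.
by rewrite ge_min lexx.
Qed.

(** Integer cut-offs with n < y. The strict bound q < y^beta leaves room for a real x < y with q <=
    x^beta. *)
Definition equidistributed (k : nat) (beta : R) (g : nat) (delta K : R) : Prop :=
  forall (y q b b' : nat), (0 < q)%N -> q%:R < y%:R `^ beta ->
    b <> 0 %[mod q] -> b' <> 0 %[mod q] -> gcdn b q = g -> gcdn b' q = g ->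
    `|\sum_(1 <= n < y | (n == b %[mod q])%N) (divk k n)%:R
      - \sum_(1 <= n < y | (n == b' %[mod q])%N) (divk k n)%:R|
    <= K * (y%:R `^ (1 - delta) / (totient (q %/ g))%:R).

Lemma equidistributed_of_exponent (g k : nat) (theta beta : R) : 0 < beta < theta ->
  exponent_of_distribution_wrt g k theta ->
  exists2 delta : R, 0 < delta <= 1 & exists2 K : R, 0 <= K & equidistributed k beta g delta K.
Proof.
move=> /andP[be0 bt] H; have [d d0 [K K0 HK]] := distribution_difference bt H.
exists d => //; exists K => // y q b b' q0 qy b0 b'0 gb gb'.
have y0 : (0 < y)%N.
  case: y qy => // ; rewrite powR0 ?gt_eqF // => qy.
  by have := lt_le_trans qy (ler0n R q); rewrite ltxx.
have qR : (1 : R) <= q%:R by rewrite ler1n.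
have qR0 : (0 : R) < q%:R by rewrite ltr0n.
(* Any real x in [y - 1, y) gives the sum over n < y; this one also has
   q <= x^beta. *)
pose x : R := Num.max (q%:R `^ beta^-1) y.-1%:R.
have qb1 : 1 <= q%:R `^ beta^-1 by rewrite -[leLHS](powRr0 q%:R) ler_powR // invr_ge0 ltW.
have x1 : 1 <= x by rewrite /x le_max qb1.
have x0 : 0 < x := lt_le_trans ltr01 x1.
have qx : q%:R <= x `^ beta.
  have -> : q%:R = (q%:R `^ beta^-1) `^ beta :> R by rewrite -powRrM mulVf ?powRr1 // gt_eqF.
  by apply: le_powR_base; [exact: ltW|exact: powR_ge0|rewrite /x le_max lexx].
have qby : q%:R `^ beta^-1 < y%:R.
  have -> : y%:R = (y%:R `^ beta) `^ beta^-1 :> R by rewrite -powRrM divff ?powRr1 // gt_eqF.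
  by apply: gt0_ltr_powR; rewrite ?invr_gt0 // nnegrE ?powR_ge0.
have xy : x < y%:R by rewrite /x gt_max qby ltr_nat ltn_predL.
have tx : (Num.truncn x).+1 = y.
  have -> : Num.truncn x = y.-1 by apply: truncn_def; rewrite prednK // xy andbT /x le_max lexx orbT.
  by rewrite prednK.
have := HK x q b b' x1 q0 qx b0 b'0 gb gb'; rewrite tx !natr_sum.
have cv c : \sum_(1 <= n < y | (n == c %[mod q])%N) (divisor_fun k n)%:R =
   \sum_(1 <= n < y | (n == c %[mod q])%N) (divk k n)%:R :> R.
  rewrite big_nat_cond [RHS]big_nat_cond; apply: eq_bigr => n /andP[/andP[n0 _] _].
  by rewrite divisor_funE.
rewrite !cv => /le_trans; apply; rewrite ler_wpM2l // ler_wpM2r ?invr_ge0 //.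
by apply: le_powR_base; [rewrite subr_ge0; case/andP: d0|exact: ltW|exact: ltW].
Qed.

(** Over the finitely many g <= H, take the least delta and add up the constants. *)
Lemma equidistributed_uniform (k H : nat) (theta beta : R) : 0 < beta < theta ->
  exponent_of_distribution k theta ->
  exists2 delta : R, 0 < delta <= 1 & exists2 K : R, 0 <= K &
    forall g, (0 < g <= H)%N -> equidistributed k beta g delta K.
Proof.
move=> bt E; elim: H => [|H [d1 d10 [K1 K10 IH]]].
  by exists 1; rewrite ?ltr01 ?lexx //; exists 0 => // g /andP[g0]; rewrite leqNgt g0.
have [d2 d20 [K2 K20 HK]] := equidistributed_of_exponent bt (E H.+1 isT).
exists (Num.min d1 d2).
  by case/andP: d10 => a1 a2; case/andP: d20 => b1 b2; rewrite lt_min a1 b1 ge_min a2.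
exists (K1 + K2) => [|g /andP[g0 gH]]; first exact: addr_ge0.
have weak d K : 0 <= K -> Num.min d1 d2 <= d -> K <= K1 + K2 -> equidistributed k beta g d K ->
    equidistributed k beta g (Num.min d1 d2) (K1 + K2).
  move=> K0 dd KK HH y q b b' q0 qy b0 b'0 gb gb'.
  apply: le_trans (HH y q b b' q0 qy b0 b'0 gb gb') _.
  have y0 : (0 < y)%N.
    case: y qy => //; case/andP: bt => be0 _; rewrite powR0 ?gt_eqF // => qy.
    by have := lt_le_trans qy (ler0n R q); rewrite ltxx.
  rewrite ler_pM ?divr_ge0 ?powR_ge0 // ler_wpM2r ?invr_ge0 //.
  by rewrite ler_powR ?ler1n // lerD2l lerN2.
move: gH; rewrite leq_eqVlt => /orP[/eqP gE|gH].
  by apply: (weak d2 K2) => //; rewrite ?ge_min ?lexx ?orbT ?lerDr // gE.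
by apply: (weak d1 K1) => //; rewrite ?ge_min ?lexx ?lerDl //; apply: IH; rewrite g0.
Qed.

(** An upward closed condition is r >= r0 for a threshold r0, with r0 = y when it fails everywhere
    below y. Sums under such a condition are differences of two initial segments, where the
    equidistribution and the sieve apply. *)
Lemma upward_cut (P : pred nat) (y : nat) : (0 < y)%N ->
  (forall r r', (0 < r)%N -> (r <= r')%N -> P r -> P r') ->
  exists r0 : nat, [/\ (0 < r0 <= y)%N, ((r0 < y)%N -> P r0),
    (forall r, (0 < r < r0)%N -> ~~ P r) &
    forall (C : pred nat) (F : nat -> R),
      \sum_(1 <= r < y | C r && P r) F r =
      \sum_(1 <= r < y | C r) F r - \sum_(1 <= r < r0 | C r) F r].
Proof.
move=> y0 Pup.
have exP : exists r : nat, (0 < r)%N && (P r || (r == y)) by exists y; rewrite y0 eqxx orbT.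
case: (ex_minnP exP) => r0 /andP[r00 Pr0] rmin.
have r0y : (r0 <= y)%N by apply: rmin; rewrite y0 eqxx orbT.
have PE r : (0 < r < y)%N -> P r = (r0 <= r)%N.
  move=> /andP[rr ry]; apply/idP/idP => [Pr|r0r].
    by apply: rmin; rewrite rr Pr.
  case/orP: Pr0 => [Pr0|/eqP e]; first exact: Pup r0r Pr0.
  by move: ry; rewrite ltnNge -e r0r.
exists r0; split.
  - by rewrite r00.
  - by case/orP: Pr0 => // /eqP ->; rewrite ltnn.
  - move=> r /andP[rr rr0]; apply/negP => Pr.
    by have := rmin r; rewrite rr Pr leqNgt rr0 => /(_ isT).
move=> C F; rewrite [X in _ = X - _](big_cat_nat r00 r0y) /= addrAC subrr add0r.
rewrite [RHS](big_nat_widenl _ 1) // big_nat_cond [RHS]big_nat_cond; apply: eq_bigl => r.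
by case: (boolP (0 < r < y)%N) => // ry; rewrite /= PE.
Qed.

(** The estimate is used at y and at the threshold r0 of P. The bound on q required at r0 is the one
    that P r0 provides; if r0 = y both sums are empty. *)
Lemma equidistributed_interval k (beta : R) g delta K (P : pred nat) (y q b b' : nat) :
  0 <= beta -> delta <= 1 -> 0 <= K -> equidistributed k beta g delta K ->
  (0 < y)%N -> (0 < q)%N ->
  (forall r r', (0 < r)%N -> (r <= r')%N -> P r -> P r') ->
  (forall r, (0 < r)%N -> P r -> q%:R < r%:R `^ beta) ->
  b <> 0 %[mod q] -> b' <> 0 %[mod q] -> gcdn b q = g -> gcdn b' q = g ->
  `|\sum_(1 <= n < y | (n == b %[mod q])%N && P n) (divk k n)%:R
    - \sum_(1 <= n < y | (n == b' %[mod q])%N && P n) (divk k n)%:R|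
  <= 2 * K * (y%:R `^ (1 - delta) / (totient (q %/ g))%:R).
Proof.
move=> be0 d1 K0 H y0 q0 Pup Pq b0 b'0 gb gb'.
have [r0 [/andP[r00 r0y] Pr0 _ E]] := upward_cut y0 Pup.
rewrite !E.
have T0 : 0 <= (totient (q %/ g))%:R^-1 :> R by rewrite invr_ge0.
move: r0y; rewrite leq_eqVlt => /orP[/eqP ->|r0y].
  by rewrite !subrr normr0 !mulr_ge0 ?powR_ge0.
have q1 := Pq r0 r00 (Pr0 r0y).
have ry : r0%:R <= y%:R :> R by rewrite ler_nat ltnW.
have q2 : q%:R < y%:R `^ beta.
  by apply: lt_le_trans q1 _; apply: le_powR_base.
have h1 := H y q b b' q0 q2 b0 b'0 gb gb'.
have h2 := H r0 q b b' q0 q1 b0 b'0 gb gb'.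
set s1 := \sum_(1 <= n < y | _) _ in h1 *; set s2 := \sum_(1 <= n < y | _) _ in h1 *.
set t1 := \sum_(1 <= n < r0 | _) _ in h2 *; set t2 := \sum_(1 <= n < r0 | _) _ in h2 *.
have -> : s1 - t1 - (s2 - t2) = (s1 - s2) - (t1 - t2) by ring.
apply: le_trans (ler_normB _ _) _.
rewrite -mulrA mulr_natl mulr2n; apply: lerD => //; apply: le_trans h2 _.
by rewrite ler_wpM2l // ler_wpM2r // le_powR_base // subr_ge0.
Qed.

(** After division by d = (s, q), s / d is invertible modulo q / d, with a power as inverse by
    Euler's theorem. The gcd of the reduced class depends on b only through g, so two classes with
    equal gcd remain comparable. *)
Lemma congruence_reduce (s q b : nat) : (0 < s)%N -> (0 < q)%N ->
  let d := gcdn s q in let g := gcdn b q in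
  (forall r, (s * r = b %[mod q]) -> (d %| g)%N) /\
  ((d %| g)%N -> exists c, (forall r, (s * r == b %[mod q])%N = (r == c %[mod q %/ d])%N)
     /\ gcdn c (q %/ d) = (g %/ d)%N).
Proof.
move=> s0 q0 d g.
have d0 : (0 < d)%N by rewrite gcdn_gt0 s0.
have dq : (d %| q)%N by exact: dvdn_gcdr. have ds : (d %| s)%N by exact: dvdn_gcdl.
split.
  move=> r e; rewrite dvdn_gcd dq andbT.
  have : (d %| b %% q)%N.
    by rewrite -e /dvdn modn_dvdm // -/(dvdn _ _) dvdn_mulr.
  by rewrite /dvdn modn_dvdm.
move=> dg; have db : (d %| b)%N by apply: dvdn_trans dg (dvdn_gcdl _ _).
pose s' := (s %/ d)%N; pose q' := (q %/ d)%N; pose b' := (b %/ d)%N.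
have sE : s = (d * s')%N by rewrite mulnC divnK.
have qE : q = (d * q')%N by rewrite mulnC divnK.
have bE : b = (d * b')%N by rewrite mulnC divnK.
have q'0 : (0 < q')%N by rewrite divn_gt0 // dvdn_leq.
have cop : coprime s' q'.
  by rewrite /coprime -(eqn_pmul2l d0) muln_gcdr -sE -qE muln1.
pose u := (s' ^ (totient q').-1)%N.
have us : (u * s' = 1 %[mod q'])%N.
  by rewrite /u -expnSr prednK ?totient_gt0 // Euler_exp_totient.
have copu : coprime u q' by exact: coprimeXl.
exists (b' * u)%N; split.
  have key x y : ((d * x) %% (d * q') == (d * y) %% (d * q'))%N = (x %% q' == y %% q')%N.
    by rewrite -!muln_modr eqn_pmul2l.
  move=> r; have -> : (s * r == b %[mod q])%N = (s' * r == b' %[mod q'])%N.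
    by rewrite -key mulnA -sE -bE -qE.
  apply/eqP/eqP => e.
    have -> : (r = u * s' * r %[mod q'])%N by rewrite -modnMml us modnMml mul1n.
    by rewrite -mulnA -modnMmr e modnMmr mulnC.
  by rewrite -modnMmr e modnMmr mulnCA [(s' * _)%N]mulnC -modnMmr us modnMmr muln1.
rewrite gcdnC Gauss_gcdl; last by rewrite coprime_sym.
rewrite gcdnC; apply/eqP; rewrite -(eqn_pmul2l d0) muln_gcdr -bE -qE -/g mulnC.
by rewrite divnK.
Qed.

End Progressions.

(** * Averaging over residue classes *)

Section Averaging.
Local Open Scope classical_set_scope.
Variable R : realType.
Variables (h k : nat) (A B : R).
Hypotheses (h_gt0 : (0 < h)%N) (A_gt0 : 0 < A) (A_le1 : A <= 1) (B_gt0 : 0 < B).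

(** This is d_(k+1)(m, A): here k is one less than in the theorem. *)
Definition truncated_divisor (m : nat) : R :=
  \sum_(r <- divisors m) (divk k r)%:R * (r%:R <= m%:R `^ A)%R%:R.

(** The condition q <= n^B for m = n + h. If m <= h, the truncated difference gives 0^B = 0, and the
    condition fails for every q > 0. *)
Definition above_cutoff (q m : nat) : bool := q%:R <= (m - h)%N%:R `^ B.

Definition class_sum (X q b : nat) : R :=
  \sum_(1 <= m < X.+1 | (m == b %[mod q])%N && above_cutoff q m) truncated_divisor m.

Definition cofactor_cond (q s r : nat) : bool :=
  above_cutoff q (s * r) && ((s * r)%N%:R `^ A < r%:R).

Lemma above_cutoff_up q m m' : (m <= m')%N -> above_cutoff q m -> above_cutoff q m'.
Proof.
move=> mm /le_trans; apply; apply: le_powR_base; rewrite ?ler_nat ?leq_sub2r //.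
exact: ltW.
Qed.

Lemma above_cutoff_lt q m : (0 < m)%N -> above_cutoff q m -> q%:R < m%:R `^ B.
Proof.
move=> m0 /le_lt_trans; apply; apply: gt0_ltr_powR; rewrite ?nnegrE ?ler0n //.
by rewrite ltr_nat ltn_subrL h_gt0.
Qed.

(** Since A <= 1, the ratio (s r)^A / r does not increase with r. *)
Lemma cofactor_cond_up q s r r' : (0 < s)%N -> (0 < r)%N -> (r <= r')%N -> cofactor_cond q s r -> cofactor_cond q s r'.
Proof.
move=> s0 r0 rr /andP[l1 l2]; apply/andP; split.
  by apply: above_cutoff_up l1; rewrite leq_mul2l rr orbT.
have rR : (0 : R) < r%:R by rewrite ltr0n.
have c1 : 1 <= r'%:R / r%:R :> R by rewrite ler_pdivlMr // mul1r ler_nat.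
have c0 : 0 <= r'%:R / r%:R :> R by exact: le_trans ler01 c1.
have -> : (s * r')%:R = r'%:R / r%:R * (s * r)%N%:R :> R.
  by rewrite !natrM; field; rewrite gt_eqF.
rewrite powRM //; apply: (@le_lt_trans _ _ (r'%:R / r%:R * (s * r)%N%:R `^ A)).
  by apply: ler_wpM2r; [exact: powR_ge0|rewrite -[leRHS]powRr1 // ler_powR].
rewrite -[ltRHS](divfK (_ : r%:R != 0)) ?gt_eqF // ltr_pM2l //.
exact: lt_le_trans ltr01 c1.
Qed.

(** With m = s r one has q < m^B = (m^A)^(B/A), and m^A < r. *)
Lemma cofactor_cond_lt q s r : (0 < s)%N -> (0 < r)%N -> cofactor_cond q s r -> q%:R < r%:R `^ (B / A).
Proof.
move=> s0 r0 /andP[l1 l2].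
have m0 : (0 < s * r)%N by rewrite muln_gt0 s0.
apply: lt_le_trans (above_cutoff_lt m0 l1) _.
have -> : (s * r)%N%:R `^ B = ((s * r)%N%:R `^ A) `^ (B / A) :> R.
  by rewrite -powRrM mulrC divfK // gt_eqF.
apply: le_powR_base; [by rewrite divr_ge0 // ltW|exact: powR_ge0|exact: ltW].
Qed.

Lemma cofactor_cond_small q s r X : (0 < s)%N -> (0 < r)%N -> (s * r <= X)%N -> cofactor_cond q s r ->
  s%:R <= X%:R `^ (1 - A).
Proof.
move=> s0 r0 rX /andP[_ l2].
have mR : (0 : R) < (s * r)%N%:R by rewrite ltr0n muln_gt0 s0.
have sR : (0 : R) < s%:R by rewrite ltr0n.
apply: (@le_trans _ _ ((s * r)%N%:R `^ (1 - A))); last first.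
  by apply: le_powR_base; rewrite ?ler_nat // subr_ge0.
rewrite powRD_gt0 // powRr1 ?(ltW mR) // powRN ler_pdivlMr ?powR_gt0 //.
by rewrite natrM ler_pM2l // -natrM ltW.
Qed.

Lemma truncated_divisor_split m : (0 < m)%N -> truncated_divisor m = (divk k.+1 m)%:R -
  \sum_(s <- divisors m) (divk k (m %/ s))%:R * (m%:R `^ A < (m %/ s)%N%:R)%R%:R.
Proof.
move=> m0; apply/eqP; rewrite eq_sym subr_eq; apply/eqP.
rewrite [X in _ = _ + X](sum_divisors_inv _ m0) divkS natr_sum /truncated_divisor -big_split /=.
apply: eq_big_seq => r; rewrite -dvdn_divisors // => rm; rewrite divn_divnK //.
by case: leP => _; rewrite ?mulr1 ?mulr0 ?addr0 ?add0r.
Qed.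

(* A divisor of m exceeding m^A is traded for its cofactor s. *)
Lemma class_sum_split X q b : class_sum X q b =
  \sum_(1 <= m < X.+1 | (m == b %[mod q])%N && above_cutoff q m) (divk k.+1 m)%:R -
  \sum_(1 <= s < X.+1) \sum_(1 <= r < (X %/ s).+1 | (s * r == b %[mod q])%N && cofactor_cond q s r)
    (divk k r)%:R.
Proof.
pose F m s : R := if (m == b %[mod q])%N && above_cutoff q m then
  (divk k (m %/ s))%:R * (m%:R `^ A < (m %/ s)%N%:R)%R%:R else 0.
have -> : class_sum X q b = \sum_(1 <= m < X.+1 | (m == b %[mod q])%N && above_cutoff q m) (divk k.+1 m)%:R
    - \sum_(1 <= m < X.+1) \sum_(s <- divisors m) F m s.
  rewrite /class_sum [X in X - _]big_mkcond [LHS]big_mkcond -sumrB; apply: eq_big_nat => m /andP[m0 _].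
  rewrite /F; case: ifP => _; last by rewrite big1 // subr0.
  by rewrite truncated_divisor_split.
congr (_ - _); rewrite (sum_divisors_swap (fun s m => F m s)).
apply: eq_big_nat => s /andP[s0 sX].
rewrite (sum_multiples (fun m => F m s)) //.
rewrite [RHS](big_nat_widen _ _ X.+1) ?ltnS ?leq_div //.
rewrite big_mkcond [RHS]big_mkcond /=; apply: eq_big_nat => r /andP[r0 _].
have -> : (s * r < X.+1)%N = (r < (X %/ s).+1)%N by rewrite !ltnS leq_divRL // mulnC.
rewrite /F /cofactor_cond mulKn // andbA.
case: (_ == _ %[mod q])%N => //=; last by rewrite if_same.
case: above_cutoff => //=; last by rewrite if_same.
case: (_ `^ A < _) => /=; rewrite ?mulr1 ?mulr0 ?if_same //.
Qed.

Lemma harmonic_le X : (0 < X)%N -> \sum_(1 <= s < X.+1) s%:R^-1 <= 1 + ln X%:R :> R.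
Proof.
move=> X0; have XM : 0 < (X%:R : R) < (X.+1%:R : R) by apply/andP; split; [rewrite ltr0n|rewrite ltr_nat].
have X1 : (1 : R) <= X%:R by rewrite ler1n.
have /andP[_] := harm_sum 0 XM.
have -> : logpow 1 X%:R = ln X%:R :> R by rewrite logpow_ge1 // expr1 divr1.
have -> : logpow 0 X%:R = 1 :> R by rewrite logpow_ge1 // expr0 divr1.
rewrite addrC; apply: le_trans.
apply: ler_sum_nat => s /andP[s0 sX]; rewrite logpow_ge1 ?expr0 ?fact0 ?divr1 ?div1r //.
by rewrite ler_pdivlMr ?ltr0n // mul1r ler_nat.
Qed.

(** For s <= X^(1-A) the length X / s is at least X^A, so each term saves X^(-A delta) over X / s;
    the sum of 1 / s costs one logarithm. *)
Lemma tail_classes_sum (X : nat) (delta : R) : (0 < X)%N -> 0 < delta <= 1 ->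
  \sum_(1 <= s < X.+1) ((X %/ s).+1)%:R `^ (1 - delta) * (s%:R <= X%:R `^ (1 - A))%R%:R
   <= 2 * X%:R `^ (1 - A * delta) * (1 + ln X%:R).
Proof.
move=> X0 /andP[d0 d1]; have XR : (0 : R) < X%:R by rewrite ltr0n.
apply: (@le_trans _ _ (\sum_(1 <= s < X.+1) (2 * X%:R `^ (1 - A * delta)) * s%:R^-1)); last first.
  rewrite -big_distrr /=; apply: ler_wpM2l; first by rewrite mulr_ge0 ?powR_ge0.
  exact: harmonic_le.
apply: ler_sum_nat => s /andP[s0 sX].
have sR : (0 : R) < s%:R by rewrite ltr0n.
case: (boolP (s%:R <= _)) => sA; last by rewrite mulr0 !mulr_ge0 ?powR_ge0 ?invr_ge0.
rewrite mulr1.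
have y2 : ((X %/ s).+1)%:R <= 2 * (X%:R / s%:R) :> R.
  rewrite mulrA ler_pdivlMr // -!natrM ler_nat mulSn mul2n -addnn.
  by rewrite leq_add // ?leq_divM.
have Xs : 0 < X%:R / s%:R :> R by rewrite divr_gt0.
apply: (@le_trans _ _ ((2 * (X%:R / s%:R)) `^ (1 - delta))).
  by apply: le_powR_base; rewrite ?subr_ge0.
rewrite powRM ?(ltW Xs) // -mulrA ler_pM ?powR_ge0 //.
  rewrite -[leRHS]powRr1 // ler_powR ?ler1n //; lra.
rewrite powRD_gt0 // powRr1 ?(ltW Xs) //.
have -> : 1 - A * delta = 1 + A * (- delta) by ring.
rewrite powRD_gt0 // powRr1 ?(ltW XR) // powRrM.
have XA : X%:R `^ A <= X%:R / s%:R.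
  rewrite ler_pdivlMr // -[leRHS]powRr1 ?(ltW XR) // mulrC -ler_pdivlMr ?powR_gt0 //.
  by rewrite -powRN -powRD_gt0.
have : (X%:R / s%:R) `^ (- delta) <= (X%:R `^ A) `^ (- delta).
  by apply: le_powR_baseN; rewrite ?powR_gt0 // oppr_le0 ltW.
move=> hh; have := ler_wpM2l (ltW Xs) hh; lra.
Qed.

(** In [class_sum_split] the first sum is compared at level B < theta_k; in the second, each s gives
    a comparison modulo q / (s, q) with gcd g / (s, q), at level B / A < theta_(k-1). That q does
    not divide h keeps all these classes nonzero. *)
Lemma progressions_close (theta_k theta_k1 : R) :
  exponent_of_distribution k.+1 theta_k -> exponent_of_distribution k theta_k1 ->
  B < theta_k -> B < A * theta_k1 ->
  exists2 delta : R, 0 < delta & exists2 K : R, 0 <= K &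
    forall X q b, (0 < X)%N -> (0 < q)%N -> ~~ (q %| h)%N -> gcdn b q = gcdn h q ->
    `|class_sum X q h - class_sum X q b| <= K * (X%:R `^ (1 - delta) / (totient (q %/ gcdn h q))%:R).
Proof.
move=> E1 E2 B1 B2.
have b1 : 0 < B < theta_k by rewrite B_gt0.
have b2 : 0 < B / A < theta_k1 by rewrite divr_gt0 //= ltr_pdivrMr // mulrC.
have [d1 d10 [K1 K10 H1]] := equidistributed_uniform h b1 E1.
have [d2 d20 [K2 K20 H2]] := equidistributed_uniform h b2 E2.
have /andP[d1p d1l] := d10; have /andP[d2p d2l] := d20.
have Ad : 0 < A * d2 / 2 by rewrite divr_gt0 // mulr_gt0.
have [C C0 HC] := ln_pow_bound 1 Ad.
(* Half of the saving A d2 is spent on the logarithm of [tail_classes_sum]. *)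
pose dl := Num.min d1 (A * d2 / 2).
have dl0 : 0 < dl by rewrite lt_min d1p.
exists dl => //; exists (4 * K1 + 4 * K2 * C) => [|X q b X0 q0 qh gb].
  by rewrite addr_ge0 ?mulr_ge0 // ltW.
pose g := gcdn h q; have g0 : (0 < g)%N by rewrite gcdn_gt0 h_gt0.
have gcd_moebius_ : (g <= h)%N by rewrite dvdn_leq // dvdn_gcdl.
have gq : (g %| q)%N by exact: dvdn_gcdr.
have gltq : (g < q)%N.
  rewrite ltn_neqAle dvdn_leq // andbT; apply: contra qh => /eqP <-; exact: dvdn_gcdl.
have XR : (1 : R) <= X%:R by rewrite ler1n.
have XR0 : (0 : R) < X%:R by rewrite ltr0n.
(* The class 0 modulo q' has gcd q', so a smaller gcd excludes it. *)
have nz c q' g' : (g' < q')%N -> gcdn c q' = g' -> c <> 0 %[mod q'].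
  move=> gq' gc e; move: gq'; rewrite -gc.
  have -> : gcdn c q' = q' by rewrite -gcdn_modl e mod0n gcd0n.
  by rewrite ltnn.
have hq : h <> 0 %[mod q] by apply: (nz h q g).
have bq : b <> 0 %[mod q] by apply: (nz b q g).
set T : R := (totient (q %/ g))%:R.
have T0 : 0 <= T^-1 by rewrite invr_ge0.
have Xd (u : R) : dl <= u -> X%:R `^ (1 - u) <= X%:R `^ (1 - dl).
  by move=> du; rewrite ler_powR // lerD2l lerN2.
rewrite !class_sum_split.
set S1 := \sum_(1 <= m < X.+1 | _) _; set S1' := \sum_(1 <= m < X.+1 | (m == b %[mod q])%N && _) _.
set S2 := \sum_(1 <= s < X.+1) _; set S2' := \sum_(1 <= s < X.+1) _.
have P1 : `|S1 - S1'| <= 2 * K1 * ((X.+1)%:R `^ (1 - d1) / T).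
  apply: (equidistributed_interval (ltW B_gt0) d1l K10 (H1 g _)) => //.
  - by rewrite g0.
  - by move=> r r' _; exact: above_cutoff_up.
  by move=> r; exact: above_cutoff_lt.
have P2 : `|S2 - S2'| <= 2 * K2 * (2 * X%:R `^ (1 - A * d2) * (1 + ln X%:R)) / T.
  rewrite /S2 /S2' -sumrB; apply: le_trans (ler_norm_sum _ _ _) _.
  apply: (@le_trans _ _ (\sum_(1 <= s < X.+1) 2 * K2 / T *
      (((X %/ s).+1)%:R `^ (1 - d2) * (s%:R <= X%:R `^ (1 - A))%R%:R))); last first.
    rewrite -big_distrr /= [leRHS](_ : _ =
      2 * K2 / T * (2 * X%:R `^ (1 - A * d2) * (1 + ln X%:R))); last by ring.
    apply: ler_wpM2l; first by rewrite !mulr_ge0.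
    exact: tail_classes_sum.
  apply: ler_sum_nat => s /andP[s0 sX].
  have zero c : ~~ (s%:R <= X%:R `^ (1 - A)) ->
     \sum_(1 <= r < (X %/ s).+1 | (s * r == c %[mod q])%N && cofactor_cond q s r) (divk k r)%:R = 0 :> R.
    move=> sA; rewrite big_nat_cond big1 // => r /andP[/andP[r0 rX] /andP[_ P]].
    move: sA; rewrite (cofactor_cond_small s0 r0 _ P) //.
    by move: rX; rewrite ltnS leq_divRL // mulnC.
  case: (boolP (s%:R <= _)) => sA; last by rewrite !zero // subrr normr0 !mulr0.
  rewrite mulr1.
  have [c1 c2] := congruence_reduce h s0 q0; have [c1' c2'] := congruence_reduce b s0 q0.
  rewrite gb in c1' c2'; rewrite -/g in c1 c2 c1' c2'.
  case: (boolP (gcdn s q %| g)%N) => dg; last first.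
    rewrite !big_pred0 ?subrr ?normr0 ?mulr_ge0 ?powR_ge0 // => r.
      by case: eqP => //= e; case/negP: dg; exact: c1' e.
    by case: eqP => //= e; case/negP: dg; exact: c1 e.
  have [u [uE gu]] := c2 dg; have [u' [uE' gu']] := c2' dg.
  have d0 : (0 < gcdn s q)%N by rewrite gcdn_gt0 s0.
  rewrite (eq_bigl (fun r => (r == u %[mod q %/ gcdn s q])%N && cofactor_cond q s r)); last by move=> r; rewrite uE.
  rewrite [X in _ - X](eq_bigl (fun r => (r == u' %[mod q %/ gcdn s q])%N && cofactor_cond q s r)); last by move=> r; rewrite uE'.
  have q'0 : (0 < q %/ gcdn s q)%N by rewrite divn_gt0 // dvdn_leq // dvdn_gcdr.
  have g'0 : (0 < g %/ gcdn s q)%N by rewrite divn_gt0 // dvdn_leq.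
  have g'q' : (g %/ gcdn s q < q %/ gcdn s q)%N by rewrite ltn_divRL ?dvdn_gcdr // divnK.
  (* The reduction does not change the quotient q / g, so all s share the same totient. *)
  have TE : T = (totient (q %/ gcdn s q %/ (g %/ gcdn s q)))%:R.
    rewrite /T; congr (totient _)%:R; rewrite -{1}(divnK dg) -{1}(divnK (dvdn_gcdr s q)).
    by rewrite divnMr.
  rewrite [leRHS](_ : _ = 2 * K2 * (((X %/ s).+1)%:R `^ (1 - d2) / T)); last by ring.
  rewrite TE; apply: (equidistributed_interval _ d2l K20 (H2 _ _)) => //.
  - by rewrite divr_ge0 ?ltW.
  - by rewrite g'0 (leq_trans (leq_div _ _)).
  - by move=> r r'; exact: cofactor_cond_up.
  - move=> r r0 P; apply: le_lt_trans (cofactor_cond_lt s0 r0 P).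
    by rewrite ler_nat leq_div.
  - exact: (nz u _ _ g'q').
  exact: (nz u' _ _ g'q').
have -> : S1 - S2 - (S1' - S2') = (S1 - S1') - (S2 - S2') by ring.
apply: le_trans (ler_normB _ _) _; apply: le_trans (lerD P1 P2) _.
have Q1 : (X.+1)%:R `^ (1 - d1) <= 2 * X%:R `^ (1 - dl).
  apply: (@le_trans _ _ ((2 * X%:R) `^ (1 - d1))).
    by apply: le_powR_base; rewrite ?subr_ge0 // -natrM ler_nat mul2n -addnn -addn1 leq_add2l.
  rewrite powRM //; apply: ler_pM; rewrite ?powR_ge0 //.
    by rewrite -[leRHS]powRr1 // ler_powR ?ler1n // gerBl ltW.
  by apply: Xd; rewrite /dl ge_min lexx.
have Q2 : X%:R `^ (1 - A * d2) * (1 + ln X%:R) <= C * X%:R `^ (1 - dl).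
  have := HC X%:R XR; rewrite expr1 => h1.
  apply: le_trans (ler_wpM2l (powR_ge0 _ _) h1) _.
  rewrite mulrCA ler_pM2l // -powRD_gt0 //.
  have -> : 1 - A * d2 + A * d2 / 2 = 1 - A * d2 / 2 by lra.
  by apply: Xd; rewrite /dl ge_min lexx orbT.
rewrite -/T [leRHS]mulrDl; apply: lerD.
  rewrite [leRHS](_ : _ = 2 * K1 * (2 * X%:R `^ (1 - dl) / T)); last by ring.
  by apply: ler_wpM2l; [exact: mulr_ge0|exact: ler_wpM2r].
rewrite [leLHS](_ : _ = 4 * K2 / T * (X%:R `^ (1 - A * d2) * (1 + ln X%:R))); last by ring.
rewrite [leRHS](_ : _ = 4 * K2 / T * (C * X%:R `^ (1 - dl))); last by ring.
by rewrite ler_wpM2l // !mulr_ge0.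
Qed.

Definition gcd_sum (X q : nat) : R :=
  \sum_(1 <= m < X.+1 | (gcdn m q == gcdn h q) && above_cutoff q m) truncated_divisor m.

Lemma count_gcd q g : (0 < q)%N -> (g %| q)%N ->
  (\sum_(0 <= b < q | gcdn b q == g) 1 = totient (q %/ g))%N.
Proof.
move=> q0 gq; have g0 := dvdn_gt0 q0 gq.
have n0 : (0 < q %/ g)%N by rewrite divn_gt0 // dvdn_leq.
rewrite totient_count_coprime.
have -> : (\sum_(0 <= d < q %/ g) coprime (q %/ g) d = \sum_(0 <= d < q %/ g | coprime (q %/ g) d) 1)%N.
  by rewrite [RHS]big_mkcond; apply: eq_bigr => d _; case: coprime.
rewrite -big_filter -[RHS]big_filter !sum1_size -(size_map (muln g) [seq d <- index_iota 0 (q %/ g) | coprime (q %/ g) d]).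
apply: perm_size; apply: uniq_perm.
- exact/filter_uniq/iota_uniq.
- rewrite map_inj_uniq; first exact/filter_uniq/iota_uniq.
  by move=> a b /eqP; rewrite eqn_pmul2l // => /eqP.
have qE : q = (g * (q %/ g))%N by rewrite mulnC divnK.
move=> b; rewrite mem_filter mem_index_iota /=; apply/andP/mapP.
  move=> [/eqP gb bq]; have gdb : (g %| b)%N by rewrite -gb dvdn_gcdl.
  exists (b %/ g)%N; last by rewrite mulnC divnK.
  rewrite mem_filter mem_index_iota /= ltn_divLR // [(_ * g)%N]divnK // bq andbT.
  rewrite /coprime -(eqn_pmul2l g0) muln_gcdr -qE [(g * (b %/ g))%N]mulnC divnK // gcdnC gb.
  by rewrite muln1.
case=> d; rewrite mem_filter mem_index_iota /= => /andP[cop dq] ->; split.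
  by rewrite {1}qE -muln_gcdr gcdnC (eqP cop) muln1.
by rewrite {1}qE ltn_pmul2l.
Qed.

Lemma gcd_sum_classes X q : (0 < q)%N ->
  gcd_sum X q = \sum_(0 <= b < q | gcdn b q == gcdn h q) class_sum X q b.
Proof.
move=> q0; rewrite /class_sum [RHS](eq_bigr (fun b => \sum_(1 <= m < X.+1)
   if (m == b %[mod q])%N && above_cutoff q m then truncated_divisor m else 0)); last first.
  by move=> b _; rewrite big_mkcond.
rewrite exchange_big_nat /= /gcd_sum big_mkcond /=; apply: eq_big_nat => m _.
rewrite big_mkcond (bigD1_seq (m %% q)%N) ?iota_uniq ?mem_index_iota ?ltn_mod //=.
rewrite gcdn_modl modn_mod eqxx /= big_nat_cond big1 ?addr0; last first.
  move=> b /andP[/andP[_ bq] bm]; rewrite (modn_small bq).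
  by rewrite [_ == b]eq_sym (negbTE bm) /= if_same.
by case: (gcdn m q == _).
Qed.

(** The comparison is averaged over the phi(q / g) classes with gcd g = (h, q). If q | h there is
    only the class 0, and the two sides coincide. *)
Lemma average_close (theta_k theta_k1 : R) :
  exponent_of_distribution k.+1 theta_k -> exponent_of_distribution k theta_k1 ->
  B < theta_k -> B < A * theta_k1 ->
  exists2 delta : R, 0 < delta & exists2 K : R, 0 <= K &
    forall X q, (0 < X)%N -> (0 < q)%N ->
    `|class_sum X q h - gcd_sum X q / (totient (q %/ gcdn h q))%:R| <=
      K * (X%:R `^ (1 - delta) / (totient (q %/ gcdn h q))%:R).
Proof.
move=> E1 E2 B1 B2; have [d d0 [K K0 H]] := progressions_close E1 E2 B1 B2.
exists d => //; exists K => // X q X0 q0.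
have gq : (gcdn h q %| q)%N by exact: dvdn_gcdr.
have n0 : (0 < q %/ gcdn h q)%N by rewrite divn_gt0 ?gcdn_gt0 ?h_gt0 // dvdn_leq.
have T0 : (0 : R) < (totient (q %/ gcdn h q))%:R by rewrite ltr0n totient_gt0.
case: (boolP (q %| h)%N) => qh.
  have gE : gcdn h q = q by apply/gcdn_idPr.
  have -> : class_sum X q h = gcd_sum X q.
    apply: eq_bigl => m; congr (_ && _); rewrite gE.
    move: qh; rewrite /dvdn => /eqP ->; apply/eqP/eqP => [e|/gcdn_idPr].
      by apply/gcdn_idPr; rewrite /dvdn e.
    by rewrite /dvdn => /eqP.
  rewrite gE divnn q0 (_ : totient 1 = 1%N) // !divr1 subrr normr0.
  by rewrite mulr_ge0 ?powR_ge0.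
set T := (totient _)%:R in T0 *.
rewrite -(ler_pM2l T0) -[X in X * `|_|](ger0_norm (ltW T0)) -normrM mulrBr.
rewrite [T * (gcd_sum X q / T)]mulrC divfK ?gt_eqF // gcd_sum_classes //.
have cst (c : R) : \sum_(0 <= b < q | gcdn b q == gcdn h q) c = T * c.
  rewrite /T -(count_gcd q0 gq) natr_sum big_distrl /=.
  by apply: eq_bigr => b _; rewrite mul1r.
rewrite -[T * class_sum X q h]cst.
rewrite -sumrB; apply: le_trans (ler_norm_sum _ _ _) _.
apply: (@le_trans _ _ (\sum_(0 <= b < q | gcdn b q == gcdn h q) K * (X%:R `^ (1 - d) / T))).
  by apply: ler_sum => b /eqP gb; exact: H.
by rewrite cst.
Qed.

End Averaging.

(** * Counting with a coprimality condition *)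

Section Sieve.
Local Open Scope classical_set_scope.
Variable R : realType.

(** The function sigma_(-1/2), which collects the rounding errors (y / e)^(1/2) over e | n. *)
Definition half_sigma (n : nat) : R := divsum (fun e => e%:R `^ (- 2^-1)) n.

Lemma sum1_multiples d n : (0 < d)%N -> \sum_(1 <= t < n.+1 | (d %| t)%N) 1 = (n %/ d)%N%:R :> R.
Proof.
move=> d0; rewrite sum_multiples //.
rewrite (eq_bigl (fun e => (e < (n %/ d).+1)%N)); last first.
  by move=> e; rewrite !ltnS leq_divRL // mulnC.
have E := big_nat_widen 1 (n %/ d).+1 n.+1 predT (fun=> 1 : R) (_ : ((n %/ d).+1 <= n.+1)%N).
by rewrite -E ?ltnS ?leq_div // sumr_const_nat subn1.
Qed.

(** The fractional part of u is at most min(u, 1), hence at most u^(1/2). *)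
Lemma floor_div (y m : nat) : (0 < m)%N ->
  `|(y %/ m)%N%:R - y%:R / m%:R| <= (y%:R / m%:R) `^ 2^-1 :> R.
Proof.
move=> m0; have mR : (0 : R) < m%:R by rewrite ltr0n.
set u := y%:R / m%:R; have u0 : 0 <= u by rewrite divr_ge0.
have fu : (y %/ m)%N%:R <= u by rewrite ler_pdivlMr // -natrM ler_nat leq_divM.
have uf : u < (y %/ m)%N%:R + 1.
  by rewrite natr1 ltr_pdivrMr // -natrM ltr_nat -ltn_divLR.
have f0 : 0 <= (y %/ m)%N%:R :> R by [].
rewrite distrC ger0_norm ?subr_ge0 //.
have [u1|u1] := lerP u 1.
  apply: (@le_trans _ _ u); first by rewrite gerBl.
  have [->|un] := eqVneq u 0; first exact: powR_ge0.
  by rewrite -{1}(powRr1 u0) ger_powR // ?u1 ?lt_neqAle ?u0 ?andbT ?[0 == u]eq_sym ?un // invf_le1 ?ler1n.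
apply: (@le_trans _ _ 1); first by lra.
by rewrite -[leLHS](powRr0 u) ler_powR // ltW.
Qed.

(** Legendre's sieve with mu = g_1. The nested floors merge into the floor of y / (L d), so L also
    enters the error. *)
Lemma coprime_count (y L n : nat) : (0 < L)%N -> (0 < n)%N ->
  `|\sum_(1 <= t < (y %/ L).+1 | coprime t n) 1 - y%:R / L%:R * ((totient n)%:R / n%:R)|
  <= (y%:R / L%:R) `^ 2^-1 * half_sigma n :> R.
Proof.
move=> L0 n0; have LR : (0 : R) < L%:R by rewrite ltr0n.
have -> : \sum_(1 <= t < (y %/ L).+1 | coprime t n) 1 =
    divsum (fun d => gcd_moebius R 1 d * (y %/ (L * d))%N%:R) n :> R.
  rewrite big_mkcond /=.
  rewrite (eq_big_nat _ _ (F2 := fun t => \sum_(d <- divisors n) gcd_moebius R 1 d * (d %| t)%N%:R)); last first.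
    move=> t /andP[t0 _]; have g0 : (0 < gcdn n t)%N by rewrite gcdn_gt0 n0.
    have := divsum_gcd_moebius R (isT : 0 < 1)%N g0.
    have gn : (0 < gcdn n t < n.+1)%N by rewrite g0 ltnS dvdn_leq // dvdn_gcdl.
    rewrite (divsum_bool _ gn) -/(divsum (fun d => gcd_moebius R 1 d * (d %| t)%N%:R) n).
    rewrite (@divsum_bool _ _ n n.+1) ?n0 ?leqnn // => e.
    have -> : (if coprime t n then 1 else 0) = (gcdn n t)%:R * (gcdn n t %| 1)%N%:R :> R.
      rewrite dvdn1 gcdnC /coprime; case: eqP => [->|_]; by rewrite ?mulr1 ?mulr0.
    rewrite -e; apply: eq_bigr => d _; rewrite dvdn_gcd -mulnb natrM; ring.
  rewrite exchange_big /=; rewrite /divsum big_seq [RHS]big_seq; apply: eq_bigr => d.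
  rewrite -dvdn_divisors // => dn; have d0 := dvdn_gt0 n0 dn.
  rewrite -big_distrr /= divnMA -sum1_multiples // [in RHS]big_mkcond /=; congr (_ * _).
  by apply: eq_bigr => t _; case: (d %| t)%N.
rewrite -divsum_gh1 // /divsum big_distrr -sumrB /=.
apply: le_trans (ler_norm_sum _ _ _) _.
rewrite /half_sigma /divsum big_distrr /= big_seq [leRHS]big_seq; apply: ler_sum => d.
rewrite -dvdn_divisors // => dn; have d0 := dvdn_gt0 n0 dn.
have dR : (0 : R) < d%:R by rewrite ltr0n.
have -> : gcd_moebius R 1 d * (y %/ (L * d))%N%:R - y%:R / L%:R * (gcd_moebius R 1 d / d%:R) =
   gcd_moebius R 1 d * ((y %/ (L * d))%N%:R - y%:R / (L * d)%N%:R).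
  by rewrite natrM; field; rewrite !gt_eqF.
rewrite normrM; apply: (@le_trans _ _ (1 * (y%:R / (L * d)%N%:R) `^ 2^-1)).
  apply: ler_pM => //; first exact: gcd_moebius_le.
  by apply: floor_div; rewrite muln_gt0 L0.
rewrite mul1r natrM invfM mulrA powRM ?divr_ge0 ?invr_ge0 //.
by rewrite -[d%:R^-1]powR_inv1 // -powRrM mulN1r.
Qed.

Lemma gcdn_lcml a b c : gcdn (lcmn a b) c = lcmn (gcdn a c) (gcdn b c).
Proof. exact: (@meetUl _ (natdvd : distrLatticeType _) a b c). Qed.

(** If r | m and (m, q) = g, then m = L t, and (m / g, q / g) = 1 splits into a condition on L / g
    and one on t. The former amounts to (q, r) | h; when it holds, the density (1 / L) phi(q/g) /
    (q/g) equals phi(q/g) / [q, r]. *)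
Lemma sieve_arith (h q r : nat) : (0 < h)%N -> (0 < q)%N -> (0 < r)%N ->
  let g := gcdn h q in let L := lcmn r g in
  coprime (L %/ g) (q %/ g) = (gcdn q r %| h)%N /\
  (coprime (L %/ g) (q %/ g) -> (L * (q %/ g) = lcmn q r)%N).
Proof.
move=> h0 q0 r0 g L.
have g0 : (0 < g)%N by rewrite gcdn_gt0 h0.
have gL : (g %| L)%N by exact: dvdn_lcmr.
have gq : (g %| q)%N by exact: dvdn_gcdr.
have copE : coprime (L %/ g) (q %/ g) = (gcdn L q == g).
  by rewrite /coprime -(eqn_pmul2l g0) muln_gcdr muln1 ![(g * _)%N]mulnC !divnK.
have gqE : gcdn g q = g by apply/gcdn_idPl.
split.
  rewrite copE; apply/eqP/idP => [e|qrh].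
    apply: (@dvdn_trans g); last exact: dvdn_gcdl.
    by rewrite -e dvdn_gcd dvdn_gcdl andbT (dvdn_trans (dvdn_gcdr _ _)) // dvdn_lcml.
  rewrite /L gcdn_lcml gqE; apply/lcmn_idPr.
  by rewrite dvdn_gcd gcdnC qrh dvdn_gcdl.
rewrite copE => /eqP e; apply/eqP; rewrite -(eqn_pmul2r g0) -mulnA divnK //.
rewrite -{1}e; have -> : lcmn q r = lcmn L q.
  rewrite /L -lcmnA (_ : lcmn g q = q); first by rewrite lcmnC.
  exact/lcmn_idPr.
by rewrite muln_lcm_gcd.
Qed.

(** This is 1 / [q, r] if (q, r) | h, and 0 otherwise. *)
Definition pair_density (h q r : nat) : R := (gcdn q r)%:R * (gcdn q r %| h)%N%:R / (q%:R * r%:R).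

Lemma pair_density_ge0 h q r : 0 <= pair_density h q r.
Proof. by rewrite divr_ge0 ?mulr_ge0. Qed.

Lemma pair_density_le h q r : (0 < h)%N -> pair_density h q r <= h%:R / (q%:R * r%:R).
Proof.
move=> h0; rewrite /pair_density ler_wpM2r ?invr_ge0 ?mulr_ge0 //.
case: (boolP (gcdn q r %| h)%N) => d; last by rewrite mulr0.
by rewrite mulr1 ler_nat dvdn_leq.
Qed.

Lemma sieve_count (h q r y : nat) : (0 < h)%N -> (0 < q)%N -> (0 < r)%N ->
  `|\sum_(1 <= m < y.+1 | (r %| m)%N && (gcdn m q == gcdn h q)) 1
    - y%:R * (totient (q %/ gcdn h q))%:R * pair_density h q r|
  <= (y%:R / r%:R) `^ 2^-1 * half_sigma (q %/ gcdn h q) :> R.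
Proof.
move=> h0 q0 r0; have [copE LE] := sieve_arith h0 q0 r0.
set g := gcdn h q in copE LE *; set L := lcmn r g in copE LE *.
have g0 : (0 < g)%N by rewrite gcdn_gt0 h0.
have gq : (g %| q)%N by exact: dvdn_gcdr.
have L0 : (0 < L)%N by rewrite lcmn_gt0 r0.
have gL : (g %| L)%N by exact: dvdn_lcmr.
have n0 : (0 < q %/ g)%N by rewrite divn_gt0 // dvdn_leq.
have LR : (0 : R) < L%:R by rewrite ltr0n.
have rR : (0 : R) < r%:R by rewrite ltr0n.
have sig0 : 0 <= half_sigma (q %/ g) by apply: divsum_ge0 => d; exact: powR_ge0.
have -> : \sum_(1 <= m < y.+1 | (r %| m)%N && (gcdn m q == g)) 1 =
   \sum_(1 <= m < y.+1 | (L %| m)%N) (if gcdn m q == g then 1 else 0) :> R.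
  rewrite -big_mkcondr; apply: eq_bigl => m; rewrite dvdn_lcm -andbA; congr (_ && _).
  by case: eqP => e; rewrite ?andbF // andbT -e dvdn_gcdl.
have gcdE t : (gcdn (L * t) q == g) = coprime (L %/ g) (q %/ g) && coprime t (q %/ g).
  rewrite -coprimeMl /coprime -[in RHS](eqn_pmul2l g0) muln_gcdr muln1 mulnA.
  by rewrite ![(g * _)%N]mulnC !divnK.
rewrite sum_multiples //.
rewrite (eq_bigl (fun t => (t < (y %/ L).+1)%N)); last first.
  by move=> e; rewrite !ltnS leq_divRL // mulnC.
have E := big_nat_widen 1 (y %/ L).+1 y.+1 predT
  (fun t => if gcdn (L * t) q == g then 1 else 0 : R) (_ : ((y %/ L).+1 <= y.+1)%N).
rewrite -E ?ltnS ?leq_div // -big_mkcond /=.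
rewrite (eq_bigl _ _ gcdE).
rewrite /pair_density -copE; case: (boolP (coprime (L %/ g) (q %/ g))) => cop; last first.
  by rewrite big_pred0 // mulr0 mul0r mulr0 subrr normr0 mulr_ge0 ?powR_ge0.
have lq : (L * (q %/ g))%N%:R * (gcdn q r)%:R = q%:R * r%:R :> R.
  by rewrite LE // -!natrM muln_lcm_gcd.
have gR : ((gcdn q r)%:R : R) != 0 by rewrite pnatr_eq0 -lt0n gcdn_gt0 q0.
have nR : ((q %/ g)%N%:R : R) != 0 by rewrite pnatr_eq0 -lt0n.
have -> : y%:R * (totient (q %/ g))%:R * ((gcdn q r)%:R * true%:R / (q%:R * r%:R)) =
   y%:R / L%:R * ((totient (q %/ g))%:R / (q %/ g)%N%:R) :> R.
  by rewrite (_ : true%:R = 1 :> R) // -lq natrM; field; rewrite gR nR gt_eqF.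
apply: le_trans (coprime_count y L0 n0) _.
apply: ler_wpM2r => //; apply: le_powR_base; rewrite ?divr_ge0 ?invr_ge0 //.
by rewrite ler_wpM2l // lef_pV2 ?posrE // ler_nat dvdn_leq // dvdn_lcml.
Qed.

Lemma divsum_dvd (f : nat -> R) m n : (0 < n)%N -> (m %| n)%N -> (forall d, 0 <= f d) ->
  divsum f m <= divsum f n.
Proof.
move=> n0 mn f0; have m0 := dvdn_gt0 n0 mn.
have mn1 : (0 < m < n.+1)%N by rewrite m0 ltnS dvdn_leq.
rewrite (divsum_bool _ mn1) (@divsum_bool _ _ n n.+1) ?n0 ?leqnn //.
apply: ler_sum => d _; case: (boolP (d %| m)%N) => dm; last by rewrite mulr0 mulr_ge0.
by rewrite (dvdn_trans dm mn).
Qed.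

Lemma half_sigma_ge1 n : (0 < n)%N -> 1 <= half_sigma n.
Proof.
move=> n0; have := @divsum_dvd (fun e => e%:R `^ (- 2^-1)) 1 n n0 (dvd1n _) (fun d => powR_ge0 _ _).
by rewrite {1}/divsum (_ : divisors 1 = [:: 1%N]) // big_seq1 powR1.
Qed.

(** Passing from q / g to q costs g <= h, and [tau_series] majorises n / phi(n). *)
Lemma sieve_weight_le (h q : nat) : (0 < h)%N -> (0 < q)%N ->
  half_sigma (q %/ gcdn h q) / (totient (q %/ gcdn h q))%:R <= h%:R / q%:R * sieve_weight R q.
Proof.
move=> h0 q0; set g := gcdn h q.
have g0 : (0 < g)%N by rewrite gcdn_gt0 h0.
have gq : (g %| q)%N by exact: dvdn_gcdr.
have n0 : (0 < q %/ g)%N by rewrite divn_gt0 // dvdn_leq.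
have qR : (0 : R) < q%:R by rewrite ltr0n.
have nR : (0 : R) < (q %/ g)%N%:R by rewrite ltr0n.
have tR : (0 : R) < (totient (q %/ g))%:R by rewrite ltr0n totient_gt0.
have nq : (q %/ g %| q)%N by exact: dvdn_divn.
have h1 : half_sigma (q %/ g) <= half_sigma q by apply: divsum_dvd => // d; exact: powR_ge0.
have h2 : (totient (q %/ g))%:R^-1 <= h%:R / q%:R * tau_series R q.
  have t1 := le_totient R n0.
  have t2 : tau_series R (q %/ g) <= tau_series R q by apply: divsum_dvd => // d; rewrite divr_ge0.
  have t0 : 0 <= tau_series R q by apply: divsum_ge0 => d; rewrite divr_ge0.
  have -> : (totient (q %/ g))%:R^-1 = (q %/ g)%N%:R^-1 * ((q %/ g)%N%:R / (totient (q %/ g))%:R) :> R.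
    by rewrite mulrA mulVf ?mul1r // gt_eqF.
  apply: ler_pM; rewrite ?invr_ge0 ?divr_ge0 //; last exact: le_trans t1 t2.
  rewrite ler_pdivlMr // mulrC ler_pdivrMr // -natrM ler_nat.
  rewrite -{1}(divnK gq) [(h * _)%N]mulnC leq_mul2l dvdn_leq ?orbT //; exact: dvdn_gcdl.
have s0 : 0 <= half_sigma (q %/ g) by apply: divsum_ge0 => d; exact: powR_ge0.
rewrite /sieve_weight -/(half_sigma q) mulrCA.
by apply: ler_pM => //; rewrite invr_ge0.
Qed.

End Sieve.

(** * Sieve counts under the moving cut-offs *)

Section Sieve.
Local Open Scope classical_set_scope.
Variable R : realType.

Section Truncated.
Variables (h k : nat) (A B : R).
Hypotheses (h_gt0 : (0 < h)%N) (A_gt0 : 0 < A) (A_le1 : A <= 1) (B_gt0 : 0 < B) (B_le1 : B <= 1).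

(** The ratio u / X is at most (q / X^c)^(1/c), and 1 / c >= 1/2 while the base is at most 1. *)
Lemma le_sqrt_cut (X c : R) (u q : nat) : 0 < X -> 0 < c <= 1 -> q%:R <= X `^ c -> u%:R `^ c <= q%:R ->
  u%:R <= X * sqrt_cut (q%:R / X `^ c).
Proof.
move=> X0 /andP[c0 c1] qX uq.
have Xc : 0 < X `^ c by rewrite powR_gt0.
have ci : 1 <= c^-1 by rewrite invf_ge1.
rewrite /sqrt_cut ler_pdivrMr // mul1r qX.
have uE : u%:R = (u%:R `^ c) `^ c^-1 :> R by rewrite -powRrM divff ?powRr1 // gt_eqF.
have XE : X = (X `^ c) `^ c^-1 by rewrite -powRrM divff ?powRr1 ?ltW // gt_eqF.
apply: (@le_trans _ _ (X * (q%:R / X `^ c) `^ c^-1)).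
  rewrite {1}XE -powRM ?divr_ge0 ?(ltW X0) ?(ltW Xc) //.
  rewrite mulrC divfK ?gt_eqF // {1}uE; apply: le_powR_base => //.
  by rewrite invr_ge0 ltW.
apply: ler_wpM2l; first exact: ltW.
have t0 : 0 <= q%:R / X `^ c by rewrite divr_ge0 // ltW.
have t1 : q%:R / X `^ c <= 1 by rewrite ler_pdivrMr // mul1r.
have [->|tn] := eqVneq (q%:R / X `^ c) 0.
  by rewrite !powR0 // ?gt_eqF // invr_gt0.
have h2 : 2^-1 <= 1 :> R by rewrite invf_le1 ?ler1n.
apply: ger_powR; last exact: le_trans h2 ci.
by rewrite t1 andbT lt_neqAle t0 andbT eq_sym tn.
Qed.

Definition trunc_ind (X q r : nat) : R :=
  (q%:R <= X%:R `^ B)%R%:R * (r%:R <= X%:R `^ A)%R%:R.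

Lemma le_add_cases (a b c v w : R) : 0 <= a -> 0 <= b -> 0 <= c ->
  v = 0 \/ (w <= a /\ v <= c + w) \/ v <= b -> v <= c + a + b.
Proof. by move=> a0 b0 c0 [->|[[h1 h2]|h1]]; lra. Qed.

(** Both cut-offs are upward closed in m, so they remove only a segment m <= u. If u > 0, one of
    them fails at u, that is (u - h)^B < q or u^A < r, and [le_sqrt_cut] bounds u. The sieve is
    applied at X and at u, whence the factor 2. *)
Lemma truncated_count (X q r : nat) : (0 < X)%N -> (0 < q)%N -> (0 < r)%N ->
  `|\sum_(1 <= m < X.+1 | ((r %| m)%N && (gcdn m q == gcdn h q)) &&
       (above_cutoff h B q m && (r%:R <= m%:R `^ A))) 1
    - X%:R * (totient (q %/ gcdn h q))%:R * pair_density R h q r * trunc_ind X q r|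
  <= ((h%:R + X%:R * sqrt_cut (q%:R / X%:R `^ B) + X%:R * sqrt_cut (r%:R / X%:R `^ A))
        * ((totient (q %/ gcdn h q))%:R * pair_density R h q r)
      + 2 * ((X%:R / r%:R) `^ 2^-1 * half_sigma R (q %/ gcdn h q))) * trunc_ind X q r :> R.
Proof.
move=> X0 q0 r0; have XR : (0 : R) < X%:R by rewrite ltr0n.
have Bmon m n : (m <= n)%N -> m%:R `^ B <= n%:R `^ B :> R.
  by move=> mn; apply: le_powR_base; rewrite ?ler_nat // ltW.
have Amon m n : (m <= n)%N -> m%:R `^ A <= n%:R `^ A :> R.
  by move=> mn; apply: le_powR_base; rewrite ?ler_nat // ltW.
pose P m := above_cutoff h B q m && (r%:R <= m%:R `^ A).
have indE : trunc_ind X q r = ((q%:R <= X%:R `^ B) && (r%:R <= X%:R `^ A))%R%:R.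
  by rewrite /trunc_ind -mulnb natrM.
rewrite indE; case: (boolP (_ && _)) => ind; last first.
  rewrite !mulr0 subr0 big_nat_cond big1 ?normr0 // => m.
  move=> /andP[/andP[m0 mX] /andP[_ /andP[l1 l2]]]; case/negP: ind; apply/andP; split.
    by apply: le_trans l1 _; apply: Bmon; rewrite (leq_trans (leq_subr _ _)) // -ltnS.
  by apply: le_trans l2 _; exact: Amon.
rewrite !mulr1; have /andP[qX rX] := ind.
have Pup m m' : (0 < m)%N -> (m <= m')%N -> P m -> P m'.
  move=> _ mm /andP[l1 l2]; apply/andP; split; first exact: (above_cutoff_up B_gt0 mm l1).
  by apply: le_trans l2 _; exact: Amon.
have [m0 [/andP[m00 m0y] _ nP E]] := @upward_cut R P X.+1 isT Pup.
rewrite (E (fun m => (r %| m)%N && (gcdn m q == gcdn h q))) {E}.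
set u := m0.-1; have m0E : m0 = u.+1 by rewrite /u prednK.
have uX : (u <= X)%N by rewrite -ltnS -m0E.
have c1 := sieve_count R X h_gt0 q0 r0; have c2 := sieve_count R u h_gt0 q0 r0.
rewrite m0E; set N1 := \sum_(1 <= m < X.+1 | _) 1 in c1 *; set N2 := \sum_(1 <= m < u.+1 | _) 1 in c2 *.
set T := (totient _)%:R in c1 c2 *; set w := pair_density R h q r in c1 c2 *.
set sg := half_sigma R (q %/ gcdn h q) in c1 c2 *.
have sg0 : 0 <= sg by apply: divsum_ge0 => d; exact: powR_ge0.
have Tw0 : 0 <= T * w by rewrite mulr_ge0 ?pair_density_ge0.
have -> : N1 - N2 - X%:R * T * w = (N1 - X%:R * T * w) - (N2 - u%:R * T * w) - u%:R * (T * w) by ring.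
apply: le_trans (ler_normB _ _) _; rewrite addrC; apply: lerD.
  have ha : 0 <= X%:R * sqrt_cut (q%:R / X%:R `^ B).
    by apply: mulr_ge0; [exact: ler0n|exact: sqrt_cut_ge0].
  have hb : 0 <= X%:R * sqrt_cut (r%:R / X%:R `^ A).
    by apply: mulr_ge0; [exact: ler0n|exact: sqrt_cut_ge0].
  have na : ~~ above_cutoff h B q u -> (u - h)%N%:R <= X%:R * sqrt_cut (q%:R / X%:R `^ B).
    move=> nl; apply: le_sqrt_cut; [exact: XR|by rewrite B_gt0|exact: qX|].
    by apply: ltW; rewrite ltNge; exact: nl.
  have nb : ~~ (r%:R <= u%:R `^ A) -> u%:R <= X%:R * sqrt_cut (r%:R / X%:R `^ A).
    move=> nl; apply: le_sqrt_cut; [exact: XR|by rewrite A_gt0|exact: rX|].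
    by apply: ltW; rewrite ltNge; exact: nl.
  have h0 : 0 <= h%:R :> R by exact: ler0n.
  have uh : u%:R <= h%:R + (u - h)%N%:R :> R by rewrite -natrD ler_nat -leq_subLR.
  have uP : (0 < u)%N -> ~~ above_cutoff h B q u \/ ~~ (r%:R <= u%:R `^ A).
    move=> u0; have : ~~ P u by apply: nP; rewrite u0 m0E ltnSn.
    by rewrite negb_and => /orP.
  rewrite ger0_norm; last by apply: mulr_ge0; [exact: ler0n|exact: Tw0].
  apply: ler_wpM2r; first exact: Tw0.
  apply: (le_add_cases (w := (u - h)%N%:R) ha hb h0).
  have [u0|u0] := posnP u; first by left; rewrite u0.
  by right; have [/na ua|/nb ub] := uP u0; [left; split|right].
apply: le_trans (ler_normB _ _) _.
have d2 (c : R) : 2 * c = c + c by ring.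
rewrite d2; apply: lerD; first exact: c1.
apply: le_trans c2 _; apply: ler_wpM2r; first exact: sg0.
apply: le_powR_base; [by rewrite invr_ge0|exact: divr_ge0|].
by rewrite ler_pM2r ?invr_gt0 ?ltr0n // ler_nat.
Qed.

Lemma gcd_sum_sum X q : (0 < X)%N -> gcd_sum h k A B X q =
  \sum_(1 <= r < X.+1) (divk k r)%:R * \sum_(1 <= m < X.+1 | ((r %| m)%N && (gcdn m q == gcdn h q)) &&
       (above_cutoff h B q m && (r%:R <= m%:R `^ A))) 1.
Proof.
move=> X0; rewrite /gcd_sum big_mkcond /=.
rewrite (eq_bigr (fun m => \sum_(r <- divisors m) if (gcdn m q == gcdn h q) && above_cutoff h B q m
   then (divk k r)%:R * (r%:R <= m%:R `^ A)%R%:R else 0)); last first.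
  by move=> m _; case: ifP => // _; rewrite big1.
rewrite (sum_divisors_swap (fun r m => if (gcdn m q == gcdn h q) && above_cutoff h B q m
   then (divk k r)%:R * (r%:R <= m%:R `^ A)%R%:R else 0)).
apply: eq_bigr => r _; rewrite big_distrr /= -big_mkcondr [LHS]big_mkcond [RHS]big_mkcond /=.
apply: eq_bigr => m _; rewrite andbA -andbA.
case: (r %| m)%N => //=; case: (gcdn m q == _) => //=; case: above_cutoff => //=.
by case: (_ <= _); rewrite ?mulr1 ?mulr0.
Qed.

End Truncated.
End Sieve.

(** * Assembling the estimates *)

Section Assembly.
Local Open Scope classical_set_scope.
Variable R : realType.
Variables (h k i : nat) (A B : R).
Hypotheses (h_gt0 : (0 < h)%N) (A_gt0 : 0 < A) (A_le1 : A <= 1) (B_gt0 : 0 < B) (B_le1 : B <= 1).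

Lemma logpow0E (Q : R) (q : nat) : (0 < q)%N -> logpow 0 (Q / q%:R) = (q%:R <= Q)%R%:R.
Proof.
move=> q0; rewrite /logpow ler_pdivlMr ?ltr0n // mul1r expr0 divr1.
by case: (q%:R <= Q).
Qed.

Lemma sqrt_cut_ind (Q : R) (q : nat) : 0 < Q ->
  (q%:R <= Q)%R%:R * sqrt_cut (q%:R / Q) = sqrt_cut (q%:R / Q).
Proof.
by move=> Q0; rewrite /sqrt_cut ler_pdivrMr // mul1r; case: (q%:R <= Q); rewrite ?mul1r ?mulr0.
Qed.

Lemma sqrt_ratio (X r : nat) : (0 < r <= X)%N ->
  (X%:R / r%:R) `^ 2^-1 = X%:R / r%:R * sqrt_cut (r%:R / X%:R) :> R.
Proof.
move=> /andP[r0 rX]; have rR : (0 : R) < r%:R by rewrite ltr0n.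
have XR : (0 : R) < X%:R by rewrite ltr0n (leq_trans r0).
rewrite /sqrt_cut ler_pdivrMr // mul1r ler_nat rX.
have t0 : 0 < X%:R / r%:R :> R by rewrite divr_gt0.
have -> : r%:R / X%:R = (X%:R / r%:R) `^ (-1) :> R by rewrite powR_inv1 ?(ltW t0) // invf_div.
rewrite -powRrM -[X in _ = X * _]powRr1 ?(ltW t0) // -powRD_gt0 //; congr (_ `^ _).
by field.
Qed.

Local Opaque sqrt_cut powR ln.

Lemma sum_linear3 (a b c d : R) (F G H : nat -> R) (M : nat) :
  d * (a * (\sum_(1 <= r < M) F r) + b * (\sum_(1 <= r < M) G r) + c * (\sum_(1 <= r < M) H r))
  = \sum_(1 <= r < M) d * (a * F r + b * G r + c * H r).
Proof. by rewrite -big_distrr /= !big_split /= -!big_distrr. Qed.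

Lemma class_sum_zero X q c : X%:R `^ B < q%:R -> class_sum h k A B X q c = 0.
Proof.
move=> Xq; rewrite /class_sum big_nat_cond big1 // => m /andP[/andP[m0 mX] /andP[_ l]].
have : q%:R <= X%:R `^ B.
  apply: le_trans l _; apply: le_powR_base; rewrite ?ler_nat ?(ltW B_gt0) //.
  by rewrite (leq_trans (leq_subr _ _)).
by rewrite leNgt Xq.
Qed.

Local Notation I Q q := ((q%:R <= Q)%R%:R : R).

Lemma gcd_sum_estimate (X q : nat) : (0 < X)%N -> (0 < q)%N -> q%:R <= X%:R `^ B ->
  `|gcd_sum h k A B X q / (totient (q %/ gcdn h q))%:R
     - X%:R * \sum_(1 <= r < X.+1) (divk k r)%:R * (pair_density R h q r * I (X%:R `^ A) r)|
  <= \sum_(1 <= r < X.+1) (divk k r)%:R * I (X%:R `^ A) r *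
      ((h%:R + X%:R * sqrt_cut (q%:R / X%:R `^ B) + X%:R * sqrt_cut (r%:R / X%:R `^ A)) * pair_density R h q r
       + 2 * ((X%:R / r%:R) `^ 2^-1 *
           (half_sigma R (q %/ gcdn h q) / (totient (q %/ gcdn h q))%:R))).
Proof.
move=> X0 q0 qX; rewrite gcd_sum_sum //.
have T0 : (0 : R) < (totient (q %/ gcdn h q))%:R.
  rewrite ltr0n totient_gt0 divn_gt0 ?gcdn_gt0 ?h_gt0 //.
  by apply: dvdn_leq => //; exact: dvdn_gcdr.
rewrite big_distrl big_distrr -sumrB /=; apply: le_trans (ler_norm_sum _ _ _) _.
apply: ler_sum_nat => r /andP[r0 rX].
have := truncated_count h_gt0 A_gt0 A_le1 B_gt0 B_le1 X0 q0 r0.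
rewrite /trunc_ind qX mul1r.
set N := \sum_(1 <= m < X.+1 | _) 1.
set T := (totient _)%:R in T0 *; set w := pair_density R h q r; set sg := half_sigma R _.
move: (sqrt_cut (q%:R / X%:R `^ B)) (sqrt_cut (r%:R / X%:R `^ A)) ((X%:R / r%:R) `^ 2^-1) => a b c.
move: (nat_of_bool (r%:R <= X%:R `^ A))%:R => t H.
have -> : (divk k r)%:R * N / T - X%:R * ((divk k r)%:R * (w * t)) =
   (divk k r)%:R * ((N - X%:R * T * w * t) / T) by field; rewrite gt_eqF.
rewrite normrM normr_nat -[leRHS]mulrA; apply: ler_wpM2l; first exact: ler0n.
rewrite normrM [`|T^-1|]ger0_norm ?invr_ge0 ?(ltW T0) // ler_pdivrMr //.
apply: le_trans H _; rewrite le_eqVlt; apply/orP; left; apply/eqP.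
by field; rewrite gt_eqF.
Qed.

(** The five errors are, in order: averaging over classes, the shift by h, the cut-off q <= n^B, the
    cut-off r <= m^A, and rounding in the sieve. The factor h / q comes from [pair_density_le] and
    [sieve_weight_le]. *)
Lemma q_estimate (X q : nat) (E : R) : (0 < X)%N -> (0 < q < X.+1)%N -> 0 <= E ->
  `|class_sum h k A B X q h - gcd_sum h k A B X q / (totient (q %/ gcdn h q))%:R| <=
      E / (totient (q %/ gcdn h q))%:R ->
  (divk i q)%:R * `|class_sum h k A B X q h
     - X%:R * (I (X%:R `^ B) q * \sum_(1 <= r < X.+1) (divk k r)%:R * (pair_density R h q r * I (X%:R `^ A) r))|
  <= h%:R * (E * ((divk i q)%:R / q%:R * logpow 0 (X%:R `^ B / q%:R) * sieve_weight R q)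
     + h%:R * logsum X.+1 k 0 (X%:R `^ A) 1 * ((divk i q)%:R / q%:R * logpow 0 (X%:R `^ B / q%:R))
     + X%:R * logsum X.+1 k 0 (X%:R `^ A) 1 * ((divk i q)%:R / q%:R * sqrt_cut (q%:R / X%:R `^ B))
     + X%:R * sqrtsum X.+1 k (X%:R `^ A) * ((divk i q)%:R / q%:R * logpow 0 (X%:R `^ B / q%:R))
     + 2 * X%:R * sqrtsum X.+1 k X%:R * ((divk i q)%:R / q%:R * logpow 0 (X%:R `^ B / q%:R) * sieve_weight R q)).
Proof.
move=> X0 /andP[q0 qX1] E0 H; rewrite logpow0E //.
have sw0 : 0 <= sieve_weight R q.
  by apply: mulr_ge0; apply: divsum_ge0 => d; [exact: powR_ge0|exact: divr_ge0].
have Rs0 (Q : R) : 0 <= sqrtsum X.+1 k Q.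
  by apply: sumr_ge0 => r _; apply: mulr_ge0; [exact: divr_ge0|exact: sqrt_cut_ge0].
have Sa0 := logsum_ge0 X.+1 k 0 (X%:R `^ A) 1.
have a0 := sqrt_cut_ge0 (q%:R / X%:R `^ B).
have dq0 : 0 <= (divk i q)%:R / q%:R :> R by exact: divr_ge0.
have [qX|qX] := leP q%:R (X%:R `^ B); last first.
  rewrite class_sum_zero // mul0r mulr0 subrr normr0 mulr0 mulr0 mul0r !mulr0 add0r addr0.
  apply: mulr_ge0; first exact: ler0n.
  rewrite add0r addr0; apply: mulr_ge0; last exact: mulr_ge0.
  by apply: mulr_ge0 => //; exact: ler0n.
rewrite !mulr1 mul1r.
have sT := sieve_weight_le R h_gt0 q0.
have T0 : (0 : R) < (totient (q %/ gcdn h q))%:R.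
  rewrite ltr0n totient_gt0 divn_gt0 ?gcdn_gt0 ?h_gt0 //.
  by apply: dvdn_leq => //; exact: dvdn_gcdr.
have n0 : (0 < q %/ gcdn h q)%N.
  by rewrite divn_gt0 ?gcdn_gt0 ?h_gt0 // dvdn_leq // dvdn_gcdr.
have s1 := half_sigma_ge1 R n0.
have qR : (0 : R) < q%:R by rewrite ltr0n.
have hq0 : 0 <= h%:R / q%:R :> R by exact: divr_ge0.
(* As [half_sigma] is at least 1, [sieve_weight_le] bounds the bare 1 / phi too. *)
have H1 : E / (totient (q %/ gcdn h q))%:R <= E * (h%:R / q%:R * sieve_weight R q).
  apply: ler_wpM2l => //; apply: le_trans sT; rewrite -[leLHS]mul1r.
  by apply: ler_wpM2r; rewrite // invr_ge0 ltW.
have H2 := gcd_sum_estimate X0 q0 qX.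
have H3 : \sum_(1 <= r < X.+1) (divk k r)%:R * I (X%:R `^ A) r *
      ((h%:R + X%:R * sqrt_cut (q%:R / X%:R `^ B) + X%:R * sqrt_cut (r%:R / X%:R `^ A)) * pair_density R h q r
       + 2 * ((X%:R / r%:R) `^ 2^-1 *
           (half_sigma R (q %/ gcdn h q) / (totient (q %/ gcdn h q))%:R))) <=
   h%:R / q%:R * ((h%:R + X%:R * sqrt_cut (q%:R / X%:R `^ B)) * logsum X.+1 k 0 (X%:R `^ A) 1
      + X%:R * sqrtsum X.+1 k (X%:R `^ A) + 2 * X%:R * sieve_weight R q * sqrtsum X.+1 k X%:R).
  have XA0 : 0 < X%:R `^ A by rewrite powR_gt0 // ltr0n.
  rewrite logsum_bool /sqrtsum sum_linear3.
  apply: ler_sum_nat => r /andP[r0 rX]; rewrite dvd1n mul1r logpow0E //.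
  have rR : (0 : R) < r%:R by rewrite ltr0n.
  have wl := pair_density_le R q r h_gt0.
  rewrite sqrt_ratio ?r0 // -[sqrt_cut (r%:R / X%:R `^ A)]sqrt_cut_ind //.
  have t01 : 0 <= I (X%:R `^ A) r <= 1 by rewrite ler0n lern1 leq_b1.
  have tt : I (X%:R `^ A) r * I (X%:R `^ A) r = I (X%:R `^ A) r.
    by case: (_ <= _); rewrite ?mulr1 ?mulr0.
  have b0 := sqrt_cut_ge0 (r%:R / X%:R `^ A); have e0 := sqrt_cut_ge0 (r%:R / X%:R : R).
  have w0 := pair_density_ge0 R h q r.
  move: sT wl t01 tt a0 b0 e0 w0; move: (half_sigma R _ / _) => sT sTle.
  move: (pair_density R h q r) (I (X%:R `^ A) r) (sqrt_cut (q%:R / X%:R `^ B)) (sqrt_cut (r%:R / X%:R `^ A))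
     (sqrt_cut (r%:R / X%:R)) => w t a b e wl /andP[t0 t1] tt a0 b0 e0 w0.
  have d0 : 0 <= (divk k r)%:R :> R by exact: ler0n.
  have D : 0 <= (divk k r)%:R / r%:R :> R by exact: divr_ge0.
  have h0 : 0 <= h%:R :> R by exact: ler0n.
  have x0 : 0 <= X%:R :> R by exact: ler0n.
  have part1 : (divk k r)%:R * t * ((h%:R + X%:R * a + X%:R * (t * b)) * w) <=
      h%:R / q%:R * ((h%:R + X%:R * a) * ((divk k r)%:R / r%:R * t) + X%:R * ((divk k r)%:R / r%:R * (t * b))).
    apply: (@le_trans _ _ ((divk k r)%:R * t * ((h%:R + X%:R * a + X%:R * (t * b)) * (h%:R / (q%:R * r%:R))))).
      apply: ler_wpM2l; first exact: mulr_ge0.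
      apply: ler_wpM2l => //; apply: addr_ge0; last by rewrite !mulr_ge0.
      by apply: addr_ge0 => //; exact: mulr_ge0.
    rewrite le_eqVlt; apply/orP; left; apply/eqP.
    rewrite [LHS](_ : _ = h%:R / q%:R * ((h%:R + X%:R * a) * ((divk k r)%:R / r%:R * t) + X%:R * ((divk k r)%:R / r%:R * (t * t * b)))).
      by rewrite tt.
    by field; rewrite !gt_eqF.
  have part2 : (divk k r)%:R * t * (2 * (X%:R / r%:R * e * sT)) <=
      h%:R / q%:R * (2 * X%:R * sieve_weight R q * ((divk k r)%:R / r%:R * e)).
    rewrite [leLHS](_ : _ = (2 * X%:R * ((divk k r)%:R / r%:R * e)) * (t * sT)); last first.
      by field; rewrite gt_eqF.
    rewrite [leRHS](_ : _ = (2 * X%:R * ((divk k r)%:R / r%:R * e)) * (h%:R / q%:R * sieve_weight R q)); last first.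
      by field; rewrite !gt_eqF.
    apply: ler_wpM2l; first by rewrite !mulr_ge0.
    have sw : 0 <= h%:R / q%:R * sieve_weight R q by exact: mulr_ge0.
    apply: (@le_trans _ _ (t * (h%:R / q%:R * sieve_weight R q))).
      exact: ler_wpM2l.
    by apply: ler_piMl.
  rewrite mulrDr; apply: le_trans (lerD part1 part2) _.
  by rewrite -mulrDr.
have H4 : `|class_sum h k A B X q h - X%:R * (\sum_(1 <= r < X.+1) (divk k r)%:R * (pair_density R h q r * I (X%:R `^ A) r))| <=
   E * (h%:R / q%:R * sieve_weight R q) + h%:R / q%:R * ((h%:R + X%:R * sqrt_cut (q%:R / X%:R `^ B)) * logsum X.+1 k 0 (X%:R `^ A) 1
      + X%:R * sqrtsum X.+1 k (X%:R `^ A) + 2 * X%:R * sieve_weight R q * sqrtsum X.+1 k X%:R).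
  apply: le_trans (ler_distD (gcd_sum h k A B X q / (totient (q %/ gcdn h q))%:R) _ _) _.
  by apply: lerD; [exact: le_trans H H1|exact: le_trans H2 H3].
apply: le_trans (ler_wpM2l (ler0n R (divk i q)) H4) _.
rewrite le_eqVlt; apply/orP; left; apply/eqP.
move: (sieve_weight R q) (sqrt_cut (q%:R / X%:R `^ B)) (logsum X.+1 k 0 (X%:R `^ A) 1) (sqrtsum X.+1 k (X%:R `^ A)) (sqrtsum X.+1 k X%:R) => sw a S1 S2 S3.
by field; rewrite gt_eqF.
Qed.

Definition shifted_sum (X : nat) : R := \sum_(1 <= q < X.+1) (divk i q)%:R * class_sum h k A B X q h.

Lemma shifted_sum_estimate (X : nat) (E : R) : (0 < X)%N -> 0 <= E ->
  (forall q, (0 < q)%N ->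
    `|class_sum h k A B X q h - gcd_sum h k A B X q / (totient (q %/ gcdn h q))%:R| <=
      E / (totient (q %/ gcdn h q))%:R) ->
  `|shifted_sum X - X%:R * pair_sum X.+1 (X%:R `^ B) (X%:R `^ A) h i k| <=
  h%:R * (E * (\sum_(1 <= q < X.+1) (divk i q)%:R / q%:R * logpow 0 (X%:R `^ B / q%:R) * sieve_weight R q)
     + h%:R * logsum X.+1 k 0 (X%:R `^ A) 1 * logsum X.+1 i 0 (X%:R `^ B) 1
     + X%:R * logsum X.+1 k 0 (X%:R `^ A) 1 * sqrtsum X.+1 i (X%:R `^ B)
     + X%:R * sqrtsum X.+1 k (X%:R `^ A) * logsum X.+1 i 0 (X%:R `^ B) 1
     + 2 * X%:R * sqrtsum X.+1 k X%:R * (\sum_(1 <= q < X.+1) (divk i q)%:R / q%:R * logpow 0 (X%:R `^ B / q%:R) * sieve_weight R q)).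
Proof.
move=> X0 E0 H.
have -> : shifted_sum X - X%:R * pair_sum X.+1 (X%:R `^ B) (X%:R `^ A) h i k =
   \sum_(1 <= q < X.+1) (divk i q)%:R * (class_sum h k A B X q h
     - X%:R * (I (X%:R `^ B) q * \sum_(1 <= r < X.+1) (divk k r)%:R * (pair_density R h q r * I (X%:R `^ A) r))).
  rewrite /shifted_sum /pair_sum [X in _ - X]big_distrr /= -sumrB; apply: eq_big_nat => q /andP[q0 _].
  rewrite mulrBr; congr (_ - _); rewrite [RHS]mulrCA; congr (_ * _).
  rewrite !big_distrr /=; apply: eq_big_nat => r /andP[r0 _]; rewrite !logpow0E // /pair_density.
  have qR : (q%:R : R) != 0 by rewrite pnatr_eq0 -lt0n.
  have rR : (r%:R : R) != 0 by rewrite pnatr_eq0 -lt0n.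
  move: (I (X%:R `^ B) q) (I (X%:R `^ A) r) => s t.
  by field; rewrite qR rR.
apply: le_trans (ler_norm_sum _ _ _) _.
apply: (@le_trans _ _ (\sum_(1 <= q < X.+1) h%:R * (E * ((divk i q)%:R / q%:R * logpow 0 (X%:R `^ B / q%:R) * sieve_weight R q)
     + h%:R * logsum X.+1 k 0 (X%:R `^ A) 1 * ((divk i q)%:R / q%:R * logpow 0 (X%:R `^ B / q%:R))
     + X%:R * logsum X.+1 k 0 (X%:R `^ A) 1 * ((divk i q)%:R / q%:R * sqrt_cut (q%:R / X%:R `^ B))
     + X%:R * sqrtsum X.+1 k (X%:R `^ A) * ((divk i q)%:R / q%:R * logpow 0 (X%:R `^ B / q%:R))
     + 2 * X%:R * sqrtsum X.+1 k X%:R * ((divk i q)%:R / q%:R * logpow 0 (X%:R `^ B / q%:R) * sieve_weight R q)))).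
  apply: ler_sum_nat => q qX; rewrite normrM normr_nat.
  by apply: q_estimate => //; apply: H; case/andP: qX.
rewrite -big_distrr /= !big_split /= -!big_distrr /=.
have -> : logsum X.+1 i 0 (X%:R `^ B) 1 =
    \sum_(1 <= q < X.+1) (divk i q)%:R / q%:R * logpow 0 (X%:R `^ B / q%:R).
  by rewrite logsum_bool; apply: eq_bigr => q _; rewrite dvd1n mul1r.
exact: lexx.
Qed.

End Assembly.

(** * The asymptotic formula and the return to the original sum *)

Section Asymptotics.
Local Open Scope classical_set_scope.
Variable R : realType.

(** In use, v is 1 / (1 + ln X), and Pi, Pk are the i-th and k-th powers of 1 + ln X. Each of the
    five products gains one factor v: from the power saving in E, from the lower bound on X v, or
    from one of Ri, Rk, Rx. *)
Lemma combine_errors (X Pi Pk v h E G Dk Di Ri Rk Rx K0 C KF Kd Ke Kri Krk Krx C2 : R) :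
  0 <= X -> 1 <= Pi -> 1 <= Pk -> 0 <= v -> 0 <= h ->
  0 <= E -> 0 <= G -> 0 <= Dk -> 0 <= Di -> 0 <= Ri -> 0 <= Rk -> 0 <= Rx ->
  0 <= C2 -> 0 <= Kd -> 0 <= Ke -> 0 <= KF -> 0 <= K0 -> 0 <= C ->
  E <= K0 * (X * (C * v)) -> G <= KF * Pi -> Dk <= Kd * Pk -> Di <= Ke * Pi ->
  Ri <= Kri * (Pi * v) -> Rk <= Krk * (Pk * v) -> Rx <= Krx * (Pk * v) -> 1 <= C2 * (X * v) ->
  h * (E * G + h * Dk * Di + X * Dk * Ri + X * Rk * Di + 2 * X * Rx * G) <=
  h * (K0 * C * KF + h * Kd * Ke * C2 + Kd * Kri + Krk * Ke + 2 * Krx * KF) * (X * (Pi * Pk * v)).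
Proof.
move=> X0 Pi1 Pk1 v0 h0 E0 G0 Dk0 Di0 Ri0 Rk0 Rx0 C20 Kd0 Ke0 KF0 K00 C0 hE hG hDk hDi hRi hRk hRx h1.
have Pi0 := le_trans ler01 Pi1; have Pk0 := le_trans ler01 Pk1.
rewrite -[leRHS]mulrA; apply: ler_wpM2l => //; rewrite 4![in leRHS]mulrDl.
apply: lerD; [apply: lerD; [apply: lerD; [apply: lerD|]|]|].
- apply: le_trans (ler_pM E0 G0 hE hG) _.
  rewrite [leLHS](_ : _ = K0 * C * KF * (X * (Pi * 1 * v))); last by ring.
  apply: ler_wpM2l; first by rewrite !mulr_ge0.
  by apply: ler_wpM2l => //; rewrite ler_wpM2r // ler_wpM2l.
- have := ler_wpM2l h0 (ler_pM Dk0 Di0 hDk hDi) => h2; rewrite -mulrA; apply: le_trans h2 _.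
  rewrite [leLHS](_ : _ = h * Kd * Ke * Pi * Pk * 1); last by ring.
  rewrite [leRHS](_ : _ = h * Kd * Ke * Pi * Pk * (C2 * (X * v))); last by ring.
  by apply: ler_wpM2l; rewrite ?mulr_ge0.
- rewrite -mulrA; apply: le_trans (ler_wpM2l X0 (ler_pM Dk0 Ri0 hDk hRi)) _.
  by rewrite le_eqVlt; apply/orP; left; apply/eqP; ring.
- rewrite -mulrA; apply: le_trans (ler_wpM2l X0 (ler_pM Rk0 Di0 hRk hDi)) _.
  by rewrite le_eqVlt; apply/orP; left; apply/eqP; ring.
have X20 : 0 <= 2 * X by rewrite mulr_ge0.
rewrite -mulrA; apply: le_trans (ler_wpM2l X20 (ler_pM Rx0 G0 hRx hG)) _.
by rewrite le_eqVlt; apply/orP; left; apply/eqP; ring.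
Qed.

Variables (h k i : nat) (A B : R).
Hypotheses (h_gt0 : (0 < h)%N) (A_gt0 : 0 < A) (A_le1 : A <= 1) (B_gt0 : 0 < B) (B_le1 : B <= 1).

Lemma ln_powR_bounds (X c : R) : 1 <= X -> 0 < c <= 1 ->
  [/\ 1 <= X `^ c, X `^ c <= X, 1 <= 1 + ln (X `^ c), 1 + ln (X `^ c) <= 1 + ln X &
      1 + ln X <= c^-1 * (1 + ln (X `^ c))].
Proof.
move=> X1 /andP[c0 c1]; have l0 := ln_ge0 X1.
have p1 : 1 <= X `^ c by rewrite -[leLHS](powRr0 X) ler_powR // ltW.
have pX : X `^ c <= X by rewrite -[leRHS]powRr1 ?(le_trans ler01) // ler_powR.
split=> //.
- by rewrite lerDl ln_ge0.
- by rewrite lerD2l ln_powR ler_piMl.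
rewrite ln_powR mulrDr mulr1 mulrA mulVf ?gt_eqF // mul1r lerD2r.
by rewrite invf_ge1.
Qed.

Lemma shifted_sum_asym (theta_k theta_k1 S : R) :
  exponent_of_distribution k.+1 theta_k -> exponent_of_distribution k theta_k1 ->
  B < theta_k -> B < A * theta_k1 ->
  (fun N : nat => \sum_(1 <= d < N) singular_term R h i k d) @ \oo --> S ->
  exists2 K : R, 0 <= K & forall X : nat, (0 < X)%N ->
    `|shifted_sum h k i A B X - X%:R * (S * (logpow i (X%:R `^ B) * logpow k (X%:R `^ A)))|
    <= K * (X%:R * ((1 + ln X%:R) ^+ (i + k) / (1 + ln X%:R))).
Proof.
move=> E1 E2 B1 B2 cS.
have [d d0 [K0 K00 H0]] := average_close h_gt0 A_gt0 A_le1 B_gt0 E1 E2 B1 B2.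
(* 1 + ln X is at most A^-1 (1 + ln X^A) and at most B^-1 (1 + ln X^B); one c serves both. *)
pose c : R := A^-1 + B^-1.
have Ai0 : 0 <= A^-1 by rewrite invr_ge0 ltW.
have Bi0 : 0 <= B^-1 by rewrite invr_ge0 ltW.
have c0 : 0 < c by rewrite /c addr_gt0 ?invr_gt0.
have [KW KW0 HW] := pair_sum_asym h_gt0 c0 cS.
have [KF KF0 HF] := sieve_weight_bound R i.
have [Kd Kd0 Hd] := logsum_upper R k 0; have [Ke Ke0 He] := logsum_upper R i 0.
have [Kr Kr0 Hr] := sqrtsum_bound R k; have [Ks Ks0 Hs] := sqrtsum_bound R i.
(* C converts the power saving X^(-d) into 1 / (1 + ln X); C2 bounds X / (1 + ln X) from below, for
   the error term without a factor X. *)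
have [C C0 HC] := ln_pow_bound 1 d0; have [C2 C20 HC2] := ln_pow_bound 1 (ltr01 : 0 < (1 : R)).
pose Kd' := Kd * logsum_majorant R k 1; pose Ke' := Ke * logsum_majorant R i 1.
have Kd'0 : 0 <= Kd' by apply: mulr_ge0 => //; exact: logsum_majorant_ge0.
have Ke'0 : 0 <= Ke' by apply: mulr_ge0 => //; exact: logsum_majorant_ge0.
pose KE := h%:R * (K0 * C * KF + h%:R * Kd' * Ke' * C2 + Kd' * (Ks * c) + (Kr * c) * Ke' + 2 * Kr * KF).
have [C0' C20' c0'] : [/\ 0 <= C, 0 <= C2 & 0 <= c] by split; exact: ltW.
have KE0 : 0 <= KE by rewrite /KE; repeat first [done | apply: addr_ge0 | apply: mulr_ge0].
exists (KE + KW) => [|X X0]; first exact: addr_ge0.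
have X1 : (1 : R) <= X%:R by rewrite ler1n.
have XR : (0 : R) < X%:R by rewrite ltr0n.
have XM : (X%:R : R) < X.+1%:R by rewrite ltr_nat.
have Ab : 0 < A <= 1 by rewrite A_gt0.
have Bb : 0 < B <= 1 by rewrite B_gt0.
have [a1 a2 a3 a4 a5] := ln_powR_bounds X1 Ab; have [b1 b2 b3 b4 b5] := ln_powR_bounds X1 Bb.
have aM : 1 <= X%:R `^ A < X.+1%:R by rewrite a1 (le_lt_trans a2).
have bM : 1 <= X%:R `^ B < X.+1%:R by rewrite b1 (le_lt_trans b2).
have xM : 1 <= (X%:R : R) < (X.+1%:R : R) by rewrite X1 XM.
have a5' : 1 + ln X%:R <= c * (1 + ln (X%:R `^ A)).
  by apply: le_trans a5 _; apply: ler_wpM2r; [exact: le_trans ler01 a3|rewrite lerDl].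
have b5' : 1 + ln X%:R <= c * (1 + ln (X%:R `^ B)).
  by apply: le_trans b5 _; apply: ler_wpM2r; [exact: le_trans ler01 b3|rewrite lerDr].
have mono j Q : 1 <= 1 + ln Q -> 1 + ln Q <= 1 + ln X%:R -> (1 + ln Q) ^+ j <= (1 + ln X%:R) ^+ j :> R.
  by move=> q1 q2; apply: lerXn2r => //; rewrite nnegrE (le_trans ler01) // (le_trans q1).
have gE : forall q, (0 < q)%N ->
    `|class_sum h k A B X q h - gcd_sum h k A B X q / (totient (q %/ gcdn h q))%:R| <=
      K0 * X%:R `^ (1 - d) / (totient (q %/ gcdn h q))%:R.
  by move=> q q0; rewrite -mulrA; exact: H0.
have E0 : 0 <= K0 * X%:R `^ (1 - d) by apply: mulr_ge0 => //; exact: powR_ge0.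
have est := shifted_sum_estimate i h_gt0 A_gt0 A_le1 B_gt0 B_le1 X0 E0 gE.
have w := HW X.+1 _ _ X%:R b1 a1 b2 a2 XM b5' a5'.
have L1 : 1 <= 1 + ln X%:R :> R by rewrite lerDl ln_ge0.
have L0 : 0 < 1 + ln X%:R :> R := lt_le_trans ltr01 L1.
rewrite mulrDl.
apply: le_trans (ler_distD (X%:R * pair_sum X.+1 (X%:R `^ B) (X%:R `^ A) h i k) _ _) _.
apply: lerD; last first.
  rewrite -mulrBr normrM ger0_norm // [leRHS]mulrCA; apply: ler_wpM2l; first exact: ler0n.
  exact: w.
apply: le_trans est _.
have hG := HF X.+1 _ bM; have hD := Hd X.+1 _ 1%N aM isT; have hI := He X.+1 _ 1%N bM isT.
have hR1 := Hr X.+1 _ aM; have hR2 := Hr X.+1 _ xM; have hS := Hs X.+1 _ bM.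
have mA j := mono j _ a3 a4. have mB j := mono j _ b3 b4.
have sA := scale_log k a3 a4 a5'; have sB := scale_log i b3 b4 b5'.
rewrite exprD.
apply: combine_errors.
- exact: ler0n.
- exact: exprn_ege1.
- exact: exprn_ege1.
- by rewrite invr_ge0 ltW.
- exact: ler0n.
- exact: E0.
- apply: sumr_ge0 => q _; apply: mulr_ge0.
    by apply: mulr_ge0; [exact: divr_ge0|exact: logpow_ge0].
  by apply: mulr_ge0; apply: divsum_ge0 => e; [exact: powR_ge0|exact: divr_ge0].
- exact: logsum_ge0.
- exact: logsum_ge0.
- by apply: sumr_ge0 => q _; apply: mulr_ge0; [exact: divr_ge0|exact: sqrt_cut_ge0].
- by apply: sumr_ge0 => q _; apply: mulr_ge0; [exact: divr_ge0|exact: sqrt_cut_ge0].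
- by apply: sumr_ge0 => q _; apply: mulr_ge0; [exact: divr_ge0|exact: sqrt_cut_ge0].
- exact: ltW.
- exact: Kd'0.
- exact: Ke'0.
- exact: KF0.
- exact: K00.
- exact: ltW.
- apply: ler_wpM2l => //; rewrite powRD_gt0 // powRr1 ?(ltW XR) //.
  apply: ler_wpM2l; first exact: ltW.
  rewrite ler_pdivlMr // mulrC powRN ler_pdivrMr ?powR_gt0 //.
  by have := HC X%:R X1; rewrite expr1.
- by apply: le_trans hG _; apply: ler_wpM2l => //; exact: mB.
- by rewrite add0n in hD; apply: le_trans hD _; apply: ler_wpM2l => //; exact: mA.
- by rewrite add0n in hI; apply: le_trans hI _; apply: ler_wpM2l => //; exact: mB.
- by apply: le_trans hS _; rewrite -[leRHS]mulrA; apply: ler_wpM2l => //; exact: sB.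
- by apply: le_trans hR1 _; rewrite -[leRHS]mulrA; apply: ler_wpM2l => //; exact: sA.
- exact: hR2.
rewrite mulrA ler_pdivlMr // mul1r.
by have := HC2 X%:R X1; rewrite expr1 powRr1 ?(ltW XR).
Qed.

Lemma truncated_divisor_natE j (C : R) n : (0 < n)%N ->
  (partial_divisor_fun j.+1 n C)%:R = truncated_divisor j C n.
Proof.
move=> n0; rewrite /partial_divisor_fun /truncated_divisor natr_sum big_mkcond /= subn1 /=.
apply: eq_big_seq => q; rewrite -dvdn_divisors // => qn.
have q0 := dvdn_gt0 n0 qn.
by case: ifP => _; rewrite ?mulr1 ?mulr0 // divisor_funE.
Qed.

(** Under m = n + h the congruence m = h mod q says q | n; the terms m <= h vanish by the convention
    in [above_cutoff]. *)
Lemma shifted_sum_original (N : nat) :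
  (\sum_(1 <= n < N.+1)
      partial_divisor_fun k.+1 (n + h) A * partial_divisor_fun i.+1 n B)%N%:R
  = shifted_sum h k i A B (N + h).
Proof.
have zero q m : (0 < q)%N -> (m <= h)%N -> above_cutoff h B q m = false.
  move=> q0 mh; rewrite /above_cutoff (_ : (m - h)%N = 0%N); last by apply/eqP; rewrite subn_eq0.
  by rewrite powR0 ?gt_eqF // leNgt ltr0n q0.
rewrite /shifted_sum.
rewrite (eq_big_nat _ _ (F2 := fun q => \sum_(1 <= m < (N + h).+1)
   if (m == h %[mod q])%N && above_cutoff h B q m then (divk i q)%:R * truncated_divisor k A m else 0)); last first.
  by move=> q _; rewrite /class_sum big_distrr /= big_mkcond.
rewrite exchange_big_nat /=.
have h1 : (1 <= h.+1)%N by []. have h2 : (h.+1 <= (N + h).+1)%N by rewrite ltnS leq_addl.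
rewrite (big_cat_nat h1 h2) /= [X in _ = X + _]big_nat_cond [X in _ = X + _]big1 ?add0r; last first.
  move=> m /andP[/andP[_ mh] _]; rewrite big_nat_cond big1 // => q /andP[/andP[q0 _] _].
  by rewrite zero // andbF.
rewrite -[h.+1]add1n -[(N + h).+1]addSn big_addn addnK natr_sum.
apply: eq_big_nat => n /andP[n0 nN].
rewrite natrM !truncated_divisor_natE ?addn_gt0 ?n0 //.
have -> : truncated_divisor i B n = \sum_(1 <= q < N.+1 + h)
    (divk i q)%:R * (q%:R <= n%:R `^ B)%R%:R * (q %| n)%N%:R.
  rewrite -(@divsum_bool R (fun q => (divk i q)%:R * (q%:R <= n%:R `^ B)%R%:R)) //.
  by rewrite n0 (leq_trans nN) // leq_addr.
rewrite mulrC big_distrl /=; apply: eq_bigr => q _.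
rewrite /above_cutoff addnK -[in (_ == _ %[mod q])%N](add0n h) eqn_modDr mod0n -/(dvdn q n).
by case: (dvdn q n); case: (_ <= _); rewrite /= ?mulr1 ?mulr0 ?mul0r.
Qed.

(** X - x is at most h, and so is x (ln X - ln x); the mean value inequality handles the power of
    the logarithm. *)
Lemma main_shift (m : nat) (x X : R) : 1 <= ln x -> 0 < x -> x <= X -> X <= x + h%:R ->
  `|X * ln X ^+ m - x * ln x ^+ m| <= (m.+1)%:R * h%:R * ln X ^+ m.
Proof.
move=> lx x0 xX Xh; have X0 : 0 < X := lt_le_trans x0 xX.
have lxX : ln x <= ln X by rewrite ler_ln ?posrE.
have lX1 : 1 <= ln X := le_trans lx lxX.
have lx0 : 0 <= ln x := le_trans ler01 lx.
have pp : ln x ^+ m <= ln X ^+ m by rewrite lerXn2r ?nnegrE // (le_trans ler01).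
have pX : 0 <= ln X ^+ m by rewrite exprn_ge0 // (le_trans ler01).
have px : 0 <= ln x ^+ m by rewrite exprn_ge0.
have mm : x * (ln X ^+ m - ln x ^+ m) <= m%:R * h%:R * ln X ^+ m.
  have dl : x * (ln X - ln x) <= h%:R.
    have -> : ln X - ln x = ln (1 + (X - x) / x).
      rewrite -ln_div ?posrE //; congr ln; field; exact: lt0r_neq0.
    apply: (@le_trans _ _ (x * ((X - x) / x))).
      apply: ler_wpM2l; first exact: ltW.
      by apply: le_ln1Dx; apply: (@lt_le_trans _ _ 0); rewrite ?ltrN10 // divr_ge0 ?subr_ge0 // ltW.
    by rewrite mulrC divfK ?lt0r_neq0 // lerBlDl.
  case: m pp pX px => [|m] pp pX px; first by rewrite !expr0 subrr mulr0 !mul0r.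
  have /andP[_] := pow_diff m lx0 lxX.
  have F0 : (0 : R) < m`!%:R by rewrite ltr0n fact_gt0.
  have S0 : (0 : R) < m.+1%:R by [].
  rewrite factS natrM -mulrBl ler_pdivrMr ?mulr_gt0 //.
  rewrite [leRHS](_ : _ = m.+1%:R * (ln X ^+ m * (ln X - ln x))); last first.
    by field; rewrite gt_eqF.
  move=> dm; apply: le_trans (ler_wpM2l (ltW x0) dm) _.
  rewrite [leLHS](_ : _ = m.+1%:R * (x * (ln X - ln x)) * ln X ^+ m); last by ring.
  apply: ler_pM.
  - by rewrite !mulr_ge0 ?subr_ge0 // ltW.
  - by rewrite exprn_ge0 // (le_trans ler01).
  - exact: ler_wpM2l.
  by rewrite exprS ler_peMl // exprn_ge0 // (le_trans ler01).
rewrite ger0_norm; last by rewrite subr_ge0 ler_pM // ltW.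
have -> : X * ln X ^+ m - x * ln x ^+ m = (X - x) * ln X ^+ m + x * (ln X ^+ m - ln x ^+ m) by ring.
rewrite [leRHS](_ : _ = h%:R * ln X ^+ m + m%:R * h%:R * ln X ^+ m); last first.
  by rewrite -natr1; ring.
apply: lerD => //.
by apply: ler_wpM2r => //; rewrite lerBlDl.
Qed.

End Asymptotics.

Lemma exponent_nat (k i : nat) : (k.+1 + i.+1 - 2)%N = (i + k)%N.
Proof. by rewrite addSn addnS subn2 addnC. Qed.

(** The exponent is taken in Z because it is -1 when both indices of the theorem are 1. *)
Lemma exponent_int (k i : nat) : (k.+1 + i.+1)%:Z - 3 = (i + k)%N%:Z + (-1).
Proof. by lia. Qed.

Unset Implicit Arguments.

Theorem theorem1p4 (R : realType) (h k l : nat) (theta_k theta_k1 A B : R)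
    (h_gt0 : (0 < h)%N) (k_gt0 : (0 < k)%N) (l_gt0 : (0 < l)%N)
    (theta_kP : exponent_of_distribution k theta_k)
    (theta_k1P : exponent_of_distribution (k - 1) theta_k1)
    (A_gt0 : 0 < A) (A_le1 : A <= 1)
    (B_gt0 : 0 < B) (B_lt : B < Num.min theta_k (A * theta_k1)) :
  exists K : R, \forall x \near +oo_R,
    `| (\sum_(1 <= n < (Num.truncn x).+1)
          partial_divisor_fun k (n + h) A * partial_divisor_fun l n B)%N%:R
       - A ^+ (k - 1) * B ^+ (l - 1)
         * singular_constant R k l * singular_factor R k l h
         / ((k - 1)`! * (l - 1)`!)%N%:R
         * (x * ln x ^+ (k + l - 2)) |
    <= K * (x * ln x ^ ((k + l)%:Z - 3)).
Proof.
case: k k_gt0 theta_kP theta_k1P => // k _ E1; rewrite subn1 /= => E2.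
case: l l_gt0 => // i _; rewrite subn1 /=.
move: B_lt; rewrite lt_min => /andP[B1 B2].
have [/andP[th0 th1] _] := E1 1%N isT.
have B_le1 : B <= 1 := le_trans (ltW B1) th1.
have [C C0 HC] := singular_term_bound R i k h_gt0.
have e0 : 0 < 2^-1 :> R by rewrite invr_gt0.
have [S cS _] := abs_series e0 C0 HC.
have SE := singular_series h_gt0 cS.
have [K K0 HK] := shifted_sum_asym h_gt0 A_gt0 A_le1 B_gt0 B_le1 E1 E2 B1 B2 cS.
pose m := (i + k)%N.
pose D : R := A ^+ k * B ^+ i * S / (k`! * i`!)%N%:R.
(* With X = floor(x) + h and x large, X <= 2 x and 1 + ln X <= 3 ln x give the first summand; the
   second pays for replacing X by x in the main term, using ln X <= 2 ln x. *)
exists (K * 2 * 3 ^+ m + `|D| * (m.+1%:R * h%:R * 2 ^+ m)).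
(* This threshold ensures ln x >= 1, x >= 2 and h <= x, whence X <= 2 x <= x^2. *)
have x0 : \forall x \near +oo_R, expR 1 + 2 + h%:R <= x.
  by apply: nbhs_pinfty_ge; rewrite num_real.
apply: filterS x0 => x hx.
have ex0 := expR_gt0 (1 : R).
have h0 : 0 <= h%:R :> R by exact: ler0n.
have x2 : 2 <= x by lra.
have xh : h%:R <= x by lra.
have xe : expR 1 <= x by lra.
have x_gt0 : 0 < x by lra.
have lx1 : 1 <= ln x by rewrite -[leLHS](expRK (1 : R)) ler_ln // posrE.
have lx0 : 0 < ln x := lt_le_trans ltr01 lx1.
(* As h >= 1, x < N + 1 <= X, so that x <= X <= x + h. *)
pose N := Num.truncn x; pose X := (N + h)%N.
have /andP[Nx xN] : N%:R <= x < N.+1%:R by apply: truncn_itv; exact: ltW.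
have X_gt0 : (0 < X)%N by rewrite addn_gt0 h_gt0 orbT.
have xX : x <= X%:R.
  apply: ltW; apply: lt_le_trans xN _; rewrite ler_nat /X -addn1 leq_add2l.
  exact: h_gt0.
have Xx : X%:R <= x + h%:R by rewrite natrD lerD2r.
have X1 : (1 : R) <= X%:R by rewrite ler1n.
have XR : (0 : R) < X%:R by rewrite ltr0n.
have lX : ln X%:R <= 2 * ln x.
  have -> : 2 * ln x = ln (x * x) by rewrite lnM ?posrE // mulr_natl mulr2n.
  rewrite ler_ln ?posrE ?mulr_gt0 //; apply: le_trans Xx _.
  apply: (@le_trans _ _ (2 * x)); first lra.
  by rewrite ler_pM2r.
have lXx : ln x <= ln X%:R by rewrite ler_ln ?posrE.
have X2 : X%:R <= 2 * x by lra.
have L3 : 1 + ln X%:R <= 3 * ln x by lra.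
have lL : ln x <= 1 + ln X%:R by lra.
rewrite -[Num.truncn x]/N shifted_sum_original // -/X.
have st := HK X X_gt0.
have plE : X%:R * (S * (logpow i (X%:R `^ B) * logpow k (X%:R `^ A))) = D * (X%:R * ln X%:R ^+ m).
  have Bb : 0 < B <= 1 by rewrite B_gt0.
  have Ab : 0 < A <= 1 by rewrite A_gt0.
  have [a1 _ _ _ _] := ln_powR_bounds X1 Ab; have [b1 _ _ _ _] := ln_powR_bounds X1 Bb.
  rewrite !logpow_ge1 // !ln_powR !exprMn /D /m exprD natrM.
  have F1 : (k`!%:R : R) != 0 by rewrite pnatr_eq0 -lt0n fact_gt0.
  have F2 : (i`!%:R : R) != 0 by rewrite pnatr_eq0 -lt0n fact_gt0.
  by field; rewrite F1 F2.
rewrite plE in st.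
have -> : A ^+ k * B ^+ i * singular_constant R k.+1 i.+1 * singular_factor R k.+1 i.+1 h
   / (k`! * i`!)%N%:R * (x * ln x ^+ (k.+1 + i.+1 - 2)) = D * (x * ln x ^+ m).
  by rewrite -[in RHS]/m exponent_nat /D SE !mulrA.
have -> : ln x ^ ((k.+1 + i.+1)%:Z - 3) = ln x ^+ m / ln x.
  by rewrite exponent_int expfzDr ?gt_eqF // exprN1.
apply: le_trans (ler_distD (D * (X%:R * ln X%:R ^+ m)) _ _) _.
have pm0 : 0 <= ln x ^+ m by rewrite exprn_ge0 // ltW.
rewrite mulrDl; apply: lerD.
  apply: le_trans st _; rewrite -!mulrA; apply: ler_wpM2l => //.
  rewrite [leRHS](_ : _ = (2 * x) * (3 ^+ m * ln x ^+ m / ln x)); last first.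
    by field; rewrite gt_eqF.
  have L1 : 1 <= 1 + ln X%:R :> R by rewrite lerDl ln_ge0.
  apply: ler_pM => //.
  by rewrite divr_ge0 ?exprn_ge0 // (le_trans ler01).
  apply: ler_pM.
  - by rewrite exprn_ge0 // (le_trans ler01).
  - by rewrite invr_ge0 (le_trans ler01).
  - rewrite -exprMn lerXn2r ?nnegrE ?(le_trans ler01 L1) //.
    by rewrite mulr_ge0 // ltW.
  by rewrite lef_pV2 ?posrE ?(lt_le_trans ltr01 L1).
rewrite -mulrBr normrM -[leRHS]mulrA; apply: ler_wpM2l; first exact: normr_ge0.
apply: le_trans (main_shift m lx1 x_gt0 xX Xx) _.
rewrite [leRHS](_ : _ = m.+1%:R * h%:R * (2 ^+ m * (x * (ln x ^+ m / ln x)))); last by ring.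
apply: ler_wpM2l; first exact: mulr_ge0.
apply: (@le_trans _ _ ((2 * ln x) ^+ m)).
  by rewrite lerXn2r ?nnegrE ?ln_ge0 // mulr_ge0 // ltW.
rewrite exprMn; apply: ler_wpM2l; first exact: exprn_ge0.
(* The shift error log^m x is absorbed by x log^m x / log x because ln x <= x. *)
rewrite [leRHS]mulrCA ler_peMr // ler_pdivlMr // mul1r.
exact: ltW (ln_sublinear x_gt0).
Qed.
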